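(* Let $n=4$ and $\lambda=0$. There exists an open interval $I$ containing $0$ such that for each $\gamma\in I$ there is a pair $(\alpha,\beta)\in\mathbb{R}^2$ with: (1) $\alpha^2+\beta^2+\gamma^2=1$; (2) the solution $(\mathcal{L},X_1,X_2,X_3,Y_1,Y_2,Y_3)$ of the system $(F)$ starting at $\phi(\alpha,\beta,\gamma)$ exists for all $s>0$ and is convergent as $s\to\infty$; (3) $\lim_{s\to\infty}(\mathcal{L},X_1,X_2,X_3,Y_1,Y_2,Y_3)=(l,0,0,0,a,b,c)$ with $l>0$, and either $a=b$, $c=0$ or $a=c$, $b=0$.
   Context: The steady soliton system for $(\xi,L_1,L_2,L_3,R_1,R_2,R_3)$ in $r$ is $\xi'=-L_1^2-L_2^2-L_3^2$, $L_i'=-\xi L_i+\frac{R_i^2}{2}-\frac{(R_j-R_k)^2}{2}$, $R_i'=R_i(L_i-L_j-L_k)$, $\{i,j,k\}=\{1,2,3\}$ (it encodes $\mathrm{Ric}+\mathrm{Hess}(u)=0$ for $dr^2+\sum f_i^2\omega_i^2$ on $SU(2)/\mathbb{Z}_4$-principal orbits of $M=SU(2)\times_{U(1)}\mathbb{R}^2$, via $L_i=f_i'/f_i$, $R_i=f_i/(f_jf_k)$, $\xi=\sum f_i'/f_i-u'$). Standing fact: there are $T>0$ and a continuous $\phi:\mathbb{S}^2\to(1,\infty)\times\mathbb{R}^6$ such that for each $(\alpha,\beta,\gamma)\in\mathbb{S}^2$, $\phi(\alpha,\beta,\gamma)$ is the value at $r=T$ of the (unique) solution on $(0,T]$ of the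 form $\xi=\frac1r+\eta_0$, $L_1=\frac1r+\eta_1$, $L_2=\gamma+\eta_2$, $L_3=-\gamma+\eta_3$, $R_1=\eta_4$, $R_2=\frac{1}{2r}+\gamma+\eta_5$, $R_3=\frac{1}{2r}-\gamma+\eta_6$ with $\eta_m$ smooth on $[0,T]$, $\eta_m(0)=0$, and with $\alpha=\lim_{r\to0}\frac{\xi-L_1-L_2-L_3}{r}$, $\beta=\lim_{r\to0}\frac{R_1}{r}$, $\gamma=\lim_{r\to0}\frac{L_2-L_3}{2}$. Change of variables: $\mathcal{L}=1/\xi$, $X_i=\mathcal{L}L_i$, $Y_i=\mathcal{L}R_i$, $dr/ds=\mathcal{L}(r(s))$, $r(0)=T$, giving system $(F)$: $\frac{d\mathcal{L}}{ds}=\mathcal{L}(X_1^2+X_2^2+X_3^2)$, $\frac{dX_i}{ds}=\frac{Y_i^2}{2}-\frac{(Y_j-Y_k)^2}{2}-X_i+X_i(X_1^2+X_2^2+X_3^2)$, $\frac{dY_i}{ds}=Y_i(X_i-X_j-X_k+X_1^2+X_2^2+X_3^2)$. ''The solution of $(F)$ starting at $\phi(\alpha,\beta,\gamma)$'' is the maximal solution of $(F)$ with initial data at $s=0$ obtained from $\phi(\alpha,\beta,\gamma)$ by this change of variables. *)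

(* Defs.v *)
From Stdlib Require Import Reals.
From Coquelicot Require Import Coquelicot.
Open Scope R_scope.

(* A point of (1,oo) x R^6 / R^7: (xi, L1, L2, L3, R1, R2, R3) or
   (calL, X1, X2, X3, Y1, Y2, Y3). *)
Record st7 := mk7 { c0 : R; c1 : R; c2 : R; c3 : R; c4 : R; c5 : R; c6 : R }.

(* C^infinity on all of R (a smooth function on [0,T] is the restriction of
   such a function, by Borel/Seeley extension). *)
Definition smooth (f : R -> R) : Prop := forall (k : nat) (x : R), ex_derive_n f k x.

(* The solution on (0,T] of the steady soliton system of the prescribed
   singular form at r = 0, with parameters (al, be, ga). *)
Definition radial_sol (T al be ga : R)
  (xi L1 L2 L3 R1 R2 R3 : R -> R) : Prop :=
  exists e0 e1 e2 e3 e4 e5 e6 : R -> R,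
    smooth e0 /\ smooth e1 /\ smooth e2 /\ smooth e3 /\ smooth e4 /\
    smooth e5 /\ smooth e6 /\
    e0 0 = 0 /\ e1 0 = 0 /\ e2 0 = 0 /\ e3 0 = 0 /\ e4 0 = 0 /\
    e5 0 = 0 /\ e6 0 = 0 /\
    (forall r, 0 < r <= T ->
       xi r = 1 / r + e0 r /\ L1 r = 1 / r + e1 r /\
       L2 r = ga + e2 r /\ L3 r = - ga + e3 r /\
       R1 r = e4 r /\ R2 r = 1 / (2 * r) + ga + e5 r /\
       R3 r = 1 / (2 * r) - ga + e6 r) /\
    (forall r, 0 < r <= T ->
       is_derive xi r (- (L1 r ^ 2 + L2 r ^ 2 + L3 r ^ 2)) /\
       is_derive L1 r (- xi r * L1 r + R1 r ^ 2 / 2 - (R2 r - R3 r) ^ 2 / 2) /\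
       is_derive L2 r (- xi r * L2 r + R2 r ^ 2 / 2 - (R3 r - R1 r) ^ 2 / 2) /\
       is_derive L3 r (- xi r * L3 r + R3 r ^ 2 / 2 - (R1 r - R2 r) ^ 2 / 2) /\
       is_derive R1 r (R1 r * (L1 r - L2 r - L3 r)) /\
       is_derive R2 r (R2 r * (L2 r - L3 r - L1 r)) /\
       is_derive R3 r (R3 r * (L3 r - L1 r - L2 r))) /\
    filterlim (fun r => (xi r - L1 r - L2 r - L3 r) / r) (at_right 0) (locally al) /\
    filterlim (fun r => R1 r / r) (at_right 0) (locally be) /\
    filterlim (fun r => (L2 r - L3 r) / 2) (at_right 0) (locally ga).

Definition val_at (T : R) (xi L1 L2 L3 R1 R2 R3 : R -> R) : st7 :=
  mk7 (xi T) (L1 T) (L2 T) (L3 T) (R1 T) (R2 T) (R3 T).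

(* Change of variables calL = 1/xi, X_i = calL L_i, Y_i = calL R_i. *)
Definition chg (p : st7) : st7 :=
  let l := / c0 p in
  mk7 l (l * c1 p) (l * c2 p) (l * c3 p) (l * c4 p) (l * c5 p) (l * c6 p).

Definition F_sol_from (p : st7) (Lc X1 X2 X3 Y1 Y2 Y3 : R -> R) : Prop :=
  Lc 0 = c0 p /\ X1 0 = c1 p /\ X2 0 = c2 p /\ X3 0 = c3 p /\
  Y1 0 = c4 p /\ Y2 0 = c5 p /\ Y3 0 = c6 p /\
  filterlim Lc (at_right 0) (locally (Lc 0)) /\
  filterlim X1 (at_right 0) (locally (X1 0)) /\
  filterlim X2 (at_right 0) (locally (X2 0)) /\
  filterlim X3 (at_right 0) (locally (X3 0)) /\
  filterlim Y1 (at_right 0) (locally (Y1 0)) /\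
  filterlim Y2 (at_right 0) (locally (Y2 0)) /\
  filterlim Y3 (at_right 0) (locally (Y3 0)) /\
  (forall s, 0 < s ->
     let Q := X1 s ^ 2 + X2 s ^ 2 + X3 s ^ 2 in
     is_derive Lc s (Lc s * Q) /\
     is_derive X1 s (Y1 s ^ 2 / 2 - (Y2 s - Y3 s) ^ 2 / 2 - X1 s + X1 s * Q) /\
     is_derive X2 s (Y2 s ^ 2 / 2 - (Y3 s - Y1 s) ^ 2 / 2 - X2 s + X2 s * Q) /\
     is_derive X3 s (Y3 s ^ 2 / 2 - (Y1 s - Y2 s) ^ 2 / 2 - X3 s + X3 s * Q) /\
     is_derive Y1 s (Y1 s * (X1 s - X2 s - X3 s + Q)) /\
     is_derive Y2 s (Y2 s * (X2 s - X3 s - X1 s + Q)) /\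
     is_derive Y3 s (Y3 s * (X3 s - X1 s - X2 s + Q))).

(* Main.v *)
Require Import Defs.
From Stdlib Require Import Reals Lra Psatz Classical ClassicalEpsilon.
From Coquelicot Require Import Coquelicot.
Open Scope R_scope.

(* Write S = R1 R2 + R2 R3 + R3 R1 - (R1^2 + R2^2 + R3^2)/2 and w = xi - L1 - L2 - L3. The quantity
   xi^2 - L1^2 - L2^2 - L3^2 - S is a first integral with value 2 alpha, so that w' = - xi w + 2 alpha.
   Continuous dependence on (alpha, beta, gamma), including uniqueness, is an energy estimate at the
   singular orbit in coordinates whose singular linear part has no growing mode.

   For gamma >= 0 (the case gamma < 0 follows by exchanging the indices 2 and 3), the ratio R1/R2
   starts at 0 and has logarithmic derivative 2 (L1 - L2). Either L1 - L2 becomes negative while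
   R1 < R2, or R1 exceeds R2, or neither happens. The first two alternatives are open conditions on
   the parameters and exclude each other, because (R2 - R1, L2 - L1) solves a cooperative system. At
   gamma = 0 the first one holds for small beta > 0 (comparison with the product of the cigar and a
   plane), and the second one for alpha = 0 (Ricci-flat metrics). Hence, for gamma close to 0, some
   alpha > 0 realizes neither. With P' = xi P and D = L1 - L2, the function (L1 + L2 + L3 - D/2) P is
   then increasing, so L1 + L2 + L3 > 0 and xi > w >= 0 is decreasing and bounded below; the source
   of D dominates the negative part of the source of L3, which makes L3 P bounded below. It follows
   that the solution is global, that L1, L2, L3 tend to 0, and that R1, R2, R3 converge to the limits
   (rho h, h, sigma h) with 0 < rho <= 1 and 0 <= sigma <= 1. The equation of L2 forces
   h^2 = (sigma h - rho h)^2, i.e. the limit is (h, h, 0). *)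

(** * Calculus on half-open intervals *)

(** [R1 / R2] equals (f1 / f2)^2, so the shooting decides whether f1 falls back before reaching f2,
    overtakes it, or gains on it for ever. The obstacle is that no comparison solution is at hand
    for [ga <> 0]. Hence both ends of the arc of parameters are treated at [ga = 0], where [L2 = L3]
    and [R2 = R3], and both events are phrased at a finite time of one solution, so that they
    survive small changes of all three parameters.

    The ends are settled with the same lemma as the middle: if neither event happens, the solution
    is trapped, hence global. For [al = 0] and for small [be], however, the trapped inequalities can
    only last for a bounded time.

    The equations of the [L_i] and of w have the form f' = - xi f + source, so multiplication by [P]
    turns the sign of a source into monotonicity from the singular orbit on. While the trapped
    inequalities give [L1 >= L2 >= 0], the source of [L3] has no sign; its lower bound is the
    delicate point of the global existence. *)

Lemma is_derive_cv (f : R -> R) (x l l' : R) : is_derive f x l -> l = l' -> is_derive f x l'.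
Proof. now intros H <-. Qed.

Lemma dplus (f g : R -> R) x a b :
  is_derive f x a -> is_derive g x b -> is_derive (fun t => f t + g t) x (a + b).
Proof. intros; now apply (is_derive_plus f g). Qed.

Lemma dminus (f g : R -> R) x a b :
  is_derive f x a -> is_derive g x b -> is_derive (fun t => f t - g t) x (a - b).
Proof. intros; now apply (is_derive_minus f g). Qed.

Lemma dopp (f : R -> R) x a : is_derive f x a -> is_derive (fun t => - f t) x (- a).
Proof. intros; now apply (is_derive_opp f). Qed.

Lemma dmult (f g : R -> R) x a b :
  is_derive f x a -> is_derive g x b ->
  is_derive (fun t => f t * g t) x (a * g x + f x * b).
Proof. intros; apply (is_derive_mult f g); auto; intros; apply Rmult_comm. Qed.

Lemma dconst (c : R) x : is_derive (fun _ : R => c) x 0.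
Proof. apply is_derive_Reals, derivable_pt_lim_const. Qed.

Lemma did x : is_derive (fun t : R => t) x 1.
Proof. apply is_derive_Reals, derivable_pt_lim_id. Qed.

Lemma dsqr (f : R -> R) x a :
  is_derive f x a -> is_derive (fun t => f t ^ 2) x (2 * f x * a).
Proof.
  intros; eapply is_derive_cv.
  - apply is_derive_pow; eassumption.
  - simpl; ring.
Qed.

Lemma dexp (f : R -> R) x a :
  is_derive f x a -> is_derive (fun t => exp (f t)) x (exp (f x) * a).
Proof.
  intros; eapply is_derive_cv.
  - apply (is_derive_comp exp f); [apply is_derive_exp | eassumption].
  - unfold scal; simpl; unfold mult; simpl; ring.
Qed.

Lemma dln (f : R -> R) x a :
  0 < f x -> is_derive f x a -> is_derive (fun t => ln (f t)) x (a / f x).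
Proof.
  intros; eapply is_derive_cv.
  - apply (is_derive_comp ln f); [now apply is_derive_ln | eassumption].
  - unfold scal; simpl; unfold mult; simpl; unfold Rdiv; ring.
Qed.

Lemma dinv (f : R -> R) x a :
  f x <> 0 -> is_derive f x a -> is_derive (fun t => / f t) x (- a / f x ^ 2).
Proof. intros; now apply is_derive_inv. Qed.

Lemma ddiv (f g : R -> R) x a b :
  g x <> 0 -> is_derive f x a -> is_derive g x b ->
  is_derive (fun t => f t / g t) x ((a * g x - f x * b) / g x ^ 2).
Proof. intros; now apply is_derive_div. Qed.

Lemma ddivc (f : R -> R) x a c : is_derive f x a -> is_derive (fun t => f t / c) x (a / c).
Proof. intros; apply (is_derive_scal_l f _ _ (/ c)); easy. Qed.

(* A purely syntactic test: unification with [fun _ => ?c] may unfold the real operations and not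
   terminate in practice. *)
Ltac is_const f :=
  let a := eval cbv beta in (f 0) in let b := eval cbv beta in (f 1) in constr_eq a b.

Ltac der :=
  match goal with
  | |- is_derive ?f _ _ => is_const f; apply dconst
  | |- is_derive (fun t => _ / @?g t) _ _ => is_const g; apply ddivc; der
  | _ =>
  lazymatch goal with
  | |- is_derive (fun t => t) _ _ => apply did
  | |- is_derive (fun t => _ + _) _ _ => apply dplus; der
  | |- is_derive (fun t => _ - _) _ _ => apply dminus; der
  (* Functions such as [fun t => c + t] may have been eta-reduced to a partial application; such
     branches recognize them. *)
  | |- is_derive (Rplus _) _ _ => apply dplus; der
  | |- is_derive (Rminus _) _ _ => apply dminus; der
  | |- is_derive (Rmult _) _ _ => apply dmult; der
  | |- is_derive Ropp _ _ => apply dopp; der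
  | |- is_derive exp _ _ => apply dexp; der
  | |- is_derive (fun t => - _) _ _ => apply dopp; der
  | |- is_derive (fun t => _ * _) _ _ => apply dmult; der
  | |- is_derive (fun t => _ / _) _ _ => apply ddiv; [ | der | der]
  | |- is_derive (Rdiv _) _ _ => apply ddiv; [ | der | der]
  | |- is_derive (fun t => _ ^ 2) _ _ => apply dsqr; der
  | |- is_derive (fun t => exp _) _ _ => apply dexp; der
  | |- is_derive (fun t => ln _) _ _ => apply dln; [ | der]
  | |- is_derive ln _ _ => apply (dln (fun t => t)); [ | der]
  | |- is_derive (fun t => / _) _ _ => apply dinv; [ | der]
  | _ => eassumption
  end
  end.

Ltac derive_as := eapply is_derive_cv; [der | cbv beta].

Lemma is_derive_cont (f : R -> R) x l : is_derive f x l -> continuous f x.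
Proof. intros H; apply (ex_derive_continuous f x); now exists l. Qed.

Lemma cplus (f g : R -> R) x : continuous f x -> continuous g x -> continuous (fun t => f t + g t) x.
Proof. apply (continuous_plus f g). Qed.

Lemma cminus (f g : R -> R) x : continuous f x -> continuous g x -> continuous (fun t => f t - g t) x.
Proof. apply (continuous_minus f g). Qed.

Lemma cmult (f g : R -> R) x : continuous f x -> continuous g x -> continuous (fun t => f t * g t) x.
Proof. apply (continuous_mult f g). Qed.

Lemma copp (f : R -> R) x : continuous f x -> continuous (fun t => - f t) x.
Proof. apply (continuous_opp f). Qed.

Lemma csqr (f : R -> R) x : continuous f x -> continuous (fun t => f t ^ 2) x.
Proof.
  intros H; apply (continuous_ext (fun t => f t * f t)); [intros; simpl; ring | now apply cmult].
Qed.

Ltac contr tac :=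
  match goal with
  | |- continuous ?f _ => is_const f; apply continuous_const
  | _ =>
  lazymatch goal with
  | |- continuous (fun t => t) _ => apply continuous_id
  | |- continuous (fun t => _ + _) _ => apply cplus; contr tac
  | |- continuous (fun t => _ - _) _ => apply cminus; contr tac
  | |- continuous (fun t => _ * _) _ => apply cmult; contr tac
  | |- continuous (fun t => - _) _ => apply copp; contr tac
  | |- continuous (fun t => _ ^ 2) _ => apply csqr; contr tac
  | |- continuous (Rplus _) _ => apply cplus; contr tac
  | |- continuous (Rminus _) _ => apply cminus; contr tac
  | |- continuous (Rmult _) _ => apply cmult; contr tac
  | _ => tac
  end
  end.

Lemma cont_eps (f : R -> R) x : continuous f x ->
  forall e, 0 < e -> exists d, 0 < d /\ forall y, Rabs (y - x) < d -> Rabs (f y - f x) < e.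
Proof.
  intros H e He.
  destruct (proj1 (filterlim_locally f (f x)) H (mkposreal e He)) as [d Hd].
  exists d; split; [apply cond_pos | intros y Hy; apply (Hd y Hy)].
Qed.

Lemma incr_on (f f' : R -> R) a b :
  a <= b -> (forall x, a <= x <= b -> is_derive f x (f' x)) ->
  (forall x, a <= x <= b -> 0 <= f' x) -> f a <= f b.
Proof.
  intros Hab Hd Hp.
  destruct (MVT_gen f a b f') as [c [Hc E]].
  - intros x; rewrite Rmin_left, Rmax_right by lra; intros; apply Hd; lra.
  - intros x; rewrite Rmin_left, Rmax_right by lra; intros.
    apply continuity_pt_filterlim, (is_derive_cont _ _ (f' x)), Hd; lra.
  - rewrite Rmin_left, Rmax_right in Hc by lra.
    specialize (Hp c Hc); nra.
Qed.

Lemma const_on (f : R -> R) a b :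
  a <= b -> (forall x, a <= x <= b -> is_derive f x 0) -> f a = f b.
Proof.
  intros Hab Hd; apply Rle_antisym.
  - apply (incr_on f (fun _ => 0)); auto; intros; lra.
  - assert (- f a <= - f b); [|lra].
    apply (incr_on (fun x => - f x) (fun _ => 0)); auto; [|intros; lra].
    intros x Hx; specialize (Hd x Hx); derive_as; ring.
Qed.

(** * Right limits at the singular time 0 *)

Definition lim0 (f : R -> R) (l : R) := filterlim f (at_right 0) (locally l).

Lemma lim0_eps (f : R -> R) l :
  lim0 f l <-> forall e, 0 < e -> exists d, 0 < d /\ forall r, 0 < r < d -> Rabs (f r - l) < e.
Proof.
  split.
  - intros H e He.
    destruct (proj1 (filterlim_locally f l) H (mkposreal e He)) as [d Hd].
    exists d; split; [apply cond_pos|]; intros r Hr; apply (Hd r); [|lra].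
    unfold ball; simpl; unfold AbsRing_ball, abs, minus, plus, opp; simpl.
    rewrite Rabs_right; lra.
  - intros H; apply filterlim_locally; intros e.
    destruct (H e (cond_pos e)) as [d [Hd Hf]].
    exists (mkposreal d Hd); intros r Hr Hr0; apply Hf; split; [easy|].
    unfold ball in Hr; simpl in Hr; unfold AbsRing_ball, abs, minus, plus, opp in Hr; simpl in Hr.
    rewrite Rabs_right in Hr; lra.
Qed.

Lemma lim0_ext (f g : R -> R) b l :
  0 < b -> (forall r, 0 < r <= b -> f r = g r) -> lim0 f l -> lim0 g l.
Proof.
  intros Hb E H; apply lim0_eps; intros e He.
  destruct (proj1 (lim0_eps f l) H e He) as [d [Hd Hf]].
  exists (Rmin d b); split; [now apply Rmin_pos|].
  intros r [H1 H2]; rewrite <- E.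
  - apply Hf; split; [easy | eapply Rlt_le_trans; [apply H2 | apply Rmin_l]].
  - split; [easy|]; left; eapply Rlt_le_trans; [apply H2 | apply Rmin_r].
Qed.

Lemma lim0_plus f g a b : lim0 f a -> lim0 g b -> lim0 (fun r => f r + g r) (a + b).
Proof. intros Hf Hg; eapply filterlim_comp_2; [exact Hf | exact Hg | apply (filterlim_plus a b)]. Qed.

Lemma lim0_mult f g a b : lim0 f a -> lim0 g b -> lim0 (fun r => f r * g r) (a * b).
Proof. intros Hf Hg; eapply filterlim_comp_2; [exact Hf | exact Hg | apply (filterlim_mult a b)]. Qed.

Lemma lim0_sqr f a : lim0 f a -> lim0 (fun r => f r ^ 2) (a ^ 2).
Proof.
  intros H; replace (a ^ 2) with (a * a) by ring.
  apply (filterlim_ext (fun r => f r * f r)); [intros; simpl; ring | now apply lim0_mult].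
Qed.

Lemma lim0_const c : lim0 (fun _ => c) c.
Proof. apply filterlim_const. Qed.

Lemma lim0_cont f : continuous f 0 -> lim0 f (f 0).
Proof.
  intros H; apply lim0_eps; intros e He.
  destruct (cont_eps f 0 H e He) as [d [Hd Hf]].
  exists d; split; [easy|]; intros r Hr; apply Hf; rewrite Rabs_right; lra.
Qed.

Lemma lim0_id : lim0 (fun r => r) 0.
Proof. apply (lim0_cont (fun r => r)), continuous_id. Qed.

Lemma lim0_opp f a : lim0 f a -> lim0 (fun r => - f r) (- a).
Proof. intros Hf; eapply filterlim_comp; [exact Hf | apply (filterlim_opp a)]. Qed.

Lemma lim0_minus f g a b : lim0 f a -> lim0 g b -> lim0 (fun r => f r - g r) (a - b).
Proof. intros; apply lim0_plus; [easy | now apply lim0_opp]. Qed.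

Lemma lim0_unique f a b : lim0 f a -> lim0 f b -> a = b.
Proof. apply (filterlim_locally_unique (F := at_right 0) f a b). Qed.

Lemma lim0_eq f a b : lim0 f a -> a = b -> lim0 f b.
Proof. now intros H <-. Qed.

Ltac lim0s :=
  match goal with
  | |- lim0 ?f _ => is_const f; apply lim0_const
  | _ =>
  lazymatch goal with
  | |- lim0 (fun t => t) _ => apply lim0_id
  | |- lim0 (fun t => _ + _) _ => apply lim0_plus; lim0s
  | |- lim0 (fun t => _ - _) _ => apply lim0_minus; lim0s
  | |- lim0 (Rplus _) _ => apply lim0_plus; lim0s
  | |- lim0 (Rminus _) _ => apply lim0_minus; lim0s
  | |- lim0 (Rmult _) _ => apply lim0_mult; lim0s
  | |- lim0 (fun t => - _) _ => apply lim0_opp; lim0s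
  | |- lim0 (fun t => _ * _) _ => apply lim0_mult; lim0s
  | |- lim0 (fun t => _ / _) _ => apply lim0_mult; lim0s
  | |- lim0 (fun t => _ ^ 2) _ => apply lim0_sqr; lim0s
  | _ => eassumption
  end
  end.

Lemma lim0_pos f l : lim0 f l -> 0 < l -> exists d, 0 < d /\ forall r, 0 < r < d -> 0 < f r.
Proof.
  intros H Hl; destruct (proj1 (lim0_eps f l) H l Hl) as [d [Hd Hf]].
  exists d; split; [easy|]; intros r Hr.
  specialize (Hf r Hr); apply Rabs_def2 in Hf; lra.
Qed.

Lemma lim0_le f l c b : 0 < b -> lim0 f l -> (forall r, 0 < r <= b -> f r <= c) -> l <= c.
Proof.
  intros Hb H Hc; destruct (Rle_lt_dec l c) as [h|h]; [easy|exfalso].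
  destruct (lim0_pos (fun r => f r - c) (l - c)) as [d [Hd Hf]]; [lim0s | lra |].
  set (r := Rmin d b / 2).
  assert (0 < Rmin d b) by now apply Rmin_pos.
  pose proof (Rmin_l d b); pose proof (Rmin_r d b).
  assert (0 < r < d) by (unfold r; lra).
  assert (0 < r <= b) by (unfold r; lra).
  specialize (Hf r H3); specialize (Hc r H4); lra.
Qed.

(** Monotonicity on (0, b] pushes the limit at 0 below every value; nothing is required at 0 itself,
    where the system is singular. *)
Lemma incr_from0 (f f' : R -> R) l b :
  lim0 f l -> (forall x, 0 < x <= b -> is_derive f x (f' x)) ->
  (forall x, 0 < x <= b -> 0 <= f' x) -> forall r, 0 < r <= b -> l <= f r.
Proof.
  intros Hl Hd Hp r Hr; apply (lim0_le f l (f r) r); [lra | easy |].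
  intros x Hx; apply (incr_on f f'); intros; try apply Hd; try apply Hp; lra.
Qed.

(** De l'Hospital's rule by monotonicity: f - (c - e)/2 x^2 and (c + e)/2 x^2 - f are nondecreasing
    near 0 and tend to 0 there. Applied to r w and to r [L2], it yields the first-order coefficients
    of w and [L2] at the singular orbit. *)
Lemma lim0_quadratic (f g : R -> R) c b :
  0 < b -> lim0 f 0 -> (forall x, 0 < x <= b -> is_derive f x (x * g x)) ->
  lim0 g c -> lim0 (fun r => f r / r ^ 2) (c / 2).
Proof.
  intros Hb Hf Hd Hg; apply lim0_eps; intros e He.
  destruct (proj1 (lim0_eps g c) Hg e He) as [d [Hd0 Hgd]].
  exists (Rmin d b); split; [now apply Rmin_pos|]; intros r [Hr1 Hr2].
  assert (Hrd : r < d) by (eapply Rlt_le_trans; [apply Hr2 | apply Rmin_l]).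
  assert (Hrb : r < b) by (eapply Rlt_le_trans; [apply Hr2 | apply Rmin_r]).
  assert (H1 : 0 <= f r - (c - e) / 2 * r ^ 2).
  { apply (incr_from0 (fun x => f x - (c - e) / 2 * x ^ 2) (fun x => x * (g x - (c - e))) 0 r).
    - eapply lim0_eq; [lim0s | ring].
    - intros x Hx; assert (D : is_derive f x (x * g x)) by (apply Hd; lra).
      derive_as; field.
    - intros x Hx; assert (Rabs (g x - c) < e) by (apply Hgd; lra).
      apply Rabs_def2 in H; apply Rmult_le_pos; lra.
    - lra. }
  assert (H2 : 0 <= (c + e) / 2 * r ^ 2 - f r).
  { apply (incr_from0 (fun x => (c + e) / 2 * x ^ 2 - f x) (fun x => x * ((c + e) - g x)) 0 r).
    - eapply lim0_eq; [lim0s | ring].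
    - intros x Hx; assert (D : is_derive f x (x * g x)) by (apply Hd; lra).
      derive_as; field.
    - intros x Hx; assert (Rabs (g x - c) < e) by (apply Hgd; lra).
      apply Rabs_def2 in H; apply Rmult_le_pos; lra.
    - lra. }
  assert (Hr : 0 < r ^ 2) by (apply pow_lt; lra).
  replace (f r / r ^ 2 - c / 2) with ((f r - c / 2 * r ^ 2) / r ^ 2) by (field; lra).
  apply Rle_lt_trans with (e / 2); [|lra].
  apply Rabs_le; split.
  - apply Rle_div_r; [easy|]; lra.
  - apply Rle_div_l; [easy|]; lra.
Qed.

(** * Primitives, continuous induction and Gronwall inequalities *)

Lemma prim_aux (f : R -> R) a :
  (forall x, continuous f x) -> forall x, is_derive (fun x => RInt f a x) x (f x).
Proof.
  intros Hc x; apply (is_derive_RInt f _ a).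
  - exists (mkposreal 1 Rlt_0_1); intros y _.
    apply (RInt_correct (V := R_CompleteNormedModule)), ex_RInt_continuous; intros; apply Hc.
  - apply Hc.
Qed.

Lemma continuous_near (f g : R -> R) x d :
  0 < d -> (forall y, Rabs (y - x) < d -> f y = g y) -> continuous f x -> continuous g x.
Proof.
  intros Hd E H; apply (continuous_ext_loc g f x); [|easy].
  exists (mkposreal d Hd); intros y Hy; now apply E.
Qed.

Lemma is_derive_near (f g : R -> R) x l d :
  0 < d -> (forall y, Rabs (y - x) < d -> f y = g y) -> is_derive f x l -> is_derive g x l.
Proof.
  intros Hd E H; apply (is_derive_ext_loc f g); [|easy].
  exists (mkposreal d Hd); intros y Hy; now apply E.
Qed.

Lemma continuous_intro (f : R -> R) x :
  (forall e, 0 < e -> exists d, 0 < d /\ forall y, Rabs (y - x) < d -> Rabs (f y - f x) < e) ->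
  continuous f x.
Proof.
  intros H; apply filterlim_locally; intros e.
  destruct (H e (cond_pos e)) as [d [Hd Hf]].
  exists (mkposreal d Hd); intros y Hy; apply Hf, Hy.
Qed.

Lemma primitive_from (f : R -> R) a b :
  a < b -> (forall x, a <= x <= b -> continuous f x) ->
  exists F, forall x, a <= x <= b -> is_derive F x (f x).
Proof.
  intros Hab Hc.
  (* Frozen outside [a, b], the integrand is continuous on the whole line, so its integral is
     differentiable from both sides at the endpoints too. *)
  set (g := fun x => f (Rmax a (Rmin x b))).
  assert (Hg : forall x, continuous g x).
  { intros x; apply continuous_intro; intros e He.
    assert (Hcl : a <= Rmax a (Rmin x b) <= b).
    { split; [apply Rmax_l | apply Rmax_lub; [lra | apply Rmin_r]]. }
    destruct (cont_eps f _ (Hc _ Hcl) e He) as [d [Hd Hf]].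
    exists d; split; [easy|]; intros y Hy; apply Hf.
    eapply Rle_lt_trans; [|exact Hy].
    unfold Rmax, Rmin; repeat destruct Rle_dec; try (unfold Rabs; repeat destruct Rcase_abs; lra). }
  exists (fun x => RInt g a x); intros x Hx.
  replace (f x) with (g x); [now apply prim_aux|].
  unfold g; rewrite Rmin_left, Rmax_right by lra; reflexivity.
Qed.

Lemma primitive_from0 (f : R -> R) b :
  0 < b -> (forall x, 0 < x <= b -> continuous f x) -> lim0 f 0 ->
  exists F, (forall x, 0 < x <= b -> is_derive F x (f x)) /\ lim0 F 0.
Proof.
  intros Hb Hc Hl.
  (* The extension by the limit 0 to the left and by a constant beyond [b] is continuous
     everywhere. *)
  set (f0 := fun x => if Rle_dec x 0 then 0 else f (Rmin x b)).
  assert (Hg : forall x, continuous f0 x).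
  { intros x; destruct (total_order_T x 0) as [[h|h]|h].
    - apply (continuous_near (fun _ => 0) _ _ (- x)); [lra | | apply continuous_const].
      intros y Hy; unfold f0; destruct Rle_dec; [easy|].
      apply Rabs_def2 in Hy; lra.
    - subst x; apply continuous_intro; intros e He.
      destruct (proj1 (lim0_eps f 0) Hl e He) as [d [Hd Hf]].
      exists (Rmin d b); split; [now apply Rmin_pos|].
      intros y Hy; unfold f0 at 2; destruct (Rle_dec 0 0); [|lra].
      apply Rabs_def2 in Hy; pose proof (Rmin_l d b); pose proof (Rmin_r d b).
      unfold f0; destruct Rle_dec.
      + rewrite Rminus_0_r, Rabs_R0; lra.
      + rewrite Rmin_left by lra; apply Hf; lra.
    - assert (Hcl : 0 < Rmin x b <= b) by (split; [now apply Rmin_pos | apply Rmin_r]).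
      apply continuous_intro; intros e He.
      destruct (cont_eps f _ (Hc _ Hcl) e He) as [d [Hd Hf]].
      exists (Rmin d x); split; [now apply Rmin_pos|]; intros y Hy.
      pose proof (Rmin_l d x); pose proof (Rmin_r d x).
      unfold f0; repeat destruct Rle_dec; try (apply Rabs_def2 in Hy; lra).
      apply Hf; eapply Rle_lt_trans; [|eapply Rlt_le_trans; [exact Hy | apply Rmin_l]].
      unfold Rmin; repeat destruct Rle_dec; unfold Rabs; repeat destruct Rcase_abs; lra. }
  exists (fun x => RInt f0 0 x); split.
  - intros x Hx; replace (f x) with (f0 x); [now apply prim_aux|].
    unfold f0; destruct Rle_dec; [lra|]; rewrite Rmin_left by lra; reflexivity.
  - assert (continuous (fun x => RInt f0 0 x) 0) by (eapply is_derive_cont; now apply prim_aux).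
    apply lim0_cont in H; rewrite RInt_point in H; exact H.
Qed.

(** Continuous induction. Were [P] to fail somewhere, the supremum of the times up to which it has
    held would satisfy [P] by the second hypothesis, and the third would push it further. This
    replaces the choice of a first exit time. *)
Lemma real_ind (P : R -> Prop) b :
  (exists d, 0 < d /\ forall r, 0 < r < d -> r <= b -> P r) ->
  (forall r, 0 < r <= b -> (forall x, 0 < x < r -> P x) -> P r) ->
  (forall r, 0 < r < b -> (forall x, 0 < x <= r -> P x) ->
     exists d, 0 < d /\ forall x, r < x < r + d -> x <= b -> P x) ->
  forall r, 0 < r <= b -> P r.
Proof.
  intros [d0 [Hd0 H0]] Hcl Hop r Hr.
  set (E := fun x => 0 < x <= r /\ forall y, 0 < y <= x -> P y).
  assert (Hx0 : E (Rmin (d0 / 2) r)).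
  { assert (0 < Rmin (d0 / 2) r) by (apply Rmin_pos; lra).
    pose proof (Rmin_l (d0 / 2) r); pose proof (Rmin_r (d0 / 2) r).
    split; [lra|]; intros y Hy; apply H0; lra. }
  destruct (completeness E) as [s [Hub Hlub]].
  - exists r; intros x [Hx _]; lra.
  - now exists (Rmin (d0 / 2) r).
  - assert (Hs : 0 < s <= r).
    { split; [|apply Hlub; intros x [Hx _]; lra].
      apply Rlt_le_trans with (Rmin (d0 / 2) r); [apply Rmin_pos; lra | now apply Hub]. }
    assert (Hlt : forall x, 0 < x < s -> P x).
    { intros x Hx; destruct (Classical_Prop.classic (P x)) as [h|h]; [easy|exfalso].
      assert (s <= x); [|lra]; apply Hlub; intros y [Hy1 Hy2].
      destruct (Rle_lt_dec y x) as [|Hyx]; [easy|]; exfalso; apply h, Hy2; lra. }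
    assert (Hps : P s) by (apply Hcl; [lra | easy]).
    destruct (Rle_lt_dec r s) as [h|h]; [now replace r with s by lra|exfalso].
    destruct (Hop s) as [d [Hd Hpd]]; [lra | |].
    { intros x Hx; destruct (Req_dec x s) as [->|]; [easy | apply Hlt; lra]. }
    assert (Hm : 0 < Rmin (d / 2) (r - s)) by (apply Rmin_pos; lra).
    pose proof (Rmin_l (d / 2) (r - s)); pose proof (Rmin_r (d / 2) (r - s)).
    assert (E (s + Rmin (d / 2) (r - s))); [|specialize (Hub _ H2); lra].
    split; [lra|]; intros y Hy.
    destruct (total_order_T y s) as [[h1|h1]|h1]; [apply Hlt; lra | now subst y | apply Hpd; lra].
Qed.

(** The integrating factor exp(- C) makes f nondecreasing. No sign of f is assumed, so upper bounds
    follow by applying the lemma to - f. *)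
Lemma gron_ge (f f' c C : R -> R) a b :
  a <= b -> (forall x, a <= x <= b -> is_derive f x (f' x)) ->
  (forall x, a <= x <= b -> is_derive C x (c x)) ->
  (forall x, a <= x <= b -> c x * f x <= f' x) -> f a * exp (C b - C a) <= f b.
Proof.
  intros Hab Hf HC Hge.
  assert (f a * exp (- C a) <= f b * exp (- C b)).
  { apply (incr_on (fun x => f x * exp (- C x)) (fun x => (f' x - c x * f x) * exp (- C x))); [easy | |].
    - intros x Hx; specialize (Hf x Hx); specialize (HC x Hx); derive_as; ring.
    - intros x Hx; specialize (Hge x Hx); apply Rmult_le_pos; [lra | left; apply exp_pos]. }
  unfold Rminus; rewrite exp_plus.
  apply (Rmult_le_compat_r (exp (C b))) in H; [|left; apply exp_pos].
  rewrite (Rmult_assoc (f b)), <- exp_plus in H.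
  replace (- C b + C b) with 0 in H by ring; rewrite exp_0 in H; lra.
Qed.

Lemma gron_pos (f f' c : R -> R) a b :
  a < b -> (forall x, a <= x <= b -> is_derive f x (f' x)) ->
  (forall x, a <= x <= b -> continuous c x) ->
  (forall x, a <= x <= b -> c x * f x <= f' x) -> 0 < f a -> 0 < f b.
Proof.
  intros Hab Hf Hc Hge Ha.
  destruct (primitive_from c a b Hab Hc) as [C HC].
  eapply Rlt_le_trans; [|apply (gron_ge f f' c C a b)]; auto; [|lra].
  apply Rmult_lt_0_compat; [easy | apply exp_pos].
Qed.

Lemma pos_near (f : R -> R) x : continuous f x -> 0 < f x ->
  exists d, 0 < d /\ forall y, Rabs (y - x) < d -> 0 < f y.
Proof.
  intros Hc Hp; destruct (cont_eps f x Hc (f x) Hp) as [d [Hd H]].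
  exists d; split; [easy|]; intros y Hy; specialize (H y Hy); apply Rabs_def2 in H; lra.
Qed.

Lemma cont_le_left (f : R -> R) a x c :
  a < x -> continuous f x -> (forall y, a < y < x -> f y <= c) -> f x <= c.
Proof.
  intros Ha Hc H; destruct (Rle_lt_dec (f x) c) as [h|h]; [easy|exfalso].
  destruct (cont_eps f x Hc (f x - c)) as [d [Hd Hf]]; [lra|].
  set (y := Rmax (x - d / 2) ((a + x) / 2)).
  pose proof (Rmax_l (x - d / 2) ((a + x) / 2)); pose proof (Rmax_r (x - d / 2) ((a + x) / 2)).
  assert (y < x) by (apply Rmax_lub_lt; lra).
  assert (f y <= c) by (apply H; fold y in H1; lra).
  assert (Rabs (f y - f x) < f x - c).
  { apply Hf; rewrite Rabs_left by lra; fold y in H0; lra. }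
  apply Rabs_def2 in H4; lra.
Qed.

Lemma real_ind_from (P : R -> Prop) a b :
  P a ->
  (forall r, a < r <= b -> (forall x, a <= x < r -> P x) -> P r) ->
  (forall r, a <= r < b -> (forall x, a <= x <= r -> P x) ->
     exists d, 0 < d /\ forall x, r < x < r + d -> x <= b -> P x) ->
  forall r, a <= r <= b -> P r.
Proof.
  intros Ha Hcl Hop r Hr.
  destruct (Req_dec r a) as [->|Hne]; [easy|].
  replace r with (a + (r - a)) by ring.
  apply (real_ind (fun t => P (a + t)) (b - a)); [| | |lra].
  - destruct (Hop a) as [d [Hd H]]; [lra | intros x Hx; now replace x with a by lra |].
    exists d; split; [easy|]; intros t Ht Htb; apply H; lra.
  - intros t Ht H; apply Hcl; [lra|]; intros x Hx.
    destruct (Req_dec x a) as [->|]; [easy|]; replace x with (a + (x - a)) by ring; apply H; lra.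
  - intros t Ht H; destruct (Hop (a + t)) as [d [Hd Hd']]; [lra | |].
    + intros x Hx; destruct (Req_dec x a) as [->|]; [easy|].
      replace x with (a + (x - a)) by ring; apply H; lra.
    + exists d; split; [easy|]; intros x Hx Hxb; apply Hd'; lra.
Qed.

(** * Global solutions of Lipschitz systems *)

Lemma lip_of_derive (f f' : R -> R) B :
  (forall x, is_derive f x (f' x)) -> (forall x, Rabs (f' x) <= B) ->
  forall s t, Rabs (f s - f t) <= B * Rabs (s - t).
Proof.
  intros Hd HB s t; destruct (MVT_gen f t s f') as [c [_ E]].
  - intros; apply Hd.
  - intros; apply continuity_pt_filterlim, (is_derive_cont _ _ _ (Hd x)).
  - rewrite E, Rabs_mult; apply Rmult_le_compat_r; [apply Rabs_pos | apply HB].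
Qed.

Lemma dominated (g g' p p' : R -> R) a t :
  a <= t -> g a = 0 -> (forall s, a <= s <= t -> is_derive g s (g' s)) ->
  (forall s, a <= s <= t -> is_derive p s (p' s)) ->
  (forall s, a <= s <= t -> Rabs (g' s) <= p' s) -> Rabs (g t) <= p t - p a.
Proof.
  intros Ht H0 Hg Hp Hle; apply Rabs_le; split.
  - assert (g a + p a <= g t + p t); [|lra].
    apply (incr_on (fun s => g s + p s) (fun s => g' s + p' s)); [easy | |].
    + intros s Hs; specialize (Hg s Hs); specialize (Hp s Hs); now derive_as.
    + intros s Hs; specialize (Hle s Hs); apply Rabs_le_between in Hle; lra.
  - assert (p a - g a <= p t - g t); [|lra].
    apply (incr_on (fun s => p s - g s) (fun s => p' s - g' s)); [easy | |].
    + intros s Hs; specialize (Hg s Hs); specialize (Hp s Hs); now derive_as.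
    + intros s Hs; specialize (Hle s Hs); apply Rabs_le_between in Hle; lra.
Qed.

Lemma le_of_geom x c M : (forall n, x <= c + M * / 2 ^ n) -> x <= c.
Proof.
  intros H.
  assert (L : is_lim_seq (fun n => c + M * / 2 ^ n) (c + M * 0)).
  { apply (is_lim_seq_plus' (fun _ => c)); [apply is_lim_seq_const|].
    apply (is_lim_seq_scal_l (fun n => / 2 ^ n) M 0).
    apply (is_lim_seq_ext (fun n => (/ 2) ^ n)); [intros; now rewrite pow_inv|].
    apply is_lim_seq_geom; rewrite Rabs_right; lra. }
  replace (c + M * 0) with c in L by ring.
  apply (is_lim_seq_le (fun _ => x) _ (Finite x) (Finite c) H); [apply is_lim_seq_const | exact L].
Qed.

(** The state is a function on an arbitrary index type, with the sup distance written pointwise.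
    Boundedness of the field gives all iterates the common Lipschitz constant [B] in time, which
    makes the integrands continuous. *)
Section Picard.
Variables (I : Type) (f : (I -> R) -> I -> R) (K B : R) (u0 : I -> R).
Hypothesis K_pos : 0 < K.
Hypothesis f_bound : forall a i, Rabs (f a i) <= B.
Hypothesis f_lip : forall a b d, (forall j, Rabs (a j - b j) <= d) ->
  forall i, Rabs (f a i - f b i) <= K * d.

Let lip (y : I -> R -> R) := forall i s t, 0 <= s -> 0 <= t -> Rabs (y i s - y i t) <= B * Rabs (s - t).

(* Evaluating at [Rmax s 0] makes the solution differentiable on both sides of the initial time. *)
Let rhs (y : I -> R -> R) i s := f (fun j => y j (Rmax s 0)) i.

Fixpoint picard_iter (n : nat) : I -> R -> R :=
  match n with
  | O => fun i _ => u0 i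
  | S n => fun i t => u0 i + RInt (rhs (picard_iter n) i) 0 t
  end.

Lemma B_nonneg (i : I) : 0 <= B.
Proof. eapply Rle_trans; [apply Rabs_pos | apply (f_bound u0 i)]. Qed.

Lemma rhs_continuous y : lip y -> forall i s, continuous (rhs y i) s.
Proof.
  intros Hy i s; apply continuous_intro; intros e He.
  pose proof (B_nonneg i) as HB.
  assert (Hp : 0 < K * (B + 1)) by (apply Rmult_lt_0_compat; lra).
  exists (e / (K * (B + 1))); split; [now apply Rdiv_lt_0_compat|].
  intros t Ht.
  apply Rle_lt_trans with (K * ((B + 1) * Rabs (t - s))).
  - apply f_lip; intros j.
    eapply Rle_trans; [apply Hy; apply Rmax_r|].
    apply Rmult_le_compat; [easy | apply Rabs_pos | lra |].
    unfold Rmax; repeat destruct Rle_dec; unfold Rabs; repeat destruct Rcase_abs; lra.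
  - apply (Rmult_lt_compat_l _ _ _ Hp) in Ht.
    replace (K * (B + 1) * (e / (K * (B + 1)))) with e in Ht by (field; lra); lra.
Qed.

Lemma integral_derive y : lip y -> forall i t,
  is_derive (fun t => u0 i + RInt (rhs y i) 0 t) t (rhs y i t).
Proof.
  intros Hy i t.
  pose proof (prim_aux (rhs y i) 0 (rhs_continuous y Hy i) t); derive_as; ring.
Qed.

Lemma integral_lip y : lip y -> lip (fun i t => u0 i + RInt (rhs y i) 0 t).
Proof.
  intros Hy i s t _ _; apply (lip_of_derive (fun t => u0 i + RInt (rhs y i) 0 t) (rhs y i)).
  - now apply integral_derive.
  - intros; apply f_bound.
Qed.

Lemma picard_lip n : lip (picard_iter n).
Proof.
  induction n as [|n IH]; [|now apply integral_lip].
  intros i s t _ _; simpl; rewrite Rminus_diag, Rabs_R0.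
  apply Rmult_le_pos; [now apply B_nonneg | apply Rabs_pos].
Qed.

(** A Bielecki weight: measured against exp(2 K t), integrating a field of Lipschitz constant [K]
    halves the error, so the iteration contracts on the whole half-line at once. [C] makes the first
    step, of slope at most [B], fit below [bd 0]. *)
Let C := B / (2 * K).
Let bd (n : nat) t := C * / 2 ^ n * exp (2 * K * t).

Lemma bd_derive n t : is_derive (bd n) t (2 * K * bd n t).
Proof. unfold bd; derive_as; ring. Qed.

Lemma C_nonneg (i : I) : 0 <= C.
Proof. apply Rdiv_le_0_compat; [now apply B_nonneg | lra]. Qed.

Lemma bd_nonneg (i : I) n t : 0 <= bd n t.
Proof.
  apply Rmult_le_pos; [apply Rmult_le_pos; [now apply C_nonneg|] | left; apply exp_pos].
  left; apply Rinv_0_lt_compat, pow_lt; lra.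
Qed.

Lemma bd_half n t : bd (S n) t = bd n t / 2.
Proof. unfold bd; simpl; field; apply pow_nonzero; lra. Qed.

Lemma integral_close y z n M t : lip y -> lip z -> 0 <= t ->
  (forall s, 0 <= s <= t -> forall j, Rabs (y j s - z j s) <= M * bd n s) ->
  forall i, Rabs ((u0 i + RInt (rhs y i) 0 t) - (u0 i + RInt (rhs z i) 0 t)) <= M * bd (S n) t.
Proof.
  intros Hy Hz Ht H i.
  assert (HM : 0 <= M * bd (S n) 0).
  { rewrite bd_half; specialize (H 0 (conj (Rle_refl 0) Ht) i).
    pose proof (Rabs_pos (y i 0 - z i 0)); lra. }
  apply Rle_trans with (M * bd (S n) t - M * bd (S n) 0); [|lra].
  apply (dominated (fun t => (u0 i + RInt (rhs y i) 0 t) - (u0 i + RInt (rhs z i) 0 t))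
    (fun s => rhs y i s - rhs z i s) (fun s => M * bd (S n) s) (fun s => K * (M * bd n s))).
  - easy.
  - rewrite !RInt_point; unfold zero; simpl; ring.
  - intros s Hs; apply dminus; now apply integral_derive.
  - intros s Hs; pose proof (bd_derive (S n) s); derive_as; rewrite bd_half; field.
  - intros s Hs; apply f_lip; intros j; rewrite Rmax_left by lra; now apply H.
Qed.

Lemma picard_step n : forall t, 0 <= t -> forall i,
  Rabs (picard_iter (S n) i t - picard_iter n i t) <= bd n t.
Proof.
  induction n as [|n IH]; intros t Ht i.
  - assert (H0 : 0 <= bd 0 0) by now apply bd_nonneg.
    apply Rle_trans with (bd 0 t - bd 0 0); [|lra].
    apply (dominated (fun t => (u0 i + RInt (rhs (picard_iter 0) i) 0 t) - u0 i)
      (fun s => rhs (picard_iter 0) i s) (bd 0) (fun s => 2 * K * bd 0 s)).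
    + easy.
    + rewrite RInt_point; unfold zero; simpl; ring.
    + intros s Hs; pose proof (integral_derive _ (picard_lip 0) i s).
      eapply is_derive_cv; [apply dminus; [eassumption | apply dconst] | ring].
    + intros s Hs; apply bd_derive.
    + intros s Hs; eapply Rle_trans; [apply f_bound|].
      unfold bd, C; simpl; rewrite Rinv_1, Rmult_1_r.
      replace (2 * K * (B / (2 * K) * exp (2 * K * s))) with (B * exp (2 * K * s)) by (field; lra).
      rewrite <- (Rmult_1_r B) at 1; apply Rmult_le_compat_l; [now apply B_nonneg|].
      rewrite <- exp_0; destruct (Req_dec s 0) as [->|]; [rewrite Rmult_0_r; lra|].
      left; apply exp_increasing; apply Rmult_lt_0_compat; lra.
  - rewrite <- (Rmult_1_l (bd (S n) t)).
    apply (integral_close (picard_iter (S n)) (picard_iter n) n 1 t); try apply picard_lip; [easy|].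
    intros s Hs j; rewrite Rmult_1_l; apply IH; lra.
Qed.

Lemma picard_cauchy n m t i : 0 <= t ->
  Rabs (picard_iter (n + m) i t - picard_iter n i t) <= 2 * bd n t.
Proof.
  intros Ht.
  assert (Rabs (picard_iter (n + m) i t - picard_iter n i t) <= 2 * bd n t - 2 * bd (n + m) t).
  { induction m as [|m IH].
    - rewrite Nat.add_0_r, Rminus_diag, Rabs_R0; lra.
    - replace (n + S m)%nat with (S (n + m)) by lia.
      pose proof (picard_step (n + m) t Ht i) as Hs; rewrite bd_half.
      replace (picard_iter (S (n + m)) i t - picard_iter n i t) with
        ((picard_iter (S (n + m)) i t - picard_iter (n + m) i t) +
         (picard_iter (n + m) i t - picard_iter n i t)) by ring.
      eapply Rle_trans; [apply Rabs_triang|]; lra. }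
  pose proof (bd_nonneg i (n + m) t); lra.
Qed.

Let Y i t := real (Lim_seq (fun n => picard_iter n i t)).

Lemma bd_geom n t : bd n t = C * exp (2 * K * t) * / 2 ^ n.
Proof. unfold bd; ring. Qed.

Lemma picard_lim i t : 0 <= t -> is_lim_seq (fun n => picard_iter n i t) (Y i t).
Proof.
  intros Ht; apply Lim_seq_correct', ex_lim_seq_cauchy_corr.
  intros e.
  assert (L : is_lim_seq (fun n => 4 * bd n t) (4 * C * exp (2 * K * t) * 0)).
  { apply (is_lim_seq_ext (fun n => 4 * C * exp (2 * K * t) * (/ 2) ^ n)).
    - intros n; rewrite bd_geom, pow_inv; ring.
    - apply (is_lim_seq_scal_l (fun n => (/ 2) ^ n) _ 0).
      apply is_lim_seq_geom; rewrite Rabs_right; lra. }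
  apply is_lim_seq_spec in L; destruct (L e) as [N HN].
  exists N; intros n m Hn Hm.
  specialize (HN N (le_n N)); apply Rabs_def2 in HN.
  pose proof (picard_cauchy N (n - N) t i Ht) as H1.
  pose proof (picard_cauchy N (m - N) t i Ht) as H2.
  replace (N + (n - N))%nat with n in H1 by lia.
  replace (N + (m - N))%nat with m in H2 by lia.
  apply Rabs_le_between in H1; apply Rabs_le_between in H2; apply Rabs_def1; lra.
Qed.

Lemma picard_close n t i : 0 <= t -> Rabs (picard_iter n i t - Y i t) <= 2 * bd n t.
Proof.
  intros Ht; rewrite Rabs_minus_sym.
  assert (L : is_lim_seq (fun m => Rabs (picard_iter (m + n) i t - picard_iter n i t))
    (Rabs (Y i t - picard_iter n i t))).
  { apply (is_lim_seq_abs _ (Finite (Y i t - picard_iter n i t))), is_lim_seq_minus'.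
    - now apply (is_lim_seq_incr_n (fun m => picard_iter m i t)), picard_lim.
    - apply is_lim_seq_const. }
  apply (is_lim_seq_le (fun m => Rabs (picard_iter (m + n) i t - picard_iter n i t))
    (fun _ => 2 * bd n t) (Finite _) (Finite _)); [|exact L | apply is_lim_seq_const].
  intros m; rewrite Nat.add_comm; now apply picard_cauchy.
Qed.

Lemma limit_lip : lip Y.
Proof.
  intros i s t Hs Ht.
  apply (le_of_geom _ _ (2 * C * exp (2 * K * s) + 2 * C * exp (2 * K * t))); intros n.
  pose proof (picard_close n s i Hs) as H1; pose proof (picard_close n t i Ht) as H2.
  rewrite bd_geom in H1, H2.
  pose proof (picard_lip n i s t Hs Ht) as H3.
  replace (Y i s - Y i t) with (- (picard_iter n i s - Y i s) +
    (picard_iter n i s - picard_iter n i t) + (picard_iter n i t - Y i t)) by ring.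
  eapply Rle_trans; [apply Rabs_triang|].
  eapply Rle_trans; [apply Rplus_le_compat_r, Rabs_triang|]; rewrite Rabs_Ropp; lra.
Qed.

Lemma limit_fixed i t : 0 <= t -> Y i t = u0 i + RInt (rhs Y i) 0 t.
Proof.
  intros Ht; apply Rminus_diag_uniq, Rabs_eq_0, Rle_antisym; [|apply Rabs_pos].
  apply (le_of_geom _ 0 (2 * C * exp (2 * K * t))); intros n.
  pose proof (picard_close (S n) t i Ht) as H1.
  pose proof (integral_close (picard_iter n) Y n 2 t (picard_lip n) limit_lip Ht) as H2.
  assert (H3 : forall s, 0 <= s <= t -> forall j, Rabs (picard_iter n j s - Y j s) <= 2 * bd n s).
  { intros s Hs j; apply picard_close; lra. }
  specialize (H2 H3 i); rewrite bd_half in H1, H2; rewrite bd_geom in H1, H2.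
  replace (Y i t - (u0 i + RInt (rhs Y i) 0 t)) with
    (- (picard_iter (S n) i t - Y i t) + (picard_iter (S n) i t - (u0 i + RInt (rhs Y i) 0 t))) by ring.
  eapply Rle_trans; [apply Rabs_triang|]; rewrite Rabs_Ropp; simpl in *; lra.
Qed.

Lemma lipschitz_solution : exists U : I -> R -> R, (forall i, U i 0 = u0 i) /\
  forall i t, 0 <= t -> is_derive (U i) t (f (fun j => U j t) i).
Proof.
  (* The witness is the integral and not [Y]: both agree for t >= 0, but the two-sided derivative at
     0 also involves negative times, where [Y] is not controlled. *)
  exists (fun i t => u0 i + RInt (rhs Y i) 0 t); split.
  - intros i; rewrite RInt_point; unfold zero; simpl; ring.
  - intros i t Ht; eapply is_derive_cv; [apply integral_derive, limit_lip|].
    unfold rhs at 1; rewrite Rmax_left by lra.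
    (* The two arguments of [f] agree only pointwise; the Lipschitz bound with arbitrarily small d
       shows that [f] does not distinguish them. *)
    assert (H : forall d, 0 < d -> Rabs (f (fun j => Y j t) i -
      f (fun j => u0 j + RInt (rhs Y j) 0 t) i) <= K * d).
    { intros d Hd; apply f_lip; intros j.
      rewrite <- limit_fixed by easy; rewrite Rminus_diag, Rabs_R0; lra. }
    apply Rminus_diag_uniq, Rabs_eq_0, Rle_antisym; [|apply Rabs_pos].
    apply (le_of_geom _ 0 K); intros n; rewrite Rplus_0_l; apply H.
    apply Rinv_0_lt_compat, pow_lt; lra.
Qed.

End Picard.

(** * The soliton system and its solutions from the singular orbit *)

Inductive ix := ixi | iL1 | iL2 | iL3 | iR1 | iR2 | iR3.

Definition G (a : ix -> R) (i : ix) : R :=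
  match i with
  | ixi => - (a iL1 ^ 2 + a iL2 ^ 2 + a iL3 ^ 2)
  | iL1 => - a ixi * a iL1 + a iR1 ^ 2 / 2 - (a iR2 - a iR3) ^ 2 / 2
  | iL2 => - a ixi * a iL2 + a iR2 ^ 2 / 2 - (a iR3 - a iR1) ^ 2 / 2
  | iL3 => - a ixi * a iL3 + a iR3 ^ 2 / 2 - (a iR1 - a iR2) ^ 2 / 2
  | iR1 => a iR1 * (a iL1 - a iL2 - a iL3)
  | iR2 => a iR2 * (a iL2 - a iL3 - a iL1)
  | iR3 => a iR3 * (a iL3 - a iL1 - a iL2)
  end.

Definition ode (U : ix -> R -> R) (r : R) :=
  forall i, is_derive (U i) r (G (fun j => U j r) i).

Definition energy (U : ix -> R -> R) (r : R) :=
  U ixi r ^ 2 - (U iL1 r ^ 2 + U iL2 r ^ 2 + U iL3 r ^ 2)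
  - (U iR1 r * U iR2 r + U iR2 r * U iR3 r + U iR3 r * U iR1 r
     - (U iR1 r ^ 2 + U iR2 r ^ 2 + U iR3 r ^ 2) / 2).

(** Only the leading terms of the singular expansion are kept, not its smoothness; together with the
    value of [energy] they already determine the solution. *)
Definition sing_lims (be ga : R) (U : ix -> R -> R) :=
  lim0 (fun r => U ixi r - 1 / r) 0 /\ lim0 (fun r => U iL1 r - 1 / r) 0 /\
  lim0 (U iL2) ga /\ lim0 (U iL3) (- ga) /\ lim0 (fun r => U iR1 r / r) be /\
  lim0 (fun r => U iR2 r - 1 / (2 * r)) ga /\ lim0 (fun r => U iR3 r - 1 / (2 * r)) (- ga).

Lemma sing_lims_ext T ga be U W :
  0 < T -> (forall i r, 0 < r <= T -> W i r = U i r) -> sing_lims be ga U -> sing_lims be ga W.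
Proof.
  intros HT E [A [B [C [D [F [K L]]]]]].
  assert (X : forall f g l, (forall r, 0 < r <= T -> f r = g r) -> lim0 f l -> lim0 g l)
    by (intros f g l; now apply lim0_ext).
  repeat split;
  [apply X with (2 := A) | apply X with (2 := B) | apply X with (2 := C) | apply X with (2 := D)
  | apply X with (2 := F) | apply X with (2 := K) | apply X with (2 := L)];
  intros; rewrite E by lra; reflexivity.
Qed.

(* The first integral [energy] equals [2 * al] along the solution with parameters [(al, be, ga)];
   this replaces the condition on the limit of [(xi - L1 - L2 - L3) / r]. *)
Definition sol (al be ga b : R) (U : ix -> R -> R) :=
  (forall r, 0 < r <= b -> ode U r) /\
  (forall r, 0 < r <= b -> energy U r = 2 * al) /\ sing_lims be ga U.

Ltac getode H :=
  let h := fresh in pose proof H as h; unfold ode in h;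
  let d0 := fresh "d0" in pose proof (h ixi) as d0;
  let d1 := fresh "d1" in pose proof (h iL1) as d1;
  let d2 := fresh "d2" in pose proof (h iL2) as d2;
  let d3 := fresh "d3" in pose proof (h iL3) as d3;
  let d4 := fresh "d4" in pose proof (h iR1) as d4;
  let d5 := fresh "d5" in pose proof (h iR2) as d5;
  let d6 := fresh "d6" in pose proof (h iR3) as d6; clear h; cbn [G] in *.

Lemma ode_cont U r i : ode U r -> continuous (U i) r.
Proof. intros H; eapply is_derive_cont, H. Qed.

Lemma energy_derive U r : ode U r -> is_derive (energy U) r 0.
Proof. intros H; getode H; unfold energy; derive_as; field. Qed.

Lemma energy_const U a b : a <= b -> (forall r, a <= r <= b -> ode U r) -> energy U a = energy U b.
Proof. intros Hab H; apply const_on; [easy|]; intros; now apply energy_derive, H. Qed.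

Lemma ix_unif (Q : ix -> R -> Prop) :
  (forall i, exists d, 0 < d /\ forall e, 0 < e <= d -> Q i e) ->
  exists d, 0 < d /\ forall i e, 0 < e <= d -> Q i e.
Proof.
  intros H.
  destruct (H ixi) as [a [Ha Pa]], (H iL1) as [b [Hb Pb]], (H iL2) as [c [Hc Pc]],
    (H iL3) as [d [Hd Pd]], (H iR1) as [e [He Pe]], (H iR2) as [f [Hf Pf]], (H iR3) as [g [Hg Pg]].
  exists (Rmin a (Rmin b (Rmin c (Rmin d (Rmin e (Rmin f g)))))); split.
  - repeat apply Rmin_pos; easy.
  - intros i x [Hx Hm].
    assert (K : forall u v, x <= Rmin u v -> x <= u /\ x <= v).
    { intros u v h; pose proof (Rmin_l u v); pose proof (Rmin_r u v); lra. }
    apply K in Hm; destruct Hm as [h1 Hm]; apply K in Hm; destruct Hm as [h2 Hm].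
    apply K in Hm; destruct Hm as [h3 Hm]; apply K in Hm; destruct Hm as [h4 Hm].
    apply K in Hm; destruct Hm as [h5 Hm]; apply K in Hm; destruct Hm as [h6 h7].
    destruct i; auto.
Qed.

Lemma ix_max (v : ix -> R) : exists M, 0 < M /\ forall i, v i <= M.
Proof.
  exists (1 + Rabs (v ixi) + Rabs (v iL1) + Rabs (v iL2) + Rabs (v iL3) + Rabs (v iR1) +
    Rabs (v iR2) + Rabs (v iR3)).
  pose proof (fun j => Rabs_pos (v j)) as h; pose proof (h ixi); pose proof (h iL1).
  pose proof (h iL2); pose proof (h iL3); pose proof (h iR1); pose proof (h iR2).
  pose proof (h iR3); split; [lra|].
  intros i; pose proof (Rle_abs (v i)); destruct i; lra.
Qed.

Lemma bounded_on (f : R -> R) a b :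
  a <= b -> (forall x, a <= x <= b -> continuous f x) ->
  exists M, forall x, a <= x <= b -> Rabs (f x) <= M.
Proof.
  intros Hab Hc.
  destruct (continuity_ab_maj (fun x => Rabs (f x)) a b Hab) as [m [Hm _]].
  - intros x Hx; apply continuity_pt_filterlim, (continuous_comp f Rabs); [now apply Hc|].
    apply (continuous_abs (f x)).
  - now exists (Rabs (f m)).
Qed.

Lemma bounded_from0 (f : R -> R) b l :
  0 < b -> (forall x, 0 < x <= b -> continuous f x) -> lim0 f l ->
  exists M, forall x, 0 < x <= b -> Rabs (f x) <= M.
Proof.
  intros Hb Hc Hl; destruct (proj1 (lim0_eps f l) Hl 1 Rlt_0_1) as [d [Hd H]].
  assert (Hm : 0 < Rmin (d / 2) b) by (apply Rmin_pos; lra).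
  pose proof (Rmin_l (d / 2) b); pose proof (Rmin_r (d / 2) b).
  destruct (bounded_on f (Rmin (d / 2) b) b) as [M HM]; [easy | intros; apply Hc; lra |].
  exists (Rmax M (Rabs l + 1)); intros x Hx.
  destruct (Rle_lt_dec (Rmin (d / 2) b) x).
  - eapply Rle_trans; [apply HM; lra | apply Rmax_l].
  - eapply Rle_trans; [|apply Rmax_r].
    replace (f x) with (l + (f x - l)) by ring.
    eapply Rle_trans; [apply Rabs_triang|].
    specialize (H x ltac:(lra)); lra.
Qed.

(** * Continuation of solutions *)

(** Truncating every coordinate makes the quadratic field [G] bounded and globally Lipschitz, and
    leaves it unchanged where all coordinates are at most [M] in absolute value. *)
Definition clip M x := Rmax (- M) (Rmin x M).

Lemma clip_id M x : Rabs x <= M -> clip M x = x.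
Proof.
  intros H; apply Rabs_le_between in H; unfold clip; rewrite Rmin_left, Rmax_right; lra.
Qed.

Lemma clip_le M x : 0 <= M -> Rabs (clip M x) <= M.
Proof.
  intros H; apply Rabs_le; unfold clip; split; [apply Rmax_l|].
  apply Rmax_lub; [lra | apply Rmin_r].
Qed.

Lemma clip_lip M x y : 0 <= M -> Rabs (clip M x - clip M y) <= Rabs (x - y).
Proof.
  intros H; unfold clip, Rmax, Rmin; repeat destruct Rle_dec; unfold Rabs; repeat destruct Rcase_abs; lra.
Qed.

Lemma prod_lip M d x y x' y' :
  Rabs x <= M -> Rabs y' <= M -> Rabs (x - x') <= d -> Rabs (y - y') <= d ->
  - (2 * M * d) <= x * y - x' * y' <= 2 * M * d.
Proof.
  intros Hx Hy Hdx Hdy; apply Rabs_le_between.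
  replace (x * y - x' * y') with (x * (y - y') + (x - x') * y') by ring.
  eapply Rle_trans; [apply Rabs_triang|]; rewrite !Rabs_mult.
  pose proof (Rmult_le_compat _ _ _ _ (Rabs_pos x) (Rabs_pos (y - y')) Hx Hdy).
  pose proof (Rmult_le_compat _ _ _ _ (Rabs_pos (x - x')) (Rabs_pos y') Hdx Hy); lra.
Qed.

Lemma G_lip M d a b :
  (forall i, Rabs (a i) <= M) -> (forall i, Rabs (b i) <= M) ->
  (forall i, Rabs (a i - b i) <= d) -> forall i, Rabs (G a i - G b i) <= 8 * M * d.
Proof.
  intros Ha Hb Hd.
  assert (P : forall i j, - (2 * M * d) <= a i * a j - b i * b j <= 2 * M * d)
    by (intros; now apply prod_lip).
  assert (0 <= M * d).
  { apply Rmult_le_pos; eapply Rle_trans; [|apply (Ha ixi) | |apply (Hd ixi)]; apply Rabs_pos. }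
  intros i; apply Rabs_le; destruct i; cbn [G].
  - pose proof (P iL1 iL1); pose proof (P iL2 iL2); pose proof (P iL3 iL3); lra.
  - pose proof (P ixi iL1); pose proof (P iR1 iR1); pose proof (P iR2 iR2).
    pose proof (P iR3 iR3); pose proof (P iR2 iR3); lra.
  - pose proof (P ixi iL2); pose proof (P iR1 iR1); pose proof (P iR2 iR2).
    pose proof (P iR3 iR3); pose proof (P iR3 iR1); lra.
  - pose proof (P ixi iL3); pose proof (P iR1 iR1); pose proof (P iR2 iR2).
    pose proof (P iR3 iR3); pose proof (P iR1 iR2); lra.
  - pose proof (P iR1 iL1); pose proof (P iR1 iL2); pose proof (P iR1 iL3); lra.
  - pose proof (P iR2 iL1); pose proof (P iR2 iL2); pose proof (P iR2 iL3); lra.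
  - pose proof (P iR3 iL1); pose proof (P iR3 iL2); pose proof (P iR3 iL3); lra.
Qed.

Definition Gc M (a : ix -> R) := G (fun j => clip M (a j)).

Lemma Gc_lip M a b d : 0 <= M -> (forall j, Rabs (a j - b j) <= d) ->
  forall i, Rabs (Gc M a i - Gc M b i) <= 8 * M * d.
Proof.
  intros HM H; apply G_lip; intros; try now apply clip_le.
  eapply Rle_trans; [now apply clip_lip | apply H].
Qed.

Lemma Gc_bound M a i : 0 <= M -> Rabs (Gc M a i) <= 16 * M * M.
Proof.
  intros HM.
  assert (E : G (fun _ => 0) i = 0) by (destruct i; cbn; field).
  rewrite <- (Rminus_0_r (Gc M a i)), <- E.
  eapply Rle_trans; [apply (G_lip M M); intros; try (now apply clip_le)|].
  - rewrite Rabs_R0; lra.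
  - rewrite Rminus_0_r; now apply clip_le.
  - nra.
Qed.

Lemma Gc_id M a : (forall i, Rabs (a i) <= M) -> forall i, Gc M a i = G a i.
Proof.
  intros H i; unfold Gc; destruct i; cbn; rewrite !clip_id; auto.
Qed.

Lemma clipped_solution M T (u0 : ix -> R) : 0 < M -> exists V : ix -> R -> R,
  (forall i, V i T = u0 i) /\
  forall i t, T <= t -> is_derive (V i) t (Gc M (fun j => V j t) i).
Proof.
  intros HM.
  destruct (lipschitz_solution ix (Gc M) (8 * M) (16 * M * M) u0) as [V [H0 H]].
  - lra.
  - intros; apply Gc_bound; lra.
  - intros; apply Gc_lip; [lra | easy].
  - exists (fun i t => V i (t - T)); split.
    + intros; now rewrite Rminus_diag.
    + intros i t Ht.
      eapply is_derive_cv.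
      * apply (is_derive_comp (V i) (fun t => t - T)); [apply H; lra|].
        apply dminus; [apply did | apply dconst].
      * unfold scal; simpl; unfold mult; simpl; ring.
Qed.

Definition nsq (a : ix -> R) :=
  a ixi ^ 2 + a iL1 ^ 2 + a iL2 ^ 2 + a iL3 ^ 2 + a iR1 ^ 2 + a iR2 ^ 2 + a iR3 ^ 2.

Lemma nsq_nonneg a : 0 <= nsq a.
Proof.
  unfold nsq; repeat apply Rplus_le_le_0_compat; apply pow2_ge_0.
Qed.

Lemma abs_le_nsq a i : Rabs (a i) <= sqrt (nsq a).
Proof.
  rewrite <- sqrt_Rsqr_abs; apply sqrt_le_1_alt; unfold nsq, Rsqr.
  pose proof (fun j => pow2_ge_0 (a j)) as h; pose proof (h ixi); pose proof (h iL1).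
  pose proof (h iL2); pose proof (h iL3); pose proof (h iR1); pose proof (h iR2).
  pose proof (h iR3); destruct i; lra.
Qed.

Lemma nsq_le a d : (forall i, Rabs (a i) <= d) -> nsq a <= 7 * d ^ 2.
Proof.
  intros H; unfold nsq.
  assert (forall i, a i ^ 2 <= d ^ 2).
  { intros i; rewrite <- (pow2_abs (a i)); apply pow_incr; split; [apply Rabs_pos | apply H]. }
  pose proof (H0 ixi); pose proof (H0 iL1); pose proof (H0 iL2); pose proof (H0 iL3).
  pose proof (H0 iR1); pose proof (H0 iR2); pose proof (H0 iR3); lra.
Qed.

(** Gronwall for the squared Euclidean distance, which unlike the sup distance is differentiable.
    Each of the seven coordinates contributes at most 2 * 8 M times that square, whence 112 M. *)
Lemma clipped_close M T b (U V : ix -> R -> R) :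
  0 <= M -> T <= b ->
  (forall i t, T <= t <= b -> is_derive (U i) t (Gc M (fun j => U j t) i)) ->
  (forall i t, T <= t <= b -> is_derive (V i) t (Gc M (fun j => V j t) i)) ->
  nsq (fun i => U i b - V i b) <= nsq (fun i => U i T - V i T) * exp (112 * M * (b - T)).
Proof.
  intros HM Hb HU HV.
  set (F := fun i t => Gc M (fun j => U j t) i - Gc M (fun j => V j t) i).
  set (N' := fun t => 2 * (U ixi t - V ixi t) * F ixi t + 2 * (U iL1 t - V iL1 t) * F iL1 t
    + 2 * (U iL2 t - V iL2 t) * F iL2 t + 2 * (U iL3 t - V iL3 t) * F iL3 t
    + 2 * (U iR1 t - V iR1 t) * F iR1 t + 2 * (U iR2 t - V iR2 t) * F iR2 t
    + 2 * (U iR3 t - V iR3 t) * F iR3 t).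
  pose proof (gron_ge (fun t => - nsq (fun i => U i t - V i t)) (fun t => - N' t)
    (fun _ => 112 * M) (fun t => 112 * M * t) T b Hb) as Gr.
  rewrite <- Rmult_minus_distr_l in Gr.
  cut (- nsq (fun i => U i T - V i T) * exp (112 * M * (b - T)) <= - nsq (fun i => U i b - V i b));
    [lra|]; apply Gr; clear Gr.
  - intros t Ht; unfold nsq, N', F.
    assert (D : forall i, is_derive (fun t => (U i t - V i t) ^ 2) t (2 * (U i t - V i t) * F i t)).
    { intros i; apply (dsqr (fun t => U i t - V i t)), dminus; auto. }
    apply dopp; repeat apply dplus; apply D.
  - intros t Ht; derive_as; ring.
  - intros t Ht.
    set (n := sqrt (nsq (fun i => U i t - V i t))).
    assert (Hn : n * n = nsq (fun i => U i t - V i t)) by apply sqrt_sqrt, nsq_nonneg.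
    assert (H : forall i, 2 * (U i t - V i t) * F i t <= 16 * M * (n * n)).
    { intros i.
      assert (H1 : Rabs (U i t - V i t) <= n) by apply (abs_le_nsq (fun i => U i t - V i t)).
      assert (H2 : Rabs (F i t) <= 8 * M * n).
      { apply Gc_lip; [easy|]; intros j; apply (abs_le_nsq (fun i => U i t - V i t)). }
      pose proof (Rmult_le_compat _ _ _ _ (Rabs_pos _) (Rabs_pos _) H1 H2) as H3.
      rewrite <- Rabs_mult in H3; apply Rabs_le_between in H3; lra. }
    pose proof (H ixi); pose proof (H iL1); pose proof (H iL2); pose proof (H iL3).
    pose proof (H iR1); pose proof (H iR2); pose proof (H iR3).
    unfold N'; rewrite <- Hn; lra.
Qed.

Definition glue (T : R) (f g : R -> R) (r : R) := if Rle_dec r T then f r else g r.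

Lemma glue_l T f g r : r <= T -> glue T f g r = f r.
Proof. intros H; unfold glue; destruct Rle_dec; [easy | lra]. Qed.

Lemma glue_r T f g r : f T = g T -> T <= r -> glue T f g r = g r.
Proof.
  intros E H; unfold glue; destruct Rle_dec; [|easy]; now replace r with T by lra.
Qed.

Lemma glue_derive T f g r l :
  f T = g T -> (r <= T -> is_derive f r l) -> (T <= r -> is_derive g r l) ->
  is_derive (glue T f g) r l.
Proof.
  intros E Hf Hg; destruct (total_order_T r T) as [[h|h]|h].
  - apply (is_derive_near f _ _ _ (T - r)); [lra | | apply Hf; lra].
    intros y Hy; apply Rabs_def2 in Hy; rewrite glue_l; [easy | lra].
  - subst r; specialize (Hf (Rle_refl T)); specialize (Hg (Rle_refl T)).
    apply is_derive_Reals in Hf; apply is_derive_Reals in Hg; apply is_derive_Reals.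
    intros e He; destruct (Hf e He) as [d1 H1], (Hg e He) as [d2 H2].
    assert (Hd : 0 < Rmin d1 d2) by (apply Rmin_pos; apply cond_pos).
    exists (mkposreal _ Hd); intros h Hh Hhd; simpl in Hhd.
    rewrite (glue_l T f g T) by lra.
    destruct (Rle_lt_dec h 0).
    + rewrite glue_l by lra; apply H1; [easy|].
      eapply Rlt_le_trans; [exact Hhd | apply Rmin_l].
    + rewrite glue_r by (easy || lra); rewrite E; apply H2; [easy|].
      eapply Rlt_le_trans; [exact Hhd | apply Rmin_r].
  - apply (is_derive_near g _ _ _ (r - T)); [lra | | apply Hg; lra].
    intros y Hy; apply Rabs_def2 in Hy; rewrite glue_r; [easy | easy | lra].
Qed.

Lemma G_ext a b i : (forall j, a j = b j) -> G a i = G b i.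
Proof. intros H; destruct i; cbn; rewrite !H; reflexivity. Qed.

Lemma glue_sol al be ga T M b U V :
  0 < T <= b -> sol al be ga T U -> (forall i, V i T = U i T) ->
  (forall i t, T <= t -> is_derive (V i) t (Gc M (fun j => V j t) i)) ->
  (forall i t, T <= t <= b -> Rabs (V i t) <= M) ->
  sol al be ga b (fun i => glue T (U i) (V i)).
Proof.
  intros HT [H1 [H2 H3]] E HV HM.
  assert (HO : forall r, 0 < r <= b -> ode (fun i => glue T (U i) (V i)) r).
  { intros r Hr i; apply glue_derive; [now rewrite E | |].
    - intros h; rewrite (G_ext _ (fun j => U j r)); [apply H1; lra|].
      intros j; now apply glue_l.
    - intros h; eapply is_derive_cv; [now apply HV|].
      rewrite (Gc_id M) by (intros; apply HM; lra).
      apply G_ext; intros j; rewrite glue_r; [easy | now rewrite E | easy]. }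
  split; [easy | split].
  - intros r Hr.
    assert (forall r, 0 < r <= T -> energy (fun i => glue T (U i) (V i)) r = 2 * al).
    { intros x Hx; unfold energy; rewrite !glue_l by lra; now apply H2. }
    destruct (Rle_lt_dec r T); [apply H; lra|].
    rewrite <- (H T) by lra; symmetry; apply energy_const; [lra|]; intros; apply HO; lra.
  - apply (sing_lims_ext T ga be U); [lra | intros; now rewrite glue_l by lra | exact H3].
Qed.

(** An a priori bound on all continuations up to times at most [b] yields existence up to [b]. The
    system clipped at m + 1 has a global solution, and as long as that solution stays below m + 1 it
    solves the true system, to which the a priori bound applies. *)
Lemma sol_continuation al be ga T U b :
  0 < T <= b -> sol al be ga T U ->
  (exists M, forall b' W, T <= b' <= b -> sol al be ga b' W ->
    forall i r, T <= r < b' -> Rabs (W i r) <= M) ->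
  exists W, sol al be ga b W /\ forall i r, 0 < r <= T -> W i r = U i r.
Proof.
  intros HT HU [M HM].
  destruct (ix_max (fun i => Rabs (U i T))) as [M1 [HM1 HM1']].
  set (m := Rmax M M1).
  assert (Hm : 0 < m) by (eapply Rlt_le_trans; [apply HM1 | apply Rmax_r]).
  destruct (clipped_solution (m + 1) T (fun i => U i T)) as [V [V0 HV]]; [lra|].
  assert (Hc : forall i t, T <= t -> continuous (V i) t)
    by (intros; eapply is_derive_cont, HV; easy).
  exists (fun i => glue T (U i) (V i)); split; [|intros; now apply glue_l].
  apply (glue_sol _ _ _ _ (m + 1)); auto.
  intros i t Ht; revert i.
  apply (real_ind_from (fun t => forall i, Rabs (V i t) <= m + 1) T b); [| | |easy].
  - intros i; rewrite V0; eapply Rle_trans; [apply HM1'|].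
    assert (M1 <= m) by apply Rmax_r; lra.
  - intros r Hr H i.
    apply (cont_le_left (fun t => Rabs (V i t)) T r); [lra | | intros; apply H; lra].
    apply (continuous_comp (V i) Rabs); [apply Hc; lra | apply (continuous_abs (V i r))].
  - intros r Hr H.
    (* The bound m + 1 known on [T, r] improves to m; the margin 1 then carries the induction past
       r. *)
    assert (Hb : forall i, Rabs (V i r) <= m).
    { destruct (Req_dec r T) as [->|Hne].
      - intros i; rewrite V0; eapply Rle_trans; [apply HM1' | apply Rmax_r].
      - intros i.
        assert (S : sol al be ga r (fun i => glue T (U i) (V i))).
        { apply (glue_sol _ _ _ _ (m + 1)); auto; lra. }
        apply (cont_le_left (fun t => Rabs (V i t)) T r); [lra | | ].
        + apply (continuous_comp (V i) Rabs); [apply Hc; lra | apply (continuous_abs (V i r))].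
        + intros y Hy; eapply Rle_trans; [|apply Rmax_l].
          pose proof (HM r _ ltac:(lra) S i y ltac:(lra)) as h; cbv beta in h.
          rewrite glue_r in h; [easy | now rewrite V0 | lra]. }
    destruct (ix_unif (fun i e => forall x, r < x < r + e -> Rabs (V i x) <= m + 1)) as [d [Hd H']].
    + intros i; destruct (cont_eps (V i) r (Hc i r ltac:(lra)) 1 Rlt_0_1) as [d [Hd Hd']].
      exists d; split; [easy|]; intros e He x Hx.
      replace (V i x) with (V i r + (V i x - V i r)) by ring.
      eapply Rle_trans; [apply Rabs_triang|]; specialize (Hb i).
      assert (Rabs (V i x - V i r) < 1) by (apply Hd'; rewrite Rabs_right; lra); lra.
    + exists d; split; [easy|]; intros x Hx _ i; apply (H' i d); [lra | easy].
Qed.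

Lemma sol_restrict al be ga b b' U : 0 < b' <= b -> sol al be ga b U -> sol al be ga b' U.
Proof.
  intros Hb [H1 [H2 H3]]; split; [intros; apply H1; lra | split; [intros; apply H2; lra | easy]].
Qed.

(** * Dependence on the parameters at the singular orbit *)

(* Coordinates in which the singular part of the system is triangular with nonpositive eigenvalues:
   the growing modes are removed by using [R1 / r] and, through the first integral,
   [xi - L1 - L2 - L3]. *)
Definition zc (U : ix -> R -> R) (i : ix) (r : R) : R :=
  match i with
  | ixi => U ixi r - U iL1 r - U iL2 r - U iL3 r
  | iL1 => U iL1 r - 1 / r
  | iL2 => U iL2 r + U iL3 r
  | iL3 => (U iL2 r - U iL3 r) + (U iR2 r - U iR3 r)
  | iR1 => U iR1 r / r
  | iR2 => U iR2 r + U iR3 r - 1 / r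
  | iR3 => (U iL2 r - U iL3 r) - (U iR2 r - U iR3 r)
  end.

Definition Zsing (a : ix -> R) (i : ix) : R :=
  match i with
  | ixi => - a ixi
  | iL1 => - (a ixi + 2 * a iL1 + a iL2)
  | iL2 => - a iL2
  | iL3 => 0
  | iR1 => 0
  | iR2 => - (a iL1 + a iR2)
  | iR3 => - (2 * a iR3)
  end.

(** In the coordinates [zc], [q], [h] and [g] are xi - 1/r, L2 - L3 and R2 - R3, and [c] stands for
    the value of the first integral. *)
Definition Zreg (r c : R) (a : ix -> R) (i : ix) : R :=
  let q := a ixi + a iL1 + a iL2 in
  let h := (a iL3 + a iR3) / 2 in
  let g := (a iL3 - a iR3) / 2 in
  match i with
  | ixi => c - q * a ixi
  | iL1 => - q * a iL1 + r ^ 2 * a iR1 ^ 2 / 2 - g ^ 2 / 2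
  | iL2 => - q * a iL2 + a iR1 + r * a iR1 * a iR2 - r ^ 2 * a iR1 ^ 2
  | iL3 => h * (a iR2 - q) + g * (a iR2 - a iL1 - r * a iR1)
  | iR1 => a iR1 * (a iL1 - a iL2)
  | iR2 => - a iL1 * a iR2 + g * h
  | iR3 => - h * (q + a iR2) + g * (a iR2 + a iL1 - r * a iR1)
  end.

Lemma zc_derive U r i : 0 < r -> ode U r ->
  is_derive (zc U i) r (Zsing (fun j => zc U j r) i / r + Zreg r (energy U r) (fun j => zc U j r) i).
Proof.
  intros Hr H; getode H.
  destruct i; cbv beta iota zeta delta [zc Zsing Zreg]; derive_as; unfold energy; try field; lra.
Qed.

Lemma sol_zc_lim al be ga b U : 0 < b -> sol al be ga b U ->
  lim0 (zc U ixi) 0 /\ lim0 (zc U iL1) 0 /\ lim0 (zc U iL2) 0 /\ lim0 (zc U iL3) (4 * ga) /\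
  lim0 (zc U iR1) be /\ lim0 (zc U iR2) 0 /\ lim0 (zc U iR3) 0.
Proof.
  intros Hb [_ [_ [H1 [H2 [H3 [H4 [H5 [H6 H7]]]]]]]]; repeat split; cbv beta iota delta [zc].
  - apply (lim0_ext (fun r => (U ixi r - 1 / r) - (U iL1 r - 1 / r) - U iL2 r - U iL3 r) _ b); [easy | |].
    + intros; ring.
    + eapply lim0_eq; [exact (lim0_minus _ _ _ _ (lim0_minus _ _ _ _ (lim0_minus _ _ _ _ H1 H2) H3) H4) | ring].
  - exact H2.
  - eapply lim0_eq; [lim0s | ring].
  - apply (lim0_ext (fun r => (U iL2 r - U iL3 r) + ((U iR2 r - 1 / (2 * r)) - (U iR3 r - 1 / (2 * r)))) _ b);
      [easy | intros; ring |].
    eapply lim0_eq; [exact (lim0_plus _ _ _ _ (lim0_minus _ _ _ _ H3 H4) (lim0_minus _ _ _ _ H6 H7)) | ring].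
  - exact H5.
  - apply (lim0_ext (fun r => (U iR2 r - 1 / (2 * r)) + (U iR3 r - 1 / (2 * r))) _ b); [easy | |].
    + intros; field; lra.
    + eapply lim0_eq; [exact (lim0_plus _ _ _ _ H6 H7) | ring].
  - apply (lim0_ext (fun r => (U iL2 r - U iL3 r) - ((U iR2 r - 1 / (2 * r)) - (U iR3 r - 1 / (2 * r)))) _ b);
      [easy | intros; ring |].
    eapply lim0_eq; [exact (lim0_minus _ _ _ _ (lim0_minus _ _ _ _ H3 H4) (lim0_minus _ _ _ _ H6 H7)) | ring].
Qed.

Lemma sol_zc_bounded al be ga b U : 0 < b -> sol al be ga b U ->
  exists M, 0 < M /\ forall r i, 0 < r <= b -> Rabs (zc U i r) <= M.
Proof.
  intros Hb H; pose proof (sol_zc_lim _ _ _ _ _ Hb H) as HL.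
  assert (Hc : forall i r, 0 < r <= b -> continuous (zc U i) r).
  { intros i r Hr; eapply is_derive_cont, zc_derive; [lra | now apply H]. }
  assert (E : forall i, exists M, forall r, 0 < r <= b -> Rabs (zc U i r) <= M).
  { intros i; destruct HL as [L0 [L1 [L2 [L3 [L4 [L5 L6]]]]]].
    destruct i; eapply bounded_from0; eauto. }
  (* Bounds are encoded as reciprocals, so that a common small radius becomes a common bound for the
     seven coordinates. *)
  destruct (ix_unif (fun i e => forall r, 0 < r <= b -> Rabs (zc U i r) <= / e)) as [d [Hd H']].
  - intros i; destruct (E i) as [M HM].
    assert (0 < Rabs M + 1) by (pose proof (Rabs_pos M); lra).
    exists (/ (Rabs M + 1)); split; [now apply Rinv_0_lt_compat|].
    intros e He r Hr; eapply Rle_trans; [now apply HM|].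
    apply Rle_trans with (Rabs M + 1); [pose proof (Rle_abs M); lra|].
    rewrite <- (Rinv_inv (Rabs M + 1)); apply Rinv_le_contravar; lra.
  - exists (/ d); split; [now apply Rinv_0_lt_compat|].
    intros r i Hr; apply (H' i d); [lra | easy].
Qed.

(** The three cross terms all contain [d iL1], and completing squares absorbs them. The part of the
    field divided by r thus never increases the distance between two solutions, however close to the
    singular orbit. *)
Lemma Zsing_dissipative d :
  d ixi * Zsing d ixi + d iL1 * Zsing d iL1 + d iL2 * Zsing d iL2 + d iL3 * Zsing d iL3
  + d iR1 * Zsing d iR1 + d iR2 * Zsing d iR2 + d iR3 * Zsing d iR3 <= 0.
Proof.
  cbn [Zsing].
  pose proof (pow2_ge_0 (d ixi + d iL1)); pose proof (pow2_ge_0 (d iL2 + d iL1)).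
  pose proof (pow2_ge_0 (d iR2 + d iL1)); pose proof (pow2_ge_0 (d iL1)).
  pose proof (pow2_ge_0 (d ixi)); pose proof (pow2_ge_0 (d iL2)).
  pose proof (pow2_ge_0 (d iR2)); pose proof (pow2_ge_0 (d iR3)); nra.
Qed.

(** Only the unprimed factors are bounded by [M]: the second solution is controlled through its
    distance to the first alone, which leaves a term quadratic in [n]. *)
Lemma prod_diff M n x y x' y' :
  Rabs x <= M -> Rabs y <= M -> Rabs (x' - x) <= n -> Rabs (y' - y) <= n ->
  - ((2 * M + n) * n) <= x' * y' - x * y <= (2 * M + n) * n.
Proof.
  intros Hx Hy Hdx Hdy.
  apply Rabs_le_between.
  replace (x' * y' - x * y) with (x * (y' - y) + (x' - x) * y + (x' - x) * (y' - y)) by ring.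
  eapply Rle_trans; [apply Rabs_triang|].
  eapply Rle_trans; [apply Rplus_le_compat_r, Rabs_triang|]; rewrite !Rabs_mult.
  pose proof (Rmult_le_compat _ _ _ _ (Rabs_pos x) (Rabs_pos (y' - y)) Hx Hdy).
  pose proof (Rmult_le_compat _ _ _ _ (Rabs_pos (x' - x)) (Rabs_pos y) Hdx Hy).
  pose proof (Rmult_le_compat _ _ _ _ (Rabs_pos (x' - x)) (Rabs_pos (y' - y)) Hdx Hdy); lra.
Qed.

Lemma scale_between k B e x : 0 <= k <= B -> - e <= x <= e -> - (B * e) <= k * x <= B * e.
Proof. intros Hk Hx; split; nra. Qed.

Lemma Zreg_diff b M n r c c' a a' :
  0 < r <= b -> (forall i, Rabs (a i) <= M) -> (forall i, Rabs (a' i - a i) <= n) ->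
  forall i, Rabs (Zreg r c' a' i - Zreg r c a i) <=
    (8 + 2 * b + b ^ 2) * ((2 * M + n) * n) + n + Rabs (c' - c).
Proof.
  intros Hr Ha Hd i.
  set (e := (2 * M + n) * n).
  assert (P : forall i j, - e <= a' i * a' j - a i * a j <= e) by (intros; now apply prod_diff).
  assert (He : 0 <= e) by (specialize (P ixi ixi); lra).
  assert (Q : forall i j, - (b * e) <= r * (a' i * a' j - a i * a j) <= b * e)
    by (intros; apply scale_between; [lra | apply P]).
  assert (Q2 : forall i j, - (b ^ 2 * e) <= r ^ 2 * (a' i * a' j - a i * a j) <= b ^ 2 * e).
  { intros; apply scale_between; [|apply P]; split; [apply pow2_ge_0 | apply pow_incr; lra]. }
  assert (0 <= b * e) by nra.
  assert (0 <= b ^ 2 * e) by (apply Rmult_le_pos; [apply pow2_ge_0 | easy]).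
  assert (Hn : 0 <= n) by (eapply Rle_trans; [apply Rabs_pos | apply (Hd ixi)]).
  pose proof (Rabs_pos (c' - c)) as Hc0.
  assert (Hc : - Rabs (c' - c) <= c' - c <= Rabs (c' - c)) by (apply Rabs_le_between; lra).
  pose proof (Hd iR1) as Hd1; apply Rabs_le_between in Hd1.
  apply Rabs_le; destruct i; cbn [Zreg].
  - pose proof (P ixi ixi); pose proof (P iL1 ixi); pose proof (P iL2 ixi); lra.
  - pose proof (P ixi iL1); pose proof (P iL1 iL1); pose proof (P iL2 iL1); pose proof (Q2 iR1 iR1).
    pose proof (P iL3 iL3); pose proof (P iL3 iR3); pose proof (P iR3 iR3); lra.
  - pose proof (P ixi iL2); pose proof (P iL1 iL2); pose proof (P iL2 iL2); pose proof (Q2 iR1 iR1).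
    pose proof (Q iR1 iR2); lra.
  - pose proof (P iL3 iR2); pose proof (P iL3 ixi); pose proof (P iL3 iL1); pose proof (P iL3 iL2).
    pose proof (P iR3 iR2); pose proof (P iR3 ixi); pose proof (P iR3 iL1); pose proof (P iR3 iL2).
    pose proof (Q iL3 iR1); pose proof (Q iR3 iR1); lra.
  - pose proof (P iR1 iL1); pose proof (P iR1 iL2); lra.
  - pose proof (P iL1 iR2); pose proof (P iL3 iL3); pose proof (P iR3 iR3); lra.
  - pose proof (P iL3 iR2); pose proof (P iL3 ixi); pose proof (P iL3 iL1); pose proof (P iL3 iL2).
    pose proof (P iR3 iR2); pose proof (P iR3 ixi); pose proof (P iR3 iL1); pose proof (P iR3 iL2).
    pose proof (Q iL3 iR1); pose proof (Q iR3 iR1); lra.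
Qed.

Definition zdist (U V : ix -> R -> R) (r : R) := nsq (fun i => zc V i r - zc U i r).

Lemma ratio_derive (m : R -> R) x m' :
  0 <= m x -> is_derive m x m' -> is_derive (fun r => m r / (1 + m r)) x (m' / (1 + m x) ^ 2).
Proof.
  intros H Hd; derive_as; [lra | field; lra].
Qed.

(** No a priori bound on [V] is available, so the energy estimate has the superlinear form m' <= k m
    (1 + m). The substitution m / (1 + m) makes it linear: its derivative m' / (1 + m)^2 is at most
    k m / (1 + m). The factor 16 comes from the limit 4 ga of [zc U iL3]. *)
Lemma singular_estimate al be ga b U : 0 < b -> sol al be ga b U ->
  exists K, 0 <= K /\ forall al' be' ga' V, sol al' be' ga' b V ->
    forall r, 0 < r <= b ->
    let m := zdist U V r + (2 * al' - 2 * al) ^ 2 in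
    m / (1 + m) <= ((be' - be) ^ 2 + 16 * (ga' - ga) ^ 2 + (2 * al' - 2 * al) ^ 2) * exp K.
Proof.
  intros Hb HU.
  destruct (sol_zc_bounded _ _ _ _ _ Hb HU) as [M [HM0 HM]].
  set (C := 8 + 2 * b + b ^ 2).
  assert (HC : 0 < C) by (unfold C; nra).
  (* 14 is seven coordinates times the 2 from differentiating a square; the additional 7 pays for
     the product of n with the difference of the first integrals, by 2 n u <= n^2 + u^2. *)
  set (k := 14 * (C * (2 * M + 1) + 1) + 7).
  assert (Hk : 0 <= k) by (assert (0 < C * (2 * M + 1)) by (apply Rmult_lt_0_compat; lra); unfold k; lra).
  exists (k * b); split; [apply Rmult_le_pos; lra|].
  intros al' be' ga' V HV r Hr.
  set (dc := 2 * al' - 2 * al).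
  set (m := fun r => zdist U V r + dc ^ 2).
  set (m0 := (be' - be) ^ 2 + 16 * (ga' - ga) ^ 2 + dc ^ 2).
  change (m r / (1 + m r) <= m0 * exp (k * b)).
  set (D := fun i r => zc V i r - zc U i r).
  set (F := fun i r => (Zsing (fun j => zc V j r) i / r + Zreg r (2 * al') (fun j => zc V j r) i)
    - (Zsing (fun j => zc U j r) i / r + Zreg r (2 * al) (fun j => zc U j r) i)).
  set (m' := fun r => 2 * D ixi r * F ixi r + 2 * D iL1 r * F iL1 r + 2 * D iL2 r * F iL2 r
    + 2 * D iL3 r * F iL3 r + 2 * D iR1 r * F iR1 r + 2 * D iR2 r * F iR2 r + 2 * D iR3 r * F iR3 r).
  assert (Hm' : forall r, 0 < r <= b -> is_derive m r (m' r)).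
  { intros x Hx.
    assert (HD : forall i, is_derive (fun t => (zc V i t - zc U i t) ^ 2) x (2 * D i x * F i x)).
    { intros i; apply (dsqr (fun t => zc V i t - zc U i t)).
      unfold F; rewrite <- (proj1 (proj2 HV) x Hx), <- (proj1 (proj2 HU) x Hx).
      apply dminus; apply zc_derive; try apply HV; try apply HU; lra. }
    unfold m, zdist, nsq, m'; rewrite <- (Rplus_0_r (_ + 2 * D iR3 x * F iR3 x)).
    apply dplus; [repeat apply dplus; apply HD | apply dconst]. }
  assert (Hm0 : forall r, 0 <= m r).
  { intros x; apply Rplus_le_le_0_compat; [apply nsq_nonneg | apply pow2_ge_0]. }
  assert (Hle : forall r, 0 < r <= b -> m' r <= k * (m r * (1 + m r))).
  { intros x Hx.
    set (n := sqrt (zdist U V x)).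
    assert (Hn : n * n = zdist U V x) by apply sqrt_sqrt, nsq_nonneg.
    assert (Hn0 : 0 <= n) by apply sqrt_pos.
    assert (HDn : forall i, Rabs (D i x) <= n) by (intros i; apply (abs_le_nsq (fun i => D i x))).
    set (E := fun i => Zreg x (2 * al') (fun j => zc V j x) i - Zreg x (2 * al) (fun j => zc U j x) i).
    set (w := C * ((2 * M + n) * n) + n + Rabs dc).
    assert (HE : forall i, D i x * E i <= n * w).
    { intros i.
      assert (H : Rabs (E i) <= w) by (apply Zreg_diff; auto).
      pose proof (Rmult_le_compat _ _ _ _ (Rabs_pos _) (Rabs_pos _) (HDn i) H) as H1.
      rewrite <- Rabs_mult in H1; apply Rabs_le_between in H1; lra. }
    assert (Hs := Zsing_dissipative (fun i => D i x)).
    assert (HF : m' x = 2 / x * (D ixi x * Zsing (fun i => D i x) ixi + D iL1 x * Zsing (fun i => D i x) iL1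
      + D iL2 x * Zsing (fun i => D i x) iL2 + D iL3 x * Zsing (fun i => D i x) iL3
      + D iR1 x * Zsing (fun i => D i x) iR1 + D iR2 x * Zsing (fun i => D i x) iR2
      + D iR3 x * Zsing (fun i => D i x) iR3)
      + 2 * (D ixi x * E ixi + D iL1 x * E iL1 + D iL2 x * E iL2 + D iL3 x * E iL3
      + D iR1 x * E iR1 + D iR2 x * E iR2 + D iR3 x * E iR3)).
    { unfold m', F, E; cbn [Zsing]; unfold D; field; lra. }
    assert (H2 : 0 < 2 / x) by (apply Rdiv_lt_0_compat; lra).
    assert (H1 : m' x <= 14 * (n * w)).
    { pose proof (HE ixi); pose proof (HE iL1); pose proof (HE iL2); pose proof (HE iL3).
      pose proof (HE iR1); pose proof (HE iR2); pose proof (HE iR3).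
      rewrite HF; cbv beta in *; nra. }
    eapply Rle_trans; [exact H1|].
    unfold m; rewrite <- Hn, <- (pow2_abs dc).
    set (u := Rabs dc); assert (Hu : 0 <= u) by apply Rabs_pos.
    (* The odd power n^3 must be expressed by n^2, the only quantity occurring in [m]. *)
    assert (Hn3 : n * n * n <= n * n + n * n * (n * n)).
    { pose proof (Rmult_le_pos _ _ (Rle_0_sqr n) (Rle_0_sqr (n - 1))) as h; unfold Rsqr in h.
      pose proof (Rle_0_sqr n) as h'; pose proof (Rle_0_sqr (n * n)) as h''; unfold Rsqr in h', h''; lra. }
    assert (Hc3 : C * (n * n * n) <= C * (n * n + n * n * (n * n))) by (apply Rmult_le_compat_l; lra).
    assert (Hnu : n * u <= (n * n + u * u) / 2) by (pose proof (pow2_ge_0 (n - u)); lra).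
    unfold w; fold u.
    set (N := n * n) in *.
    set (d := u ^ 2); replace (u * u) with d in Hnu by (unfold d; ring).
    assert (HN : 0 <= N) by (unfold N; nra).
    assert (Hdd : 0 <= d) by (unfold d; nra).
    assert (HCM : 0 < C * (2 * M + 1)) by (apply Rmult_lt_0_compat; lra).
    apply Rle_trans with ((14 * (C * (2 * M + 1) + 1)) * (N + N * N) + 7 * (N + d)).
    { replace (n * (C * ((2 * M + n) * n) + n + u)) with (2 * (C * M) * N + C * (N * n) + N + n * u)
        by (unfold N; ring).
      assert (0 <= C * M * (N * N)) by (repeat apply Rmult_le_pos; lra).
      replace (14 * (C * (2 * M + 1) + 1) * (N + N * N)) with (28 * (C * M * N) + 28 * (C * M * (N * N))
        + 14 * (C * (N + N * N)) + 14 * N + 14 * (N * N)) by ring.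
      assert (0 <= N * N) by (apply Rmult_le_pos; lra); lra. }
    assert (HX : (N + d) * (1 + (N + d)) = N + d + N * N + 2 * (N * d) + d * d) by ring.
    assert (0 <= N * N) by (apply Rmult_le_pos; lra).
    assert (0 <= N * d) by (apply Rmult_le_pos; lra).
    assert (0 <= d * d) by (apply Rmult_le_pos; lra).
    assert (N + N * N <= (N + d) * (1 + (N + d))) by lra.
    assert (N + d <= (N + d) * (1 + (N + d))) by lra.
    set (X := (N + d) * (1 + (N + d))) in *.
    assert ((14 * (C * (2 * M + 1) + 1)) * (N + N * N) <= (14 * (C * (2 * M + 1) + 1)) * X)
      by (apply Rmult_le_compat_l; lra).
    unfold k; lra. }
  assert (Hlim : lim0 m m0).
  { destruct (sol_zc_lim _ _ _ _ _ Hb HU) as [u0 [u1 [u2 [u3 [u4 [u5 u6]]]]]].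
    destruct (sol_zc_lim _ _ _ _ _ Hb HV) as [v0 [v1 [v2 [v3 [v4 [v5 v6]]]]]].
    unfold m, zdist, nsq; eapply lim0_eq; [lim0s | unfold m0; ring]. }
  assert (Hm00 : 0 <= m0).
  { apply (lim0_le (fun r => - m r) (- m0) 0 b) in Hb; [lra | lim0s | intros x _; specialize (Hm0 x); lra]. }
  set (f := fun r => - (m r / (1 + m r)) * exp (- (k * r))).
  assert (Hfl : lim0 f (- (m0 / (1 + m0)) * 1)).
  { unfold f; apply lim0_mult.
    - apply lim0_opp, lim0_mult; [exact Hlim|].
      eapply (filterlim_comp _ _ _ (fun r => 1 + m r) Rinv _ (locally (1 + m0))).
      + apply lim0_plus; [apply lim0_const | exact Hlim].
      + apply (filterlim_Rbar_inv (1 + m0)); injection; lra.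
    - replace 1 with (exp (- (k * 0))) by (rewrite Rmult_0_r, Ropp_0; apply exp_0).
      apply (lim0_cont (fun r => exp (- (k * r)))).
      assert (is_derive (fun r => exp (- (k * r))) 0 (exp (- (k * 0)) * - k)) by (derive_as; ring).
      eapply is_derive_cont; eassumption. }
  assert (Hf : - (m0 / (1 + m0)) * 1 <= f r).
  { apply (incr_from0 f (fun x => (k * (m x * (1 + m x)) - m' x) / (1 + m x) ^ 2 * exp (- (k * x))) _ b);
      [easy | | | easy].
    - intros x Hx; specialize (Hm0 x).
      pose proof (ratio_derive m x (m' x) Hm0 (Hm' x Hx)) as Hrd.
      unfold f; eapply is_derive_cv.
      + apply dmult; [apply dopp, Hrd | der].
      + cbv beta; field; lra.
    - intros x Hx; specialize (Hm0 x); apply Rmult_le_pos; [|left; apply exp_pos].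
      apply Rdiv_le_0_compat; [specialize (Hle x Hx); lra | apply pow_lt; lra]. }
  unfold f in Hf.
  assert (He : exp (- (k * r)) * exp (k * r) = 1) by (rewrite <- exp_plus, Rplus_opp_l; apply exp_0).
  pose proof (exp_pos (k * r)) as Hep.
  assert (Hr1 : m0 / (1 + m0) <= m0).
  { apply Rle_div_l; [lra|]; nra. }
  assert (Hebr : exp (k * r) <= exp (k * b)).
  { destruct (Rle_lt_or_eq_dec (k * r) (k * b)) as [h|h]; [nra | left; now apply exp_increasing | rewrite h; lra]. }
  set (p := m r / (1 + m r)) in *.
  apply Rle_trans with (m0 * exp (k * r)); [|now apply Rmult_le_compat_l].
  replace p with (p * exp (- (k * r)) * exp (k * r)) by (rewrite Rmult_assoc, He; ring).
  apply Rmult_le_compat_r; lra.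
Qed.

Lemma zc_eq U V r : 0 < r -> (forall i, zc U i r = zc V i r) -> forall i, U i r = V i r.
Proof.
  intros Hr H.
  pose proof (H ixi) as h0; pose proof (H iL1) as h1; pose proof (H iL2) as h2; pose proof (H iL3) as h3.
  pose proof (H iR1) as h4; pose proof (H iR2) as h5; pose proof (H iR3) as h6; cbn [zc] in *.
  assert (U iR1 r = V iR1 r) by (apply (Rmult_eq_reg_r (/ r)); [easy | apply Rinv_neq_0_compat; lra]).
  intros i; destruct i; lra.
Qed.

Lemma sol_unique al be ga b U V : 0 < b -> sol al be ga b U -> sol al be ga b V ->
  forall i r, 0 < r <= b -> U i r = V i r.
Proof.
  intros Hb HU HV i r Hr.
  destruct (singular_estimate _ _ _ _ _ Hb HU) as [K [HK H]].
  specialize (H _ _ _ _ HV r Hr); cbv zeta in H.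
  rewrite !Rminus_diag in H.
  replace ((0 ^ 2 + 16 * 0 ^ 2 + 0 ^ 2) * exp K) with 0 in H by ring.
  replace (zdist U V r + 0 ^ 2) with (zdist U V r) in H by ring.
  pose proof (nsq_nonneg (fun i => zc V i r - zc U i r)) as Hn; fold (zdist U V r) in Hn.
  assert (Hz : zdist U V r <= 0) by (apply Rle_div_l in H; lra).
  apply zc_eq; [easy|]; intros j.
  pose proof (abs_le_nsq (fun i => zc V i r - zc U i r) j) as Hj; fold (zdist U V r) in Hj.
  replace (zdist U V r) with 0 in Hj by lra; rewrite sqrt_0 in Hj.
  apply Rabs_le_between in Hj; lra.
Qed.

(** xi is the sum of three of the coordinates, and R1 is r times one of them; whence the factor 3 +
    b. *)
Lemma zdist_close b U V r n : 0 < r <= b -> zdist U V r <= n ^ 2 -> 0 <= n ->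
  forall i, Rabs (V i r - U i r) <= (3 + b) * n.
Proof.
  intros Hr H Hn.
  assert (Hz : forall i, - n <= zc V i r - zc U i r <= n).
  { intros i; apply Rabs_le_between.
    eapply Rle_trans; [apply (abs_le_nsq (fun i => zc V i r - zc U i r))|].
    rewrite <- (sqrt_pow2 n Hn); now apply sqrt_le_1_alt. }
  pose proof (Hz ixi) as h0; pose proof (Hz iL1) as h1; pose proof (Hz iL2) as h2.
  pose proof (Hz iL3) as h3; pose proof (Hz iR2) as h5; pose proof (Hz iR3) as h6.
  pose proof (scale_between r b n _ ltac:(lra) (Hz iR1)) as h4; cbn [zc] in *.
  replace (r * (V iR1 r / r - U iR1 r / r)) with (V iR1 r - U iR1 r) in h4 by (field; lra).
  assert (0 <= b * n) by nra.
  intros i; apply Rabs_le; destruct i; lra.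
Qed.

Lemma sol_close al be ga b U e : 0 < b -> 0 < e -> sol al be ga b U ->
  exists d, 0 < d /\ forall al' be' ga' V,
    Rabs (al' - al) <= d -> Rabs (be' - be) <= d -> Rabs (ga' - ga) <= d ->
    sol al' be' ga' b V -> forall r i, 0 < r <= b -> Rabs (V i r - U i r) <= e.
Proof.
  intros Hb He HU; destruct (singular_estimate _ _ _ _ _ Hb HU) as [K [HK H]].
  set (n := e / (3 + b)).
  assert (Hn : 0 < n) by (apply Rdiv_lt_0_compat; lra).
  assert (Hn2 : 0 < n ^ 2) by (apply pow_lt; easy).
  set (q := n ^ 2 / (1 + n ^ 2)).
  assert (Hq : 0 < q) by (apply Rdiv_lt_0_compat; lra).
  pose proof (exp_pos K) as HeK.
  (* 21 = 1 + 16 + 4 adds up the weights of the parameter differences in [be], [ga] and [al], whose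
     squares are at most d because d <= 1. *)
  set (d := Rmin 1 (q / (21 * exp K))).
  assert (Hd : 0 < d) by (apply Rmin_pos; [lra | apply Rdiv_lt_0_compat; lra]).
  exists d; split; [easy|]; intros al' be' ga' V Ha Hbe Hg HV r i Hr.
  replace e with ((3 + b) * n) by (unfold n; field; lra).
  apply zdist_close; [easy | | lra].
  specialize (H _ _ _ _ HV r Hr); cbv zeta in H.
  assert (Hd1 : d <= 1) by apply Rmin_l.
  assert (Hd2 : 21 * d * exp K <= q).
  { apply Rle_trans with (21 * (q / (21 * exp K)) * exp K); [|right; field; lra].
    apply Rmult_le_compat_r; [lra|]; apply Rmult_le_compat_l; [lra | apply Rmin_r]. }
  assert (Hsq : forall x, Rabs x <= d -> x ^ 2 <= d).
  { intros x Hx; rewrite <- (pow2_abs x); pose proof (Rabs_pos x); nra. }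
  apply Hsq in Ha; apply Hsq in Hbe; apply Hsq in Hg.
  set (m := zdist U V r) in *; set (dc := (2 * al' - 2 * al) ^ 2) in *.
  assert (Hdc : dc = 4 * (al' - al) ^ 2) by (unfold dc; ring).
  assert (Hm0 : 0 <= m) by apply nsq_nonneg.
  assert (Hdc0 : 0 <= dc) by apply pow2_ge_0.
  assert (Hmq : (m + dc) / (1 + (m + dc)) <= q).
  { eapply Rle_trans; [exact H|]; eapply Rle_trans; [|exact Hd2].
    apply Rmult_le_compat_r; lra. }
  assert (Hmq' : m + dc <= q * (1 + (m + dc))) by (apply Rle_div_l; [lra | easy]).
  assert (Hqn : q * (1 + n ^ 2) = n ^ 2) by (unfold q; field; lra).
  assert (Hq1 : q < 1).
  { apply (Rmult_lt_reg_r (1 + n ^ 2)); lra. }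
  assert (0 <= dc * (1 - q)) by (apply Rmult_le_pos; lra).
  apply (Rmult_le_reg_r (1 - q)); lra.
Qed.

(** Nearby parameters come with a solution up to [T] only. At [T] it is close to [U] by the singular
    estimate, and from there the clipped flow keeps it within 1 of [U] up to [b], hence unclipped; a
    second use of the singular estimate gives the final closeness. *)
Lemma sol_perturb al be ga T b U e : 0 < T <= b -> 0 < e -> sol al be ga b U ->
  exists d, 0 < d /\ forall al' be' ga' W,
    Rabs (al' - al) <= d -> Rabs (be' - be) <= d -> Rabs (ga' - ga) <= d ->
    sol al' be' ga' T W ->
    exists V, sol al' be' ga' b V /\ forall r i, 0 < r <= b -> Rabs (V i r - U i r) <= e.
Proof.
  intros HT He HU.
  assert (HB : forall i, exists M, forall r, T <= r <= b -> Rabs (U i r) <= M).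
  { intros i; apply bounded_on; [lra|]; intros; apply ode_cont, HU; lra. }
  destruct (HB ixi) as [M0 B0], (HB iL1) as [M1 B1], (HB iL2) as [M2 B2], (HB iL3) as [M3 B3],
    (HB iR1) as [M4 B4], (HB iR2) as [M5 B5], (HB iR3) as [M6 B6].
  destruct (ix_max (fun i => match i with ixi => M0 | iL1 => M1 | iL2 => M2 | iL3 => M3
    | iR1 => M4 | iR2 => M5 | iR3 => M6 end)) as [M [HM HM']].
  assert (HUM : forall i r, T <= r <= b -> Rabs (U i r) <= M).
  { intros i r Hr; eapply Rle_trans; [|apply (HM' i)]; destruct i; auto. }
  set (X := exp (112 * (M + 1) * (b - T))).
  assert (HX : 1 <= X).
  { unfold X; rewrite <- exp_0 at 1; destruct (Req_dec b T) as [->|].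
    - rewrite Rminus_diag, Rmult_0_r; lra.
    - left; apply exp_increasing; repeat apply Rmult_lt_0_compat; lra. }
  (* Then 7 * e1^2 * X = e1 <= 1, which bounds the squared distance on [T, b]. *)
  set (e1 := / (7 * X)).
  assert (He1 : 0 < e1 <= 1).
  { split; [apply Rinv_0_lt_compat; lra|]; rewrite <- Rinv_1; apply Rinv_le_contravar; lra. }
  destruct (sol_close al be ga T U e1) as [d1 [Hd1 H1]]; [lra | lra | |].
  { apply sol_restrict with b; [lra | easy]. }
  destruct (sol_close al be ga b U e) as [d2 [Hd2 H2]]; [lra | lra | easy |].
  exists (Rmin d1 d2); split; [now apply Rmin_pos|].
  pose proof (Rmin_l d1 d2); pose proof (Rmin_r d1 d2).
  intros al' be' ga' W Ha Hbe Hg HW.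
  destruct (clipped_solution (M + 1) T (fun i => W i T)) as [V [V0 HV]]; [lra|].
  assert (HVM : forall i t, T <= t <= b -> Rabs (V i t) <= M + 1).
  { intros i t Ht.
    assert (HN : nsq (fun i => U i t - V i t) <= 1).
    { eapply Rle_trans.
      - apply (clipped_close (M + 1) T t); [lra | lra | | intros; apply HV; lra].
        intros j s Hs; rewrite Gc_id; [apply HU; lra|].
        intros k; specialize (HUM k s ltac:(lra)); lra.
      - apply Rle_trans with (7 * e1 ^ 2 * X).
        + apply Rmult_le_compat; [apply nsq_nonneg | left; apply exp_pos | |].
          * apply (nsq_le (fun i => U i T - V i T)); intros j; rewrite V0, Rabs_minus_sym.
            apply (H1 al' be' ga'); try lra; easy.
          * unfold X; destruct (Req_dec t b) as [->|]; [lra|].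
            left; apply exp_increasing, Rmult_lt_compat_l; lra.
        + assert (HX1 : 7 * X * e1 = 1) by (unfold e1; field; lra).
          replace (7 * e1 ^ 2 * X) with (7 * X * e1 * e1) by ring; rewrite HX1; lra. }
    pose proof (abs_le_nsq (fun i => U i t - V i t) i) as h.
    apply sqrt_le_1_alt in HN; rewrite sqrt_1 in HN.
    specialize (HUM i t Ht); apply Rabs_le_between in HUM.
    cbv beta in h; assert (h' : Rabs (U i t - V i t) <= 1) by lra.
    apply Rabs_le_between in h'; apply Rabs_le; lra. }
  assert (HS : sol al' be' ga' b (fun i => glue T (W i) (V i))) by (apply (glue_sol _ _ _ _ (M + 1)); auto).
  exists (fun i => glue T (W i) (V i)); split; [easy|].
  intros r i Hr; apply (H2 al' be' ga' _) with (4 := HS); lra.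
Qed.

(** * Trapped solutions *)

(** Each function supports the other: nonnegativity of both on the past implies the two Gronwall
    inequalities, which keep both positive. Since the inequalities are required only under
    nonnegativity on the whole of [a, r], the signs of the coupling coefficients may be derived from
    the past. *)
Lemma coop2 (f1 f2 f1' f2' c1 c2 : R -> R) a b :
  (forall r, a <= r <= b -> is_derive f1 r (f1' r)) ->
  (forall r, a <= r <= b -> is_derive f2 r (f2' r)) ->
  (forall r, a <= r <= b -> continuous c1 r) -> (forall r, a <= r <= b -> continuous c2 r) ->
  (forall r, a <= r <= b -> (forall x, a <= x <= r -> 0 <= f1 x /\ 0 <= f2 x) ->
    c1 r * f1 r <= f1' r /\ c2 r * f2 r <= f2' r) ->
  0 < f1 a -> 0 < f2 a -> forall r, a <= r <= b -> 0 < f1 r /\ 0 < f2 r.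
Proof.
  intros D1 D2 C1 C2 H P1 P2.
  assert (K1 : forall r, a <= r <= b -> continuous f1 r) by (intros; eapply is_derive_cont, D1; lra).
  assert (K2 : forall r, a <= r <= b -> continuous f2 r) by (intros; eapply is_derive_cont, D2; lra).
  apply real_ind_from; [easy | |].
  - intros r Hr Hlt.
    assert (Hle : forall x, a <= x <= r -> 0 <= f1 x /\ 0 <= f2 x).
    { intros x Hx; destruct (Req_dec x r) as [->|]; [|destruct (Hlt x); lra]; split.
      - assert (- f1 r <= 0); [|lra]; apply (cont_le_left (fun x => - f1 x) a r); [lra | |].
        + apply (continuous_opp f1), K1; lra.
        + intros y Hy; destruct (Hlt y); lra.
      - assert (- f2 r <= 0); [|lra]; apply (cont_le_left (fun x => - f2 x) a r); [lra | |].
        + apply (continuous_opp f2), K2; lra.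
        + intros y Hy; destruct (Hlt y); lra. }
    split.
    + apply (gron_pos f1 f1' c1 a r); try easy; intros x Hx; [apply D1 | apply C1 | apply H]; try lra.
      intros; apply Hle; lra.
    + apply (gron_pos f2 f2' c2 a r); try easy; intros x Hx; [apply D2 | apply C2 | apply H]; try lra.
      intros; apply Hle; lra.
  - intros r Hr Hle; destruct (Hle r) as [Q1 Q2]; [lra|].
    destruct (pos_near f1 r) as [d1 [Hd1 E1]]; [apply K1; lra | easy |].
    destruct (pos_near f2 r) as [d2 [Hd2 E2]]; [apply K2; lra | easy |].
    exists (Rmin d1 d2); split; [now apply Rmin_pos|]; intros x Hx _.
    pose proof (Rmin_l d1 d2); pose proof (Rmin_r d1 d2).
    split; [apply E1 | apply E2]; rewrite Rabs_right; lra.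
Qed.

Lemma pos_from0 (f f' c : R -> R) b :
  (exists d, 0 < d /\ forall r, 0 < r < d -> 0 < f r) ->
  (forall r, 0 < r <= b -> is_derive f r (f' r)) ->
  (forall r, 0 < r <= b -> continuous c r) ->
  (forall r, 0 < r <= b -> c r * f r <= f' r) -> forall r, 0 < r <= b -> 0 < f r.
Proof.
  intros [d [Hd H0]] Hf Hc H r Hr; destruct (Rlt_le_dec r d) as [h|h]; [apply H0; lra|].
  apply (gron_pos f f' c (d / 2) r); [lra | | | | apply H0; lra]; intros; [apply Hf | apply Hc | apply H]; lra.
Qed.

Lemma strict_incr_on (f f' : R -> R) a b :
  a < b -> (forall x, a <= x <= b -> is_derive f x (f' x)) ->
  (forall x, a <= x <= b -> 0 < f' x) -> f a < f b.
Proof.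
  intros Hab Hd Hp.
  destruct (MVT_gen f a b f') as [c [Hc E]].
  - intros x; rewrite Rmin_left, Rmax_right by lra; intros; apply Hd; lra.
  - intros x; rewrite Rmin_left, Rmax_right by lra; intros.
    apply continuity_pt_filterlim, (is_derive_cont _ _ (f' x)), Hd; lra.
  - rewrite Rmin_left, Rmax_right in Hc by lra.
    specialize (Hp c Hc); nra.
Qed.

Lemma decr_right (f : R -> R) x l d :
  is_derive f x l -> l < 0 -> 0 < d -> exists y, x < y < x + d /\ f y < f x.
Proof.
  intros H Hl Hd; apply is_derive_Reals in H.
  destruct (H (- l)) as [e He]; [lra|].
  assert (Hm : 0 < Rmin (e / 2) (d / 2)) by (apply Rmin_pos; [pose proof (cond_pos e)|]; lra).
  pose proof (Rmin_l (e / 2) (d / 2)); pose proof (Rmin_r (e / 2) (d / 2)).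
  set (h := Rmin (e / 2) (d / 2)) in *.
  exists (x + h); split; [lra|].
  assert (Hh : Rabs ((f (x + h) - f x) / h - l) < - l).
  { apply He; [lra|]; rewrite Rabs_right; lra. }
  apply Rabs_def2 in Hh.
  assert ((f (x + h) - f x) / h * h < 0) by nra.
  replace ((f (x + h) - f x) / h * h) with (f (x + h) - f x) in H2 by (field; lra); lra.
Qed.

(** * Symmetry, positivity and ordering *)

Definition swap23 (U : ix -> R -> R) (i : ix) : R -> R :=
  match i with
  | iL2 => U iL3 | iL3 => U iL2 | iR2 => U iR3 | iR3 => U iR2 | _ => U i
  end.

Lemma swap23_sol al be ga b U : sol al be ga b U -> sol al be (- ga) b (swap23 U).
Proof.
  intros [H1 [H2 [A [B [C [D [F [K L]]]]]]]]; split; [|split].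
  - intros r Hr; specialize (H1 r Hr); getode H1.
    intros i; destruct i; cbn [swap23 G]; eapply is_derive_cv; try eassumption; try field.
  - intros r Hr; rewrite <- (H2 r Hr); unfold energy; cbn [swap23]; field.
  - unfold sing_lims; cbn [swap23]; rewrite Ropp_involutive; repeat split; easy.
Qed.

Section Sol.
Variables (al be ga b : R) (U : ix -> R -> R).
Hypothesis b_pos : 0 < b.
Hypothesis be_pos : 0 < be.
Hypothesis ga_nonneg : 0 <= ga.
Hypothesis HU : sol al be ga b U.

Let HO : forall r, 0 < r <= b -> ode U r := proj1 HU.

Lemma R1_pos r : 0 < r <= b -> 0 < U iR1 r.
Proof.
  apply (pos_from0 (U iR1) (fun r => U iR1 r * (U iL1 r - U iL2 r - U iL3 r))
    (fun r => U iL1 r - U iL2 r - U iL3 r)).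
  - destruct (proj2 (proj2 HU)) as [_ [_ [_ [_ [L _]]]]].
    destruct (lim0_pos _ _ L be_pos) as [d [Hd H]].
    exists d; split; [easy|]; intros x Hx; specialize (H x Hx).
    apply (Rmult_lt_compat_r x) in H; [|lra].
    replace (U iR1 x / x * x) with (U iR1 x) in H by (field; lra); lra.
  - intros; now apply HO.
  - intros; contr ltac:(apply ode_cont, HO; lra).
  - intros; right; ring.
Qed.

Lemma large_near0 (f : R -> R) l :
  lim0 (fun r => f r - 1 / (2 * r)) l -> exists d, 0 < d /\ forall r, 0 < r < d -> 0 < f r.
Proof.
  intros L; apply lim0_eps with (e := 1) in L; [|lra]; destruct L as [d [Hd H]].
  assert (Hk : 0 < / (2 * (Rabs l + 1))) by (apply Rinv_0_lt_compat; pose proof (Rabs_pos l); lra).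
  exists (Rmin d (/ (2 * (Rabs l + 1)))); split; [now apply Rmin_pos|]; intros r [Hr1 Hr2].
  pose proof (Rmin_l d (/ (2 * (Rabs l + 1)))); pose proof (Rmin_r d (/ (2 * (Rabs l + 1)))).
  assert (h : Rabs (f r - 1 / (2 * r) - l) < 1) by (apply H; lra); apply Rabs_def2 in h.
  assert (Rabs l + 1 < 1 / (2 * r)).
  { apply Rlt_div_r; [lra|].
    assert (r < / (2 * (Rabs l + 1))) by lra.
    apply (Rmult_lt_compat_r (2 * (Rabs l + 1))) in H2; [|pose proof (Rabs_pos l); lra].
    rewrite Rinv_l in H2; [lra | pose proof (Rabs_pos l); lra]. }
  pose proof (Rle_abs (- l)); rewrite Rabs_Ropp in H3; lra.
Qed.

Lemma R2_pos r : 0 < r <= b -> 0 < U iR2 r.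
Proof.
  apply (pos_from0 (U iR2) (fun r => U iR2 r * (U iL2 r - U iL3 r - U iL1 r))
    (fun r => U iL2 r - U iL3 r - U iL1 r)).
  - apply (large_near0 _ ga), HU.
  - intros; now apply HO.
  - intros; contr ltac:(apply ode_cont, HO; lra).
  - intros; right; ring.
Qed.

Lemma R3_pos r : 0 < r <= b -> 0 < U iR3 r.
Proof.
  apply (pos_from0 (U iR3) (fun r => U iR3 r * (U iL3 r - U iL1 r - U iL2 r))
    (fun r => U iL3 r - U iL1 r - U iL2 r)).
  - apply (large_near0 _ (- ga)), HU.
  - intros; now apply HO.
  - intros; contr ltac:(apply ode_cont, HO; lra).
  - intros; right; ring.
Qed.

(** For [ga > 0] the differences R2 - R3 and L2 - L3 start near 2 ga and satisfy a cooperative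
    system, where [R1 <= R2] makes the coefficient R2 + R3 - R1 nonnegative. For [ga = 0] uniqueness
    and the symmetry [swap23] give equalities. *)
Lemma order23 :
  (forall r, 0 < r <= b -> U iR1 r <= U iR2 r) ->
  forall r, 0 < r <= b -> U iR3 r <= U iR2 r /\ U iL3 r <= U iL2 r.
Proof.
  intros H12 r Hr; destruct ga_nonneg as [Hg|Hg].
  - destruct (proj2 (proj2 HU)) as [_ [_ [L2 [L3 [_ [L5 L6]]]]]].
    assert (P1 : exists d, 0 < d /\ forall r, 0 < r < d -> 0 < U iR2 r - U iR3 r).
    { apply (lim0_pos _ (2 * ga)); [|lra].
      apply (lim0_ext (fun r => (U iR2 r - 1 / (2 * r)) - (U iR3 r - 1 / (2 * r))) _ b);
        [easy | intros; ring |].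
      eapply lim0_eq; [exact (lim0_minus _ _ _ _ L5 L6) | ring]. }
    assert (P2 : exists d, 0 < d /\ forall r, 0 < r < d -> 0 < U iL2 r - U iL3 r).
    { apply (lim0_pos _ (2 * ga)); [|lra]; eapply lim0_eq; [exact (lim0_minus _ _ _ _ L2 L3) | ring]. }
    destruct P1 as [d1 [Hd1 P1]], P2 as [d2 [Hd2 P2]].
    set (a := Rmin r (Rmin (d1 / 2) (d2 / 2))).
    assert (Ha : 0 < a <= r /\ a < d1 /\ a < d2).
    { assert (0 < a) by (repeat apply Rmin_pos; lra).
      pose proof (Rmin_l r (Rmin (d1 / 2) (d2 / 2))); pose proof (Rmin_r r (Rmin (d1 / 2) (d2 / 2))).
      pose proof (Rmin_l (d1 / 2) (d2 / 2)); pose proof (Rmin_r (d1 / 2) (d2 / 2)); fold a in H0, H1; lra. }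
    destruct (coop2 (fun r => U iR2 r - U iR3 r) (fun r => U iL2 r - U iL3 r)
      (fun r => - U iL1 r * (U iR2 r - U iR3 r) + (U iL2 r - U iL3 r) * (U iR2 r + U iR3 r))
      (fun r => - U ixi r * (U iL2 r - U iL3 r) + (U iR2 r - U iR3 r) * (U iR2 r + U iR3 r - U iR1 r))
      (fun r => - U iL1 r) (fun r => - U ixi r) a b) with (r := r); try lra.
    + intros x Hx; getode (HO x ltac:(lra)); derive_as; ring.
    + intros x Hx; getode (HO x ltac:(lra)); derive_as; field.
    + intros x Hx; contr ltac:(apply ode_cont, HO; lra).
    + intros x Hx; contr ltac:(apply ode_cont, HO; lra).
    + intros x Hx Hp; destruct (Hp x) as [Q1 Q2]; [lra|].
      assert (Hx' : 0 < x <= b) by lra.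
      pose proof (R2_pos x Hx'); pose proof (R3_pos x Hx'); pose proof (H12 x Hx').
      assert (0 <= (U iL2 x - U iL3 x) * (U iR2 x + U iR3 x)) by (apply Rmult_le_pos; lra).
      assert (0 <= (U iR2 x - U iR3 x) * (U iR2 x + U iR3 x - U iR1 x)) by (apply Rmult_le_pos; lra).
      lra.
    + apply P1; lra.
    + apply P2; lra.
  - assert (HS := swap23_sol _ _ _ _ _ HU); rewrite <- Hg, Ropp_0 in HS.
    assert (HU' := HU); rewrite <- Hg in HU'.
    pose proof (sol_unique _ _ _ _ _ _ b_pos HU' HS iR2 r Hr) as E2.
    pose proof (sol_unique _ _ _ _ _ _ b_pos HU' HS iL2 r Hr) as E3.
    cbn [swap23] in *; lra.
Qed.

End Sol.

(** The coupling coefficient R1 + R2 - R3 is nonnegative because [R3 <= R2], which [order23] derives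
    from [R1 <= R2] on the past. Thus, once L1 < L2 occurs below R2, R1 can never reach R2
    afterwards. *)
Lemma absorbing al be ga b U r1 :
  0 < be -> 0 <= ga -> sol al be ga b U -> 0 < r1 <= b ->
  (forall r, 0 < r <= r1 -> U iR1 r < U iR2 r) -> U iL1 r1 < U iL2 r1 ->
  forall r, r1 <= r <= b -> U iR1 r < U iR2 r /\ U iL1 r < U iL2 r.
Proof.
  intros Hbe Hga HU Hr1 H12 HD r Hr.
  assert (HO := proj1 HU).
  destruct (coop2 (fun r => U iR2 r - U iR1 r) (fun r => U iL2 r - U iL1 r)
    (fun r => - U iL3 r * (U iR2 r - U iR1 r) + (U iL2 r - U iL1 r) * (U iR2 r + U iR1 r))
    (fun r => - U ixi r * (U iL2 r - U iL1 r) + (U iR2 r - U iR1 r) * (U iR2 r + U iR1 r - U iR3 r))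
    (fun r => - U iL3 r) (fun r => - U ixi r) r1 b) with (r := r); try lra.
  - intros x Hx; getode (HO x ltac:(lra)); derive_as; ring.
  - intros x Hx; getode (HO x ltac:(lra)); derive_as; field.
  - intros x Hx; contr ltac:(apply ode_cont, HO; lra).
  - intros x Hx; contr ltac:(apply ode_cont, HO; lra).
  - intros x Hx Hp; destruct (Hp x) as [Q1 Q2]; [lra|].
    assert (HUx : sol al be ga x U) by (apply sol_restrict with b; [lra | easy]).
    destruct (order23 al be ga x U ltac:(lra) Hga HUx) with (r := x) as [O1 O2]; [|lra|].
    { intros y Hy; destruct (Rle_lt_dec y r1); [left; apply H12; lra|].
      destruct (Hp y); lra. }
    assert (Hx' : 0 < x <= b) by lra.
    assert (Hb : 0 < b) by lra.
    pose proof (R1_pos al be ga b U Hbe HU x Hx').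
    pose proof (R2_pos al be ga b U HU x Hx').
    assert (0 <= (U iL2 x - U iL1 x) * (U iR2 x + U iR1 x)) by (apply Rmult_le_pos; lra).
    assert (0 <= (U iR2 x - U iR1 x) * (U iR2 x + U iR1 x - U iR3 x)) by (apply Rmult_le_pos; lra).
    lra.
  - specialize (H12 r1); lra.
Qed.

(** The interval is open at [b] because a contact of [R1] and [R2] is excluded by looking slightly
    to its right. *)
Definition trapped (b : R) (U : ix -> R -> R) :=
  forall r, 0 < r < b -> U iR1 r < U iR2 r /\ U iL2 r <= U iL1 r.

Lemma lim0_exp f l : lim0 f l -> lim0 (fun r => exp (f r)) (exp l).
Proof.
  intros H; apply (filterlim_comp _ _ _ f exp _ (locally l)); [exact H|].
  eapply is_derive_cont, is_derive_exp.
Qed.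

(* [P] is the density of the weighted volume, [P' = xi P], normalized by [P ~ r] at the singular orbit. *)
Definition density (b : R) (U : ix -> R -> R) (P : R -> R) :=
  (forall r, 0 < r <= b -> is_derive P r (U ixi r * P r) /\ 0 < P r) /\ lim0 (fun r => P r / r) 1.

Lemma density_exists al be ga b U : 0 < b -> sol al be ga b U -> exists P, density b U P.
Proof.
  intros Hb HU.
  (* The pole 1 / r of xi integrates to ln r, which becomes the factor r of the density; only the
     regular remainder is integrated from 0. *)
  destruct (primitive_from0 (fun r => U ixi r - 1 / r) b Hb) as [F [HF HF0]].
  - intros x Hx; apply cminus; [apply ode_cont, HU; lra|].
    assert (is_derive (fun r => 1 / r) x (- 1 / x ^ 2)) by (derive_as; [lra | field; lra]).
    eapply is_derive_cont; eassumption.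
  - apply HU.
  - exists (fun r => r * exp (F r)); split.
    + intros r Hr; split; [|apply Rmult_lt_0_compat; [lra | apply exp_pos]].
      specialize (HF r Hr); derive_as; field; lra.
    + apply (lim0_ext (fun r => exp (F r)) _ b); [easy | intros; field; lra |].
      rewrite <- exp_0; now apply lim0_exp.
Qed.

Lemma density_lim b U P : 0 < b -> density b U P -> lim0 P 0.
Proof.
  intros Hb [_ H]; apply (lim0_ext (fun r => P r / r * r) _ b); [easy | intros; field; lra |].
  eapply lim0_eq; [exact (lim0_mult _ _ _ _ H lim0_id) | ring].
Qed.

(** With (x, y, z) = (R1, R2, R3), the source S of the trace of the [L_i] alone may be negative, for
    instance when z = 0. The added term is the source of - (L1 - L2) / 2 and makes up for it. *)
Lemma scalar_curvature_ineq x y z : 0 <= x <= y -> 0 <= z <= y ->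
  0 <= x * y + y * z + z * x - (x ^ 2 + y ^ 2 + z ^ 2) / 2 + (y - x) * (x + y - z) / 2.
Proof.
  intros Hx Hz.
  replace (x * y + y * z + z * x - (x ^ 2 + y ^ 2 + z ^ 2) / 2 + (y - x) * (x + y - z) / 2)
    with (x * (y - x) + z * (y - z + 3 * x) / 2) by field.
  assert (0 <= x * (y - x)) by (apply Rmult_le_pos; lra).
  assert (0 <= z * (y - z + 3 * x)) by (apply Rmult_le_pos; lra); lra.
Qed.

Lemma ratio_incr (f g u v : R -> R) a b :
  a <= b -> (forall x, a <= x <= b -> is_derive f x (f x * u x)) ->
  (forall x, a <= x <= b -> is_derive g x (g x * v x)) ->
  (forall x, a <= x <= b -> 0 < f x /\ 0 < g x /\ v x <= u x) ->
  f a / g a <= f b / g b /\ g b / f b <= g a / f a.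
Proof.
  intros Hab Hf Hg H.
  assert (Hle : f a / g a <= f b / g b).
  { apply (incr_on (fun x => f x / g x) (fun x => (u x - v x) * (f x / g x))); [easy | |].
    - intros x Hx; destruct (H x Hx) as [_ [h _]].
      specialize (Hf x Hx); specialize (Hg x Hx); derive_as; [lra | field; lra].
    - intros x Hx; destruct (H x Hx) as [h1 [h2 h3]].
      apply Rmult_le_pos; [lra | apply Rdiv_le_0_compat; lra]. }
  split; [easy|].
  destruct (H a ltac:(lra)) as [h1 [h2 _]], (H b ltac:(lra)) as [h3 [h4 _]].
  replace (g b / f b) with (/ (f b / g b)) by (field; lra).
  replace (g a / f a) with (/ (f a / g a)) by (field; lra).
  apply Rinv_le_contravar; [apply Rdiv_lt_0_compat; lra | easy].
Qed.

Section Trapped.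
Variables (al be ga b : R) (U : ix -> R -> R).
Hypothesis be_pos : 0 < be.
Hypothesis ga_nonneg : 0 <= ga.
Hypothesis HU : sol al be ga b U.
Hypothesis Htr : trapped b U.

Let HO : forall r, 0 < r <= b -> ode U r := proj1 HU.

Lemma trapped_order r : 0 < r < b ->
  0 < U iR1 r < U iR2 r /\ 0 < U iR3 r <= U iR2 r /\ U iL3 r <= U iL2 r <= U iL1 r.
Proof.
  intros Hr.
  assert (HUr : sol al be ga r U) by (apply sol_restrict with b; [lra | easy]).
  destruct (order23 al be ga r U ltac:(lra) ga_nonneg HUr) with (r := r) as [O1 O2]; [|lra|].
  { intros x Hx; left; apply Htr; lra. }
  pose proof (R1_pos al be ga r U be_pos HUr r ltac:(lra)).
  pose proof (R3_pos al be ga r U HUr r ltac:(lra)).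
  destruct (Htr r Hr); lra.
Qed.

Variable P : R -> R.
Hypothesis HP : density b U P.

(** Variation of constants: (f P)' = s P. The limit [l] at the singular orbit replaces an initial
    value. *)
Lemma weighted_incr (f s : R -> R) l a :
  0 < a < b -> lim0 (fun r => f r * P r) l ->
  (forall r, 0 < r <= a -> is_derive f r (- U ixi r * f r + s r)) ->
  (forall r, 0 < r <= a -> 0 <= s r) -> l <= f a * P a.
Proof.
  intros Ha Hl Hf Hs.
  apply (incr_from0 (fun r => f r * P r) (fun r => s r * P r) l a Hl); [| | lra].
  - intros x Hx; destruct (proj1 HP x) as [Hd _]; [lra|].
    specialize (Hf x Hx); derive_as; ring.
  - intros x Hx; destruct (proj1 HP x) as [_ Hp]; [lra|].
    apply Rmult_le_pos; [now apply Hs | lra].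
Qed.

Lemma trapped_L2 r : 0 < r < b -> 0 <= U iL2 r.
Proof.
  intros Hr; destruct (proj1 HP r) as [_ Hp]; [lra|].
  assert (0 <= U iL2 r * P r); [|nra].
  apply (weighted_incr (U iL2) (fun r => U iR2 r ^ 2 / 2 - (U iR3 r - U iR1 r) ^ 2 / 2)); [easy | | |].
  - eapply lim0_eq; [apply lim0_mult; [apply HU | apply (density_lim b U P); [lra | easy]] | ring].
  - intros x Hx; eapply is_derive_cv; [apply (HO x); lra | cbn [G]; field].
  - intros x Hx; destruct (trapped_order x ltac:(lra)) as [A [B C]].
    replace (U iR2 x ^ 2 / 2 - (U iR3 x - U iR1 x) ^ 2 / 2) with
      ((U iR2 x - U iR3 x + U iR1 x) * (U iR2 x - U iR1 x + U iR3 x) / 2) by field.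
    assert (0 <= (U iR2 x - U iR3 x + U iR1 x) * (U iR2 x - U iR1 x + U iR3 x))
      by (apply Rmult_le_pos; lra); lra.
Qed.

Lemma lim0_pole f l : lim0 (fun r => f r - 1 / r) l -> 0 < b -> lim0 (fun r => f r * P r) 1.
Proof.
  intros H Hb; apply (lim0_ext (fun r => (f r - 1 / r) * P r + P r / r) _ b); [easy | intros; field; lra |].
  pose proof (density_lim b U P Hb HP) as H0.
  eapply lim0_eq; [exact (lim0_plus _ _ _ _ (lim0_mult _ _ _ _ H H0) (proj2 HP)) | ring].
Qed.

Lemma lim0_P0 f l : lim0 f l -> 0 < b -> lim0 (fun r => f r * P r) 0.
Proof.
  intros H Hb; eapply lim0_eq; [exact (lim0_mult _ _ _ _ H (density_lim b U P Hb HP)) | ring].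
Qed.

Lemma trapped_trace r : 0 < r < b -> 0 < U iL1 r + U iL2 r + U iL3 r.
Proof.
  intros Hr; destruct (proj1 HP r) as [_ Hp]; [lra|].
  destruct (trapped_order r Hr) as [_ [_ HD]].
  destruct (proj2 (proj2 HU)) as [_ [l1 [l2 [l3 _]]]].
  (* Only [L1] has a pole at 0, and it enters with the coefficient 1 - 1/2, so the weighted quantity
     starts at 1/2. *)
  assert (1 / 2 <= (U iL1 r + U iL2 r + U iL3 r - (U iL1 r - U iL2 r) / 2) * P r); [|nra].
  apply (weighted_incr (fun r => U iL1 r + U iL2 r + U iL3 r - (U iL1 r - U iL2 r) / 2)
    (fun r => U iR1 r * U iR2 r + U iR2 r * U iR3 r + U iR3 r * U iR1 r
      - (U iR1 r ^ 2 + U iR2 r ^ 2 + U iR3 r ^ 2) / 2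
      + (U iR2 r - U iR1 r) * (U iR1 r + U iR2 r - U iR3 r) / 2)); [easy | | |].
  - apply lim0_pole in l1; [|lra]; apply lim0_P0 in l2; [|lra]; apply lim0_P0 in l3; [|lra].
    apply (lim0_ext (fun r => / 2 * (U iL1 r * P r) + 3 / 2 * (U iL2 r * P r) + U iL3 r * P r) _ b);
      [lra | intros; field |].
    eapply lim0_eq; [exact (lim0_plus _ _ _ _ (lim0_plus _ _ _ _ (lim0_mult _ _ _ _ (lim0_const (/ 2)) l1)
      (lim0_mult _ _ _ _ (lim0_const (3 / 2)) l2)) l3) | field].
  - intros x Hx; getode (HO x ltac:(lra)); derive_as; field.
  - intros x Hx; destruct (trapped_order x ltac:(lra)) as [A [B C]].
    apply scalar_curvature_ineq; lra.
Qed.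

Lemma w_derive r : 0 < r <= b ->
  is_derive (fun r => U ixi r - U iL1 r - U iL2 r - U iL3 r) r
    (- U ixi r * (U ixi r - U iL1 r - U iL2 r - U iL3 r) + 2 * al).
Proof.
  intros Hr; rewrite <- (proj1 (proj2 HU) r Hr); pose proof (HO r Hr) as Ho.
  getode Ho; derive_as; unfold energy; field.
Qed.

Lemma trapped_w r : 0 <= al -> 0 < r < b -> 0 <= U ixi r - U iL1 r - U iL2 r - U iL3 r.
Proof.
  intros Hal Hr; destruct (proj1 HP r) as [_ Hp]; [lra|].
  assert (0 <= (U ixi r - U iL1 r - U iL2 r - U iL3 r) * P r); [|nra].
  apply (weighted_incr (fun r => U ixi r - U iL1 r - U iL2 r - U iL3 r) (fun _ => 2 * al)); [easy | | |].
  - apply (lim0_P0 _ 0); [|lra]; apply (sol_zc_lim al be ga b U); [lra | easy].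
  - intros x Hx; apply w_derive; lra.
  - intros; lra.
Qed.

Lemma trapped_xi r : 0 <= al -> 0 < r < b -> 0 < U ixi r.
Proof.
  intros Hal Hr; pose proof (trapped_w r Hal Hr); pose proof (trapped_trace r Hr); lra.
Qed.

Lemma trapped_xi_decr T r : 0 < T <= r -> r < b -> U ixi r <= U ixi T.
Proof.
  intros HT Hr; assert (- U ixi T <= - U ixi r); [|lra].
  apply (incr_on (fun r => - U ixi r) (fun r => U iL1 r ^ 2 + U iL2 r ^ 2 + U iL3 r ^ 2)); [lra | |].
  - intros x Hx; getode (HO x ltac:(lra)); derive_as; ring.
  - intros; repeat apply Rplus_le_le_0_compat; apply pow2_ge_0.
Qed.

Lemma density_incr T r : 0 <= al -> 0 < T <= r -> r < b -> P T <= P r.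
Proof.
  intros Hal HT Hr; apply (incr_on P (fun x => U ixi x * P x)); [lra | |].
  - intros x Hx; apply HP; lra.
  - intros x Hx; apply Rmult_le_pos; [left; apply trapped_xi; lra|]; left; apply HP; lra.
Qed.

Lemma ratio13_incr T r : 0 < T <= r -> r < b -> U iR1 T / U iR3 T <= U iR1 r / U iR3 r.
Proof.
  intros HT Hr; apply (ratio_incr (U iR1) (U iR3) (fun r => U iL1 r - U iL2 r - U iL3 r)
    (fun r => U iL3 r - U iL1 r - U iL2 r)); try (intros x Hx; apply (HO x); lra); [lra|].
  intros x Hx; destruct (trapped_order x ltac:(lra)); lra.
Qed.

Lemma ratio12_incr T r : 0 < T <= r -> r < b -> U iR1 T / U iR2 T <= U iR1 r / U iR2 r.
Proof.
  intros HT Hr; apply (ratio_incr (U iR1) (U iR2) (fun r => U iL1 r - U iL2 r - U iL3 r)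
    (fun r => U iL2 r - U iL3 r - U iL1 r)); try (intros x Hx; apply (HO x); lra); [lra|].
  intros x Hx; destruct (trapped_order x ltac:(lra)); lra.
Qed.

Lemma ratio32_decr T r : 0 < T <= r -> r < b -> U iR3 r / U iR2 r <= U iR3 T / U iR2 T.
Proof.
  intros HT Hr; apply (ratio_incr (U iR2) (U iR3) (fun r => U iL2 r - U iL3 r - U iL1 r)
    (fun r => U iL3 r - U iL1 r - U iL2 r)); try (intros x Hx; apply (HO x); lra); [lra|].
  intros x Hx; destruct (trapped_order x ltac:(lra)); lra.
Qed.

(* [(R1 - R2)^2], the negative part of the source of [L3], is dominated by the source of
   [L1 - L2], which is integrable against [P]. *)
Lemma trapped_L3 T q k r : 0 <= al -> 0 < T <= r -> r < b ->
  0 < q <= 1 -> q <= U iR1 T / U iR3 T -> k = / q ->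
  - Rabs (U iL3 T - k * (U iL1 T - U iL2 T)) * P T <= U iL3 r * P r.
Proof.
  intros Hal HT Hr Hq HqT Hk.
  assert (Hk1 : 1 <= k) by (rewrite Hk, <- Rinv_1; apply Rinv_le_contravar; lra).
  assert (Hkq : k * q = 1) by (rewrite Hk; field; lra).
  destruct (proj1 HP T) as [_ HpT]; [lra|]; destruct (proj1 HP r) as [_ Hpr]; [lra|].
  assert (H : (U iL3 T - k * (U iL1 T - U iL2 T)) * P T <= (U iL3 r - k * (U iL1 r - U iL2 r)) * P r).
  { apply (incr_on (fun r => (U iL3 r - k * (U iL1 r - U iL2 r)) * P r)
      (fun r => (U iR3 r ^ 2 / 2 - (U iR1 r - U iR2 r) ^ 2 / 2
         + k * ((U iR2 r - U iR1 r) * (U iR1 r + U iR2 r - U iR3 r))) * P r)); [lra | |].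
    - intros x Hx; destruct (proj1 HP x) as [Hd _]; [lra|].
      getode (HO x ltac:(lra)); derive_as; field.
    - intros x Hx; destruct (proj1 HP x) as [_ Hp]; [lra|].
      apply Rmult_le_pos; [|lra].
      destruct (trapped_order x ltac:(lra)) as [A [B C]].
      assert (Hqx : q * U iR3 x <= U iR1 x).
      { pose proof (ratio13_incr T x ltac:(lra) ltac:(lra)).
        apply (Rmult_le_reg_r (/ U iR3 x)); [apply Rinv_0_lt_compat; lra|].
        replace (q * U iR3 x * / U iR3 x) with q by (field; lra); unfold Rdiv in *; lra. }
      (* If R3 <= R2 / 2, then R1 + R2 - R3 is at least R2 / 2, and k >= 1. Otherwise k R1 >= R3 >
         R2 / 2, where [R1 >= q R3] persists because R1 / R3 is nondecreasing. *)
      assert (Hs : U iR2 x - U iR1 x <= 2 * k * (U iR1 x + U iR2 x - U iR3 x)).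
      { destruct (Rle_lt_dec (U iR3 x) (U iR2 x / 2)); [nra|].
        assert (k * (q * U iR3 x) <= k * U iR1 x) by (apply Rmult_le_compat_l; lra).
        rewrite <- Rmult_assoc, Hkq in H.
        assert (0 <= k * (U iR2 x - U iR3 x)) by (apply Rmult_le_pos; lra); lra. }
      pose proof (pow2_ge_0 (U iR3 x)).
      assert ((U iR2 x - U iR1 x) * (U iR2 x - U iR1 x) <=
        (U iR2 x - U iR1 x) * (2 * k * (U iR1 x + U iR2 x - U iR3 x))) by (apply Rmult_le_compat_l; lra).
      nra. }
  destruct (trapped_order r ltac:(lra)) as [_ [_ C]].
  assert (0 <= k * (U iL1 r - U iL2 r) * P r) by (repeat apply Rmult_le_pos; lra).
  pose proof (Rle_abs (- (U iL3 T - k * (U iL1 T - U iL2 T)))) as Ha; rewrite Rabs_Ropp in Ha.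
  assert (- Rabs (U iL3 T - k * (U iL1 T - U iL2 T)) * P T <= (U iL3 T - k * (U iL1 T - U iL2 T)) * P T)
    by (apply Rmult_le_compat_r; lra).
  lra.
Qed.

End Trapped.

(** * The two crossings and global existence *)

Lemma sol_ext al be ga b b' U W :
  0 < b < b' -> sol al be ga b' W -> (forall i r, 0 < r <= b' -> U i r = W i r) -> sol al be ga b U.
Proof.
  intros Hb [H1 [H2 H3]] E; split; [|split].
  - intros r Hr i; rewrite (G_ext _ (fun j => W j r)) by (intros; apply E; lra).
    assert (Hm : 0 < Rmin r (b' - r)) by (apply Rmin_pos; lra).
    pose proof (Rmin_l r (b' - r)); pose proof (Rmin_r r (b' - r)).
    apply (is_derive_near (W i) _ _ _ (Rmin r (b' - r))); [easy | | apply H1; lra].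
    intros y Hy; symmetry; apply E; apply Rabs_def2 in Hy; lra.
  - intros r Hr; unfold energy; rewrite !E by lra; apply H2; lra.
  - apply (sing_lims_ext b ga be W); [lra | intros; apply E; lra | exact H3].
Qed.

(** For each r a solution reaching beyond r is chosen and evaluated at r; uniqueness makes the
    choices agree. *)
Lemma sol_unify al be ga T :
  0 < T -> (forall b, T <= b -> exists W, sol al be ga b W) ->
  exists U, forall b, 0 < b -> sol al be ga b U.
Proof.
  intros HT H.
  assert (HTr : forall r, T <= T + Rabs r) by (intros r; pose proof (Rabs_pos r); lra).
  set (W := fun r => proj1_sig (constructive_indefinite_description _ (H (T + Rabs r) (HTr r)))).
  assert (HW : forall r, sol al be ga (T + Rabs r) (W r)).
  { intros r; unfold W; apply proj2_sig. }
  exists (fun i r => W r i r); intros b Hb.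
  apply (sol_ext al be ga b (T + Rabs b) _ (W b)).
  - rewrite Rabs_right; lra.
  - apply HW.
  - intros i r Hr; set (m := Rmin (T + Rabs r) (T + Rabs b)).
    pose proof (Rmin_l (T + Rabs r) (T + Rabs b)); pose proof (Rmin_r (T + Rabs r) (T + Rabs b)).
    assert (Hrm : 0 < r <= m).
    { split; [lra|]; apply Rmin_glb; [|lra]; pose proof (Rle_abs r); lra. }
    apply (sol_unique al be ga m); [lra | | | easy];
    [apply sol_restrict with (T + Rabs r) | apply sol_restrict with (T + Rabs b)];
    try apply HW; fold m in H0, H1; lra.
Qed.

(** The condition [T <= b] matches the perturbation lemma, which continues nearby solutions from [T]
    to [b]. *)
Definition crossed_down (T al be ga : R) := exists b U r,
  T <= b /\ sol al be ga b U /\ 0 < r <= b /\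
  (forall x, 0 < x <= r -> U iR1 x < U iR2 x) /\ U iL1 r < U iL2 r.

Definition crossed_up (T al be ga : R) := exists b U r,
  T <= b /\ sol al be ga b U /\ 0 < r <= b /\ U iR2 r < U iR1 r.

Lemma R12_lim al be ga b U : 0 < b -> sol al be ga b U ->
  lim0 (fun r => (U iR2 r - U iR1 r) - 1 / (2 * r)) ga.
Proof.
  intros Hb HU; destruct (proj2 (proj2 HU)) as [_ [_ [_ [_ [L [L' _]]]]]].
  apply (lim0_ext (fun r => (U iR2 r - 1 / (2 * r)) - U iR1 r / r * r) _ b); [easy | |].
  - intros; field; lra.
  - eapply lim0_eq; [exact (lim0_minus _ _ _ _ L' (lim0_mult _ _ _ _ L lim0_id)) | ring].
Qed.

(* Were [R1 = R2] to hold first at [r], also [L1 = L2] there, and [R1 = R2, L1 = L2] is invariant. *)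
Lemma trapped_of_not T al be ga b U :
  0 < T <= b -> 0 < be -> sol al be ga b U ->
  ~ crossed_down T al be ga -> ~ crossed_up T al be ga -> trapped b U.
Proof.
  intros HT Hbe HU HA HB.
  assert (HO := proj1 HU).
  assert (HB' : forall r, 0 < r <= b -> U iR1 r <= U iR2 r).
  { intros r Hr; destruct (Rle_lt_dec (U iR1 r) (U iR2 r)) as [|h]; [easy|].
    exfalso; apply HB; exists b, U, r; easy. }
  assert (HA' : forall r, 0 < r <= b -> (forall x, 0 < x <= r -> U iR1 x < U iR2 x) -> U iL2 r <= U iL1 r).
  { intros r Hr H; destruct (Rle_lt_dec (U iL2 r) (U iL1 r)) as [|h]; [easy|].
    exfalso; apply HA; exists b, U, r; easy. }
  assert (H12 : forall r, 0 < r < b -> U iR1 r < U iR2 r).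
  { intros r0 Hr0; apply (real_ind (fun r => U iR1 r < U iR2 r) r0); [| | |lra].
    - destruct (large_near0 (fun r => U iR2 r - U iR1 r) ga) as [d [Hd H]].
      { apply (R12_lim al be ga b U); [lra | easy]. }
      exists d; split; [easy|]; intros r Hr _; specialize (H r Hr); lra.
    - intros r Hr Hlt.
      destruct (HB' r) as [h|h]; [lra | easy | exfalso].
      assert (HD : U iL2 r <= U iL1 r).
      { assert (U iL2 r - U iL1 r <= 0); [|lra].
        apply (cont_le_left (fun r => U iL2 r - U iL1 r) 0 r); [lra | |].
        - contr ltac:(apply ode_cont, HO; lra).
        - intros y Hy; assert (U iL2 y <= U iL1 y); [|lra].
          apply HA'; [lra|]; intros x Hx; apply Hlt; lra. }
      assert (Hf : forall x, 0 < x <= b -> is_derive (fun r => U iR2 r - U iR1 r) x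
        (- U iL3 x * (U iR2 x - U iR1 x) - (U iL1 x - U iL2 x) * (U iR1 x + U iR2 x))).
      { intros x Hx; pose proof (HO x Hx) as Ho; getode Ho; derive_as; ring. }
      assert (Hg : forall x, 0 < x <= b -> is_derive (fun r => U iL1 r - U iL2 r) x
        (- U ixi x * (U iL1 x - U iL2 x) - (U iR2 x - U iR1 x) * (U iR1 x + U iR2 x - U iR3 x))).
      { intros x Hx; pose proof (HO x Hx) as Ho; getode Ho; derive_as; field. }
      (* If L1 > L2 at the contact, R2 - R1 would have a negative derivative there, and R1 would
         exceed R2 right after. *)
      assert (HD0 : U iL1 r - U iL2 r = 0).
      { destruct HD as [HD|HD]; [exfalso|lra].
        pose proof (R1_pos al be ga b U Hbe HU r ltac:(lra)) as Hp.
        destruct (decr_right (fun r => U iR2 r - U iR1 r) r _ (b - r) (Hf r ltac:(lra))) as [y [Hy1 Hy2]];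
          [rewrite h; nra | lra |].
        specialize (HB' y ltac:(lra)); lra. }
      (* The pair (R2 - R1, L1 - L2) solves a linear homogeneous system, so N' >= c N with c
         continuous: being positive at r / 2, N cannot vanish at r. *)
      set (N := fun x => (U iR2 x - U iR1 x) ^ 2 + (U iL1 x - U iL2 x) ^ 2).
      set (s := fun x => U iR1 x + U iR2 x + (U iR1 x + U iR2 x - U iR3 x)).
      set (c := fun x => - (3 + U iL3 x ^ 2 + U ixi x ^ 2 + s x ^ 2)).
      assert (HN : 0 < N r).
      { apply (gron_pos N (fun x =>
          2 * (U iR2 x - U iR1 x) *
            (- U iL3 x * (U iR2 x - U iR1 x) - (U iL1 x - U iL2 x) * (U iR1 x + U iR2 x))
          + 2 * (U iL1 x - U iL2 x) *
            (- U ixi x * (U iL1 x - U iL2 x) - (U iR2 x - U iR1 x) * (U iR1 x + U iR2 x - U iR3 x))) c (r / 2) r).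
        - lra.
        - intros x Hx; specialize (Hf x ltac:(lra)); specialize (Hg x ltac:(lra)).
          unfold N; apply dplus;
          [apply (dsqr (fun x => U iR2 x - U iR1 x)) | apply (dsqr (fun x => U iL1 x - U iL2 x))]; easy.
        - intros x Hx; unfold c, s; contr ltac:(apply ode_cont, HO; lra).
        - intros x Hx; unfold c, N.
          set (f := U iR2 x - U iR1 x); set (g := U iL1 x - U iL2 x).
          set (p := U iL3 x); set (q := U ixi x).
          replace (2 * f * (- p * f - g * (U iR1 x + U iR2 x)) +
            2 * g * (- q * g - f * (U iR1 x + U iR2 x - U iR3 x))) with
            (- (2 * p) * f ^ 2 - 2 * q * g ^ 2 - 2 * (f * g) * s x) by (unfold s; ring).
          set (t := s x).
          pose proof (pow2_ge_0 f); pose proof (pow2_ge_0 g).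
          assert (S : forall u v : R, 0 <= u ^ 2 * v ^ 2) by (intros; apply Rmult_le_pos; apply pow2_ge_0).
          pose proof (S (p - 1) f); pose proof (S (q - 1) g); pose proof (S p g); pose proof (S q f).
          pose proof (S t g); pose proof (pow2_ge_0 (t * f - g)); nra.
        - assert (U iR1 (r / 2) < U iR2 (r / 2)) by (apply Hlt; lra).
          unfold N; pose proof (pow2_ge_0 (U iL1 (r / 2) - U iL2 (r / 2))); nra. }
      unfold N in HN; rewrite HD0, h in HN; rewrite Rminus_diag in HN; simpl in HN; lra.
    - intros r Hr Hle; specialize (Hle r ltac:(lra)).
      destruct (pos_near (fun r => U iR2 r - U iR1 r) r) as [d [Hd H]]; [| lra |].
      + contr ltac:(apply ode_cont, HO; lra).
      + exists d; split; [easy|]; intros x Hx _; specialize (H x); rewrite Rabs_right in H; lra. }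
  intros r Hr; split; [now apply H12|]; apply HA'; [lra|]; intros x Hx; apply H12; lra.
Qed.

(** It involves the values at [T] only and is therefore common to all continuations of a solution
    given up to [T]. *)
Definition L3_const (T : R) (U : ix -> R -> R) :=
  Rabs (U iL3 T - / Rmin 1 (U iR1 T / U iR3 T) * (U iL1 T - U iL2 T)).

Lemma trapped_L3_lower al be ga b U P T r :
  0 <= al -> 0 < be -> 0 <= ga -> sol al be ga b U -> trapped b U -> density b U P ->
  0 < T <= r -> r < b -> - L3_const T U * P T <= U iL3 r * P r.
Proof.
  intros Hal Hbe Hga HU Htr HP HT Hr.
  destruct (trapped_order al be ga b U Hbe Hga HU Htr T ltac:(lra)) as [A [B C]].
  apply (trapped_L3 al be ga b U Hbe Hga HU Htr P HP T (Rmin 1 (U iR1 T / U iR3 T))); try easy.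
  - split; [|apply Rmin_l]; apply Rmin_pos; [lra | apply Rdiv_lt_0_compat; lra].
  - apply Rmin_r.
Qed.

(** [P] is nondecreasing since xi > 0, so the lower bound on L3 P gives one on [L3]. Then w >= 0
    bounds [L1] by xi - L2 - L3, and (ln R2)' = L2 - L3 - L1 <= - L3 gives the exponential bound. *)
Lemma trapped_bounds al be ga b U T r :
  0 <= al -> 0 < be -> 0 <= ga -> sol al be ga b U -> trapped b U ->
  0 < T <= r -> r < b ->
  0 < U ixi r <= U ixi T /\ - L3_const T U <= U iL3 r <= U iL2 r /\ 0 <= U iL2 r <= U iL1 r /\
  U iL1 r <= U ixi T + L3_const T U /\
  0 < U iR1 r < U iR2 r /\ 0 < U iR3 r <= U iR2 r /\
  U iR2 r <= U iR2 T * exp (L3_const T U * (r - T)).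
Proof.
  intros Hal Hbe Hga HU Htr HT Hr.
  destruct (density_exists al be ga b U) as [P HP]; [lra | easy |].
  set (K := L3_const T U).
  assert (HK : 0 <= K) by apply Rabs_pos.
  assert (H3 : forall x, T <= x <= r -> - K <= U iL3 x).
  { intros x Hx.
    pose proof (trapped_L3_lower al be ga b U P T x Hal Hbe Hga HU Htr HP ltac:(lra) ltac:(lra)) as H.
    pose proof (density_incr al be ga b U Hbe Hga HU Htr P HP T x Hal ltac:(lra) ltac:(lra)) as HPx.
    destruct (proj1 HP T) as [_ HpT]; [lra|]; fold K in H.
    destruct (Rle_lt_dec (- K) (U iL3 x)) as [|h]; [easy|exfalso]; nra. }
  destruct (trapped_order al be ga b U Hbe Hga HU Htr r ltac:(lra)) as [A [B C]].
  pose proof (trapped_L2 al be ga b U Hbe Hga HU Htr P HP r ltac:(lra)).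
  pose proof (trapped_xi al be ga b U Hbe Hga HU Htr P HP r Hal ltac:(lra)).
  pose proof (trapped_xi_decr al be ga b U HU T r ltac:(lra) ltac:(lra)).
  pose proof (trapped_w al be ga b U HU P HP r Hal ltac:(lra)).
  pose proof (H3 r ltac:(lra)).
  repeat split; try lra.
  assert (- U iR2 T * exp (K * r - K * T) <= - U iR2 r); [|rewrite Rmult_minus_distr_l; lra].
  apply (gron_ge (fun r => - U iR2 r) (fun r => - (U iR2 r * (U iL2 r - U iL3 r - U iL1 r)))
    (fun _ => K) (fun r => K * r)); [lra | | |].
  - intros x Hx; assert (Ho : ode U x) by (apply (proj1 HU); lra); getode Ho; derive_as; ring.
  - intros x Hx; derive_as; ring.
  - intros x Hx; specialize (H3 x Hx).
    destruct (trapped_order al be ga b U Hbe Hga HU Htr x ltac:(lra)) as [A' [B' C']].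
    assert (0 <= U iR2 x * (K - (U iL2 x - U iL3 x - U iL1 x))) by (apply Rmult_le_pos; lra); lra.
Qed.

(** Every continuation up to some b' is trapped, and the bounds of [trapped_bounds] depend only on
    the values at [T] and on b; so continuation never stops. *)
Lemma trapped_exists T al be ga U :
  0 < T -> 0 <= al -> 0 < be -> 0 <= ga -> sol al be ga T U ->
  ~ crossed_down T al be ga -> ~ crossed_up T al be ga ->
  exists W, forall b, 0 < b -> sol al be ga b W /\ trapped b W.
Proof.
  intros HT Hal Hbe Hga HU HA HB.
  assert (HW : exists W, forall b, 0 < b -> sol al be ga b W).
  { apply (sol_unify al be ga T HT); intros b Hb.
    destruct (sol_continuation al be ga T U b) as [W [HW _]]; [lra | easy | | now exists W].
    set (K := L3_const T U).
    exists (U ixi T + K + U iR2 T * exp (K * (b - T))).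
    intros b' W Hb' HW i r Hr.
    assert (Htr : trapped b' W) by (apply (trapped_of_not T al be ga); lra || easy).
    pose proof (trapped_bounds al be ga b' W T r Hal Hbe Hga HW Htr ltac:(lra) ltac:(lra)) as H.
    assert (HWT : sol al be ga T W) by (apply sol_restrict with b'; [lra | easy]).
    assert (E : forall i, W i T = U i T).
    { intros j; apply (sol_unique al be ga T); lra || easy. }
    replace (L3_const T W) with K in H by (unfold K, L3_const; rewrite !E; reflexivity).
    rewrite !E in H.
    assert (HK : 0 <= K) by apply Rabs_pos.
    assert (Hexp : exp (K * (r - T)) <= exp (K * (b - T))).
    { destruct (Rle_lt_or_eq_dec (K * (r - T)) (K * (b - T))) as [h|h]; [nra | left; now apply exp_increasing | rewrite h; lra]. }
    pose proof (R2_pos al be ga T U HU T ltac:(lra)) as H2.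
    apply (Rmult_le_compat_l (U iR2 T)) in Hexp; [|lra].
    pose proof (exp_pos (K * (b - T))).
    assert (0 < U iR2 T * exp (K * (b - T))) by (apply Rmult_lt_0_compat; lra).
    apply Rabs_le; destruct i; lra. }
  destruct HW as [W HW]; exists W; intros b Hb; split; [now apply HW|].
  assert (trapped (b + T) W).
  { apply (trapped_of_not T al be ga); [lra | easy | apply HW; lra | easy | easy]. }
  intros r Hr; apply H; lra.
Qed.

Lemma sol_symmetric al be b U r : 0 < r <= b -> sol al be 0 b U ->
  U iR3 r = U iR2 r /\ U iL3 r = U iL2 r.
Proof.
  intros Hr HU; pose proof (swap23_sol _ _ _ _ _ HU) as HS; rewrite Ropp_0 in HS.
  split; [apply (sol_unique al be 0 b _ _ ltac:(lra) HU HS iR3 r Hr)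
    | apply (sol_unique al be 0 b _ _ ltac:(lra) HU HS iL3 r Hr)].
Qed.

(** * Small values of beta at gamma = 0 *)

Lemma weighted_decr b U P (f s : R -> R) l a : density b U P ->
  0 < a < b -> lim0 (fun r => f r * P r) l ->
  (forall r, 0 < r <= a -> is_derive f r (- U ixi r * f r + s r)) ->
  (forall r, 0 < r <= a -> s r <= 0) -> f a * P a <= l.
Proof.
  intros HP Ha Hl Hf Hs.
  assert (- l <= (- f a) * P a); [|lra].
  apply (weighted_incr b U P HP (fun r => - f r) (fun r => - s r)); [easy | | |].
  - apply (lim0_ext (fun r => - (f r * P r)) _ b); [lra | intros; ring | now apply lim0_opp].
  - intros r Hr; specialize (Hf r Hr); derive_as; ring.
  - intros r Hr; specialize (Hs r Hr); lra.
Qed.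

Section SmallBeta.
Variables (al be b : R) (U : ix -> R -> R) (P : R -> R).
Hypothesis al_large : 1 / 2 <= al.
Hypothesis be_pos : 0 < be.
Hypothesis HU : sol al be 0 b U.
Hypothesis Htr : trapped b U.
Hypothesis HP : density b U P.

Let HO : forall r, 0 < r <= b -> ode U r := proj1 HU.

Let order := trapped_order al be 0 b U be_pos (Rle_refl 0) HU Htr.

Lemma trace_weighted r : 0 < r < b -> 1 <= (U iL1 r + U iL2 r + U iL3 r) * P r.
Proof.
  intros Hr; destruct (proj2 (proj2 HU)) as [_ [l1 [l2 [l3 _]]]].
  apply (weighted_incr b U P HP (fun r => U iL1 r + U iL2 r + U iL3 r)
    (fun r => U iR1 r * U iR2 r + U iR2 r * U iR3 r + U iR3 r * U iR1 r
      - (U iR1 r ^ 2 + U iR2 r ^ 2 + U iR3 r ^ 2) / 2)); [easy | | |].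
  - apply (lim0_pole b U P HP) in l1; [|lra]; apply (lim0_P0 b U P HP) in l2; [|lra].
    apply (lim0_P0 b U P HP) in l3; [|lra].
    apply (lim0_ext (fun r => U iL1 r * P r + U iL2 r * P r + U iL3 r * P r) _ b);
      [lra | intros; ring |].
    eapply lim0_eq; [exact (lim0_plus _ _ _ _ (lim0_plus _ _ _ _ l1 l2) l3) | field].
  - intros x Hx; getode (HO x ltac:(lra)); derive_as; field.
  - intros x Hx; destruct (order x ltac:(lra)) as [A _].
    destruct (sol_symmetric al be b U x ltac:(lra) HU) as [E _]; rewrite E.
    replace (U iR1 x * U iR2 x + U iR2 x * U iR2 x + U iR2 x * U iR1 x
      - (U iR1 x ^ 2 + U iR2 x ^ 2 + U iR2 x ^ 2) / 2) with
      (U iR1 x * (2 * U iR2 x - U iR1 x / 2)) by field.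
    apply Rmult_le_pos; lra.
Qed.

(** Without the source of the trace, and with [al = 1 / 2], the equations read P'' = P, that is P =
    sinh r. The bound keeps the first two Taylor terms: P' is the sum of the trace part, at least 1,
    and of w P, at least r^2 / 2. *)
Lemma density_cubic r : 0 < r < b -> r + r ^ 3 / 6 <= P r.
Proof.
  intros Hr.
  assert (Hlim := density_lim b U P ltac:(lra) HP).
  assert (Hxi : forall x, U ixi x * P x = (U iL1 x + U iL2 x + U iL3 x) * P x
    + (U ixi x - U iL1 x - U iL2 x - U iL3 x) * P x) by (intros; ring).
  assert (HPp : forall x, 0 < x <= b -> 0 < P x) by (intros; now apply HP).
  assert (H1 : forall x, 0 < x < b -> x <= P x).
  { intros x Hx; assert (0 <= P x - x); [|lra].
    apply (incr_from0 (fun x => P x - x) (fun x => U ixi x * P x - 1) 0 x); [| | |lra].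
    - eapply lim0_eq; [lim0s | ring].
    - intros y Hy; destruct (proj1 HP y) as [Hd _]; [lra|]; now derive_as.
    - intros y Hy; rewrite Hxi; pose proof (trace_weighted y ltac:(lra)).
      pose proof (trapped_w al be 0 b U HU P HP y ltac:(lra) ltac:(lra)).
      pose proof (HPp y ltac:(lra)); nra. }
  assert (H2 : forall x, 0 < x < b -> x ^ 2 / 2 <= (U ixi x - U iL1 x - U iL2 x - U iL3 x) * P x).
  { intros x Hx; assert (0 <= (U ixi x - U iL1 x - U iL2 x - U iL3 x) * P x - x ^ 2 / 2); [|lra].
    apply (incr_from0 (fun x => (U ixi x - U iL1 x - U iL2 x - U iL3 x) * P x - x ^ 2 / 2)
      (fun x => 2 * al * P x - x) 0 x); [| | |lra].
    - assert (L : lim0 (fun x => (U ixi x - U iL1 x - U iL2 x - U iL3 x) * P x) 0).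
      { apply (lim0_P0 b U P HP _ 0); [|lra]; apply (sol_zc_lim al be 0 b U); [lra | easy]. }
      assert (L' : lim0 (fun x => x ^ 2 / 2) (0 ^ 2 * / 2)) by lim0s.
      eapply lim0_eq; [exact (lim0_minus _ _ _ _ L L') | field].
    - intros y Hy; destruct (proj1 HP y) as [Hd _]; [lra|].
      pose proof (w_derive al be 0 b U HU y ltac:(lra)) as Hw.
      eapply is_derive_cv; [apply dminus; [apply (dmult _ _ _ _ _ Hw Hd) | der] |].
      cbv beta; field.
    - intros y Hy; pose proof (H1 y ltac:(lra)); nra. }
  assert (0 <= P r - (r + r ^ 3 / 6)); [|lra].
  apply (incr_from0 (fun x => P x - (x + x * x ^ 2 / 6)) (fun x => U ixi x * P x - (1 + x ^ 2 / 2)) 0 r); [| | |lra].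
  - assert (L' : lim0 (fun x => x + x * x ^ 2 / 6) (0 + 0 * 0 ^ 2 * / 6)) by lim0s.
    eapply lim0_eq; [exact (lim0_minus _ _ _ _ Hlim L') | field].
  - intros y Hy; destruct (proj1 HP y) as [Hd _]; [lra|]; derive_as; field.
  - intros y Hy; rewrite Hxi; pose proof (trace_weighted y ltac:(lra)); pose proof (H2 y ltac:(lra)); lra.
Qed.

Lemma D_weighted r : 0 < r < b -> (U iL1 r - U iL2 r) * P r <= 1.
Proof.
  intros Hr; destruct (proj2 (proj2 HU)) as [_ [l1 [l2 _]]].
  apply (weighted_decr b U P (fun r => U iL1 r - U iL2 r)
    (fun r => - ((U iR2 r - U iR1 r) * (U iR1 r + U iR2 r - U iR3 r))) 1 r HP Hr).
  - apply (lim0_pole b U P HP) in l1; [|lra]; apply (lim0_P0 b U P HP) in l2; [|lra].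
    apply (lim0_ext (fun r => U iL1 r * P r - U iL2 r * P r) _ b); [lra | intros; ring |].
    eapply lim0_eq; [exact (lim0_minus _ _ _ _ l1 l2) | ring].
  - intros x Hx; getode (HO x ltac:(lra)); derive_as; field.
  - intros x Hx; destruct (order x ltac:(lra)) as [A [B _]].
    assert (0 <= (U iR2 x - U iR1 x) * (U iR1 x + U iR2 x - U iR3 x)) by (apply Rmult_le_pos; lra); lra.
Qed.

(* [(ln (r^2 / (1 + r^2/6)))' = 2 / (r + r^3/6)], which bounds [2 (L1 - L2)]. *)
Lemma log_comparison r x : 0 < r < b -> x * P r <= 2 ->
  x + r / 3 / (1 + r ^ 2 / 6) - 2 / r <= 0.
Proof.
  intros Hr H; pose proof (density_cubic r Hr) as Hc.
  assert (H0 : 0 < 1 + r ^ 2 / 6) by nra.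
  assert (Hx : x <= 2 / (r * (1 + r ^ 2 / 6))).
  { apply Rle_div_r; [apply Rmult_lt_0_compat; lra|].
    replace (r * (1 + r ^ 2 / 6)) with (r + r ^ 3 / 6) by field.
    destruct (Rle_lt_dec x 0) as [h|h]; [|nra].
    assert (0 < r + r ^ 3 / 6) by (assert (0 < r ^ 3) by (apply pow_lt; lra); lra); nra. }
  replace (2 / r) with (2 / (r * (1 + r ^ 2 / 6)) + r / 3 / (1 + r ^ 2 / 6)) by (field; split; nra).
  lra.
Qed.

(** By [log_comparison] the quotient of R1 / R2 by r^2 / (1 + r^2 / 6) is nonincreasing. It starts
    at 2 be, as R1 ~ be r and R2 ~ 1 / (2 r), and the divisor never exceeds 6. *)
Lemma rho_bound r : 0 < r < b -> U iR1 r <= 12 * be * U iR2 r.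
Proof.
  intros Hr.
  destruct (order r Hr) as [A _].
  set (f := fun r => U iR1 r / U iR2 r * (1 + r ^ 2 / 6) / r ^ 2).
  assert (Hf : - (2 * be) <= - f r).
  { apply (incr_from0 (fun r => - f r) (fun x => - f x * (2 * (U iL1 x - U iL2 x) +
      x / 3 / (1 + x ^ 2 / 6) - 2 / x)) (- (2 * be)) r); [| | |lra].
    - destruct (proj2 (proj2 HU)) as [_ [_ [_ [_ [l1 [l2 _]]]]]].
      assert (L : lim0 (fun x => (U iR2 x - 1 / (2 * x)) * x + 1 / 2) (1 / 2)).
      { eapply lim0_eq; [exact (lim0_plus _ _ _ _ (lim0_mult _ _ _ _ l2 lim0_id) (lim0_const (1 / 2))) | ring]. }
      assert (L2 : lim0 (fun x => / ((U iR2 x - 1 / (2 * x)) * x + 1 / 2)) (/ (1 / 2))).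
      { eapply (filterlim_comp _ _ _ _ Rinv _ (locally (1 / 2))); [exact L|].
        apply (filterlim_Rbar_inv (1 / 2)); injection; lra. }
      assert (L' : lim0 (fun x => 1 + x ^ 2 / 6) (1 + 0 ^ 2 * / 6)) by lim0s.
      apply lim0_opp; apply (lim0_ext (fun x => U iR1 x / x * / ((U iR2 x - 1 / (2 * x)) * x + 1 / 2)
        * (1 + x ^ 2 / 6)) _ b); [lra | |].
      + intros x Hx; unfold f; pose proof (R2_pos al be 0 b U HU x ltac:(lra)).
        replace ((U iR2 x - 1 / (2 * x)) * x + 1 / 2) with (U iR2 x * x) by (field; lra).
        field; lra.
      + eapply lim0_eq; [exact (lim0_mult _ _ _ _ (lim0_mult _ _ _ _ l1 L2) L') | field].
    - intros x Hx; unfold f.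
      assert (Ho : ode U x) by (apply HO; lra).
      pose proof (R2_pos al be 0 b U HU x ltac:(lra)).
      assert (0 < x ^ 2) by (apply pow_lt; lra).
      getode Ho; derive_as; try lra; field; nra.
    - intros x Hx.
      destruct (order x ltac:(lra)) as [A' _].
      assert (0 <= f x).
      { unfold f; apply Rdiv_le_0_compat; [|apply pow_lt; lra].
        apply Rmult_le_pos; [apply Rdiv_le_0_compat; lra | nra]. }
      pose proof (log_comparison x (2 * (U iL1 x - U iL2 x)) ltac:(lra)) as Hl.
      pose proof (D_weighted x ltac:(lra)); specialize (Hl ltac:(lra)); nra. }
  assert (E : U iR1 r = f r * (U iR2 r * (r ^ 2 / (1 + r ^ 2 / 6)))).
  { unfold f; field; repeat split; nra. }
  assert (Hq : 0 <= r ^ 2 / (1 + r ^ 2 / 6) <= 6).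
  { split; [apply Rdiv_le_0_compat; nra | apply Rle_div_l; nra]. }
  rewrite E; apply Rle_trans with (2 * be * (U iR2 r * 6)); [|lra].
  apply Rle_trans with (2 * be * (U iR2 r * (r ^ 2 / (1 + r ^ 2 / 6)))).
  - apply Rmult_le_compat_r; [apply Rmult_le_pos|]; lra.
  - apply Rmult_le_compat_l; [lra|]; apply Rmult_le_compat_l; lra.
Qed.

Hypothesis be_small : be <= 1 / 100.

(** The source of 2 L1 - L2 is - (R2 - 3/2 R1) R1, negative since R1 is at most 12/100 of R2; and L1
    <= 2 L1 - L2. *)
Lemma L1_weighted r : 0 < r < b -> U iL1 r * P r <= 2.
Proof.
  intros Hr; destruct (proj2 (proj2 HU)) as [_ [l1 [l2 _]]].
  destruct (order r Hr) as [_ [_ C]].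
  assert (H : (2 * U iL1 r - U iL2 r) * P r <= 2).
  { apply (weighted_decr b U P (fun r => 2 * U iL1 r - U iL2 r)
      (fun r => - ((U iR2 r - 3 / 2 * U iR1 r) * U iR1 r)) 2 r HP Hr).
    - apply (lim0_pole b U P HP) in l1; [|lra]; apply (lim0_P0 b U P HP) in l2; [|lra].
      apply (lim0_ext (fun r => 2 * (U iL1 r * P r) - U iL2 r * P r) _ b); [lra | intros; ring |].
      eapply lim0_eq; [exact (lim0_minus _ _ _ _ (lim0_mult _ _ _ _ (lim0_const 2) l1) l2) | ring].
    - intros x Hx; assert (Ho : ode U x) by (apply HO; lra).
      destruct (sol_symmetric al be b U x ltac:(lra) HU) as [E _].
      getode Ho; derive_as; rewrite E; field.
    - intros x Hx; destruct (order x ltac:(lra)) as [A [B _]].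
      pose proof (rho_bound x ltac:(lra)).
      assert (U iR1 x <= U iR2 x / 2) by nra.
      assert (0 <= (U iR2 x - 3 / 2 * U iR1 x) * U iR1 x) by (apply Rmult_le_pos; lra); lra. }
  destruct (proj1 HP r) as [_ Hp]; [lra|]; nra.
Qed.

(** By symmetry R2' = - L1 R2, and the bound on L1 P allows the logarithmic comparison again: R2 r^2
    / (1 + r^2 / 6) is nondecreasing. The second factor is 6/7 at r = 1 and at most 6 later. *)
Lemma R2_lower r : 1 <= r < b -> U iR2 1 / 7 <= U iR2 r.
Proof.
  intros Hr.
  set (f := fun r => U iR2 r * (r ^ 2 / (1 + r ^ 2 / 6))).
  assert (H : f 1 <= f r).
  { apply (incr_on f (fun x => - f x * (U iL1 x + x / 3 / (1 + x ^ 2 / 6) - 2 / x))); [lra | |].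
    - intros x Hx; assert (Ho : ode U x) by (apply HO; lra).
      destruct (sol_symmetric al be b U x ltac:(lra) HU) as [_ E].
      unfold f; getode Ho; rewrite E in *.
      assert (0 < 1 + x ^ 2 / 6) by nra.
      derive_as; [lra|]; field; split; nra.
    - intros x Hx; pose proof (log_comparison x (U iL1 x) ltac:(lra) (L1_weighted x ltac:(lra))).
      assert (0 <= f x); [|nra].
      unfold f; pose proof (R2_pos al be 0 b U HU x ltac:(lra)).
      apply Rmult_le_pos; [lra|]; apply Rdiv_le_0_compat; nra. }
  unfold f in H.
  pose proof (R2_pos al be 0 b U HU r ltac:(lra)).
  assert (Hq : r ^ 2 / (1 + r ^ 2 / 6) <= 6) by (apply Rle_div_l; nra).
  replace (U iR2 1 * (1 ^ 2 / (1 + 1 ^ 2 / 6))) with (6 / 7 * U iR2 1) in H by field.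
  assert (U iR2 r * (r ^ 2 / (1 + r ^ 2 / 6)) <= U iR2 r * 6) by (apply Rmult_le_compat_l; lra).
  lra.
Qed.

(** (L1 - L2) P is nonnegative, at most 1 at r = 1, and decreases at a rate at least c: R2 - R1 >=
    R2 / 2, R1 / R2 stays above its value at 1, R2 >= R2(1) / 7 and P >= 1. *)
Lemma small_beta_bounded :
  1 < b -> b <= 1 + 2 / ((U iR2 1 / 7) ^ 2 * (U iR1 1 / U iR2 1) / 2).
Proof.
  intros Hb; set (c := (U iR2 1 / 7) ^ 2 * (U iR1 1 / U iR2 1) / 2).
  destruct (order 1 ltac:(lra)) as [A1 _].
  assert (Hc : 0 < c).
  { unfold c; assert (0 < (U iR2 1 / 7) ^ 2) by (apply pow_lt; lra).
    assert (0 < U iR1 1 / U iR2 1) by (apply Rdiv_lt_0_compat; lra); nra. }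
  destruct (Rle_lt_dec b (1 + 2 / c)) as [|Hlt]; [easy|exfalso].
  set (r := 1 + 2 / c) in *.
  assert (H2c : 0 < 2 / c) by (apply Rdiv_lt_0_compat; lra).
  assert (H1r : 1 <= r) by (unfold r; lra).
  assert (H : - ((U iL1 1 - U iL2 1) * P 1) - c * 1 <= - ((U iL1 r - U iL2 r) * P r) - c * r).
  { apply (incr_on (fun r => - ((U iL1 r - U iL2 r) * P r) - c * r)
      (fun r => (U iR2 r - U iR1 r) * U iR1 r * P r - c)); [lra | |].
    - intros x Hx; destruct (proj1 HP x) as [Hd _]; [lra|].
      destruct (sol_symmetric al be b U x ltac:(lra) HU) as [E _].
      getode (HO x ltac:(lra)); derive_as; rewrite E; field.
    - intros x Hx.
      destruct (order x ltac:(lra)) as [A _].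
      pose proof (R2_lower x ltac:(lra)) as HR.
      pose proof (rho_bound x ltac:(lra)) as Hrho.
      pose proof (density_cubic x ltac:(lra)).
      assert (0 < x ^ 3) by (apply pow_lt; lra).
      pose proof (ratio12_incr al be 0 b U be_pos (Rle_refl 0) HU Htr 1 x ltac:(lra) ltac:(lra)) as Hr12.
      set (q := U iR1 1 / U iR2 1) in *.
      assert (Hq : q * U iR2 x <= U iR1 x).
      { apply (Rmult_le_reg_r (/ U iR2 x)); [apply Rinv_0_lt_compat; lra|].
        replace (q * U iR2 x * / U iR2 x) with q by (field; lra); unfold Rdiv in *; lra. }
      assert (Hq0 : 0 < q) by (apply Rdiv_lt_0_compat; lra).
      assert (H2 : U iR2 x / 2 <= U iR2 x - U iR1 x) by nra.
      assert (H3 : (U iR2 1 / 7) ^ 2 <= U iR2 x ^ 2) by (apply pow_incr; lra).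
      assert (H4 : U iR2 x / 2 * (q * U iR2 x) <= (U iR2 x - U iR1 x) * U iR1 x).
      { apply Rmult_le_compat; try lra; apply Rmult_le_pos; lra. }
      assert (H5 : c <= (U iR2 x - U iR1 x) * U iR1 x).
      { unfold c; fold q; apply Rle_trans with (U iR2 x ^ 2 * q / 2); [|lra].
        apply (Rmult_le_compat_r q) in H3; lra. }
      assert (1 <= P x) by lra; nra. }
  pose proof (D_weighted 1 ltac:(lra)).
  assert (Hcr : c * r = c + 2) by (unfold r; field; lra).
  assert (Hr : 0 <= (U iL1 r - U iL2 r) * P r).
  { destruct (Htr r ltac:(lra)) as [_ HD]; destruct (proj1 HP r) as [_ Hp]; [lra|].
    apply Rmult_le_pos; lra. }
  clearbody r; lra.
Qed.

End SmallBeta.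

(** If [crossed_down] fails, continuous induction with [rho_bound] keeps R1 <= 12 be R2 < R2, so
    [crossed_up] fails as well; the solution would be trapped for ever, against
    [small_beta_bounded]. *)
Lemma crossed_down_small T al be U :
  0 < T -> 1 / 2 <= al -> 0 < be <= 1 / 100 -> sol al be 0 T U -> crossed_down T al be 0.
Proof.
  intros HT Hal Hbe HU; apply NNPP; intros HA.
  assert (HB : ~ crossed_up T al be 0).
  { intros [b [V [r [HTb [HV [Hr H]]]]]].
    assert (HO := proj1 HV).
    assert (H12 : forall x, 0 < x <= r -> V iR1 x < V iR2 x).
    { apply real_ind.
      - destruct (large_near0 (fun r => V iR2 r - V iR1 r) 0) as [d [Hd H0]].
        { apply (R12_lim al be 0 b V); [lra | easy]. }
        exists d; split; [easy|]; intros x Hx _; specialize (H0 x Hx); lra.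
      - intros x Hx Hlt.
        assert (Htr : trapped x V).
        { intros y Hy; split; [now apply Hlt|].
          destruct (Rle_lt_dec (V iL2 y) (V iL1 y)) as [|h]; [easy|exfalso].
          apply HA; exists b, V, y.
          split; [lra | split; [exact HV | split; [lra | split; [|exact h]]]].
          intros z Hz; apply Hlt; lra. }
        assert (HVx : sol al be 0 x V) by (apply sol_restrict with b; [lra | easy]).
        destruct (density_exists al be 0 x V ltac:(lra) HVx) as [P HP].
        assert (V iR1 x - 12 * be * V iR2 x <= 0).
        { apply (cont_le_left (fun x => V iR1 x - 12 * be * V iR2 x) 0 x); [lra | |].
          - contr ltac:(apply ode_cont, HO; lra).
          - intros y Hy; pose proof (rho_bound al be x V P Hal ltac:(lra) HVx Htr HP y Hy); lra. }
        pose proof (R2_pos al be 0 b V HV x ltac:(lra)); nra.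
      - intros x Hx Hle; specialize (Hle x ltac:(lra)).
        destruct (pos_near (fun r => V iR2 r - V iR1 r) x) as [d [Hd H0]]; [| lra |].
        + contr ltac:(apply ode_cont, HO; lra).
        + exists d; split; [easy|]; intros y Hy _; specialize (H0 y); rewrite Rabs_right in H0; lra. }
    specialize (H12 r ltac:(lra)); lra. }
  destruct (trapped_exists T al be 0 U HT ltac:(lra) ltac:(lra) (Rle_refl 0) HU HA HB) as [W HW].
  set (B := 1 + 2 / ((W iR2 1 / 7) ^ 2 * (W iR1 1 / W iR2 1) / 2)).
  set (b := Rmax B 1 + 1).
  pose proof (Rmax_l B 1); pose proof (Rmax_r B 1).
  destruct (HW b ltac:(unfold b; lra)) as [HWb Htr].
  destruct (density_exists al be 0 b W ltac:(unfold b; lra) HWb) as [P HP].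
  pose proof (small_beta_bounded al be b W P Hal ltac:(lra) HWb Htr HP ltac:(lra) ltac:(unfold b; lra)) as Hbd.
  fold B in Hbd; unfold b in Hbd; lra.
Qed.

(** * Ricci-flat solutions *)

Section RicciFlat.
Variables (be b : R) (U : ix -> R -> R) (P : R -> R).
Hypothesis b_pos : 0 < b.
Hypothesis be_pos : 0 < be.
Hypothesis HU : sol 0 be 0 b U.
Hypothesis HP : density b U P.
Hypothesis R12 : forall r, 0 < r < b -> U iR1 r < U iR2 r.

Let HO : forall r, 0 < r <= b -> ode U r := proj1 HU.

Let R1p := R1_pos 0 be 0 b U be_pos HU.
Let R2p := R2_pos 0 be 0 b U HU.
Let sym r (Hr : 0 < r <= b) := sol_symmetric 0 be b U r Hr HU.

Lemma flat_w r : 0 < r < b -> U ixi r = U iL1 r + 2 * U iL2 r.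
Proof.
  intros Hr; destruct (proj1 HP r) as [_ Hp]; [lra|].
  destruct (sym r ltac:(lra)) as [_ E].
  assert (L : lim0 (fun x => (U ixi x - U iL1 x - U iL2 x - U iL3 x) * P x) 0).
  { apply (lim0_P0 b U P HP _ 0); [|lra]; apply (sol_zc_lim 0 be 0 b U); [lra | easy]. }
  pose proof (weighted_incr b U P HP (fun r => U ixi r - U iL1 r - U iL2 r - U iL3 r)
    (fun _ => 2 * 0) 0 r Hr L (fun x Hx => w_derive 0 be 0 b U HU x ltac:(lra)) ltac:(intros; lra)).
  pose proof (weighted_decr b U P (fun r => U ixi r - U iL1 r - U iL2 r - U iL3 r)
    (fun _ => 2 * 0) 0 r HP Hr L (fun x Hx => w_derive 0 be 0 b U HU x ltac:(lra)) ltac:(intros; lra)).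
  cbv beta in *.
  assert (U ixi r - U iL1 r - U iL2 r - U iL3 r = 0); [|lra].
  apply (Rmult_eq_reg_r (P r)); lra.
Qed.

Lemma flat_constraint r : 0 < r < b ->
  2 * U iL1 r * U iL2 r = U iR1 r * U iR2 r - U iR1 r ^ 2 / 4 - U iL2 r ^ 2.
Proof.
  intros Hr; destruct (sym r ltac:(lra)) as [E1 E2].
  pose proof (proj1 (proj2 HU) r ltac:(lra)) as H; unfold energy in H.
  rewrite (flat_w r Hr), E1, E2 in H; lra.
Qed.

Lemma flat_L2_pos r : 0 < r < b -> 0 < U iL2 r.
Proof.
  intros Hr; destruct (proj1 HP r) as [_ Hp]; [lra|].
  assert (H : 0 <= U iL2 r * P r).
  { apply (weighted_incr b U P HP (U iL2) (fun r => U iR1 r * (U iR2 r - U iR1 r / 2))); [easy | | |].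
    - apply (lim0_P0 b U P HP _ 0); [|lra]; apply HU.
    - intros x Hx; destruct (sym x ltac:(lra)) as [E1 E2].
      eapply is_derive_cv; [apply (HO x); lra | cbn [G]; rewrite E1; field].
    - intros x Hx; pose proof (R12 x ltac:(lra)).
      pose proof (R1p x ltac:(lra)); apply Rmult_le_pos; lra. }
  pose proof (flat_constraint r Hr) as Hc.
  pose proof (R12 r Hr); pose proof (R1p r ltac:(lra)).
  destruct (total_order_T (U iL2 r) 0) as [[h|h]|h]; [nra | rewrite h in Hc; nra | easy].
Qed.

(** The constraint eliminates [R2] and [L1] drops out, which leaves a Riccati equation for L2 / R1
    with equilibria 1/2 and - 1/2, up to the time change of speed [R1]. *)
Lemma flat_kappa_derive r : 0 < r < b ->
  is_derive (fun r => U iL2 r / U iR1 r) r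
    (U iR1 r * ((U iL2 r / U iR1 r) ^ 2 - 1 / 4)).
Proof.
  intros Hr; destruct (sym r ltac:(lra)) as [E1 E2].
  pose proof (R1p r ltac:(lra)).
  pose proof (flat_constraint r Hr) as Hc; pose proof (flat_w r Hr) as Hw.
  getode (HO r ltac:(lra)); derive_as; [lra|].
  rewrite E1, E2, Hw.
  replace (U iR2 r) with ((2 * U iL1 r * U iL2 r + U iR1 r ^ 2 / 4 + U iL2 r ^ 2) / U iR1 r)
    by (rewrite Hc; field; lra).
  field; lra.
Qed.

Lemma flat_kappa_lim : lim0 (fun r => U iL2 r / U iR1 r) (1 / 4).
Proof.
  destruct (proj2 (proj2 HU)) as [l0 [_ [l2 [_ [l4 [l5 _]]]]]].
  assert (L5 : lim0 (fun x => (U iR2 x - 1 / (2 * x)) * x + 1 / 2) (1 / 2)).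
  { eapply lim0_eq; [exact (lim0_plus _ _ _ _ (lim0_mult _ _ _ _ l5 lim0_id) (lim0_const (1 / 2))) | ring]. }
  assert (L4 : lim0 (fun x => U iR1 x / x * x) 0).
  { eapply lim0_eq; [exact (lim0_mult _ _ _ _ l4 lim0_id) | ring]. }
  (* The factor r cancels the pole of xi: (r L2)' is r times a function tending to be / 2, the limit
     of R1 R2. *)
  assert (H : lim0 (fun r => r * U iL2 r / r ^ 2) (be / 2 / 2)).
  { apply (lim0_quadratic _ (fun r => - (U ixi r - 1 / r) * U iL2 r
      + (U iR1 r / r * ((U iR2 r - 1 / (2 * r)) * r + 1 / 2) - U iR1 r / r * r * (U iR1 r / r * r) * / 2)) _ b b_pos).
    - eapply lim0_eq; [exact (lim0_mult _ _ _ _ lim0_id l2) | ring].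
    - intros x Hx; destruct (sym x ltac:(lra)) as [E1 E2].
      getode (HO x ltac:(lra)); derive_as; rewrite E1; field; lra.
    - eapply lim0_eq; [exact (lim0_plus _ _ _ _ (lim0_mult _ _ _ _ (lim0_opp _ _ l0) l2)
        (lim0_minus _ _ _ _ (lim0_mult _ _ _ _ l4 L5)
          (lim0_mult _ _ _ _ (lim0_mult _ _ _ _ L4 L4) (lim0_const (/ 2))))) | field]. }
  assert (L : lim0 (fun x => / (U iR1 x / x)) (/ be)).
  { eapply (filterlim_comp _ _ _ _ Rinv _ (locally be)); [exact l4|].
    apply (filterlim_Rbar_inv be); injection; lra. }
  apply (lim0_ext (fun r => r * U iL2 r / r ^ 2 * / (U iR1 r / r)) _ b); [lra | |].
  - intros x Hx; pose proof (R1p x ltac:(lra)); field; lra.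
  - eapply lim0_eq; [exact (lim0_mult _ _ _ _ H L) | field; lra].
Qed.

Lemma flat_kappa r : 0 < r < b -> 4 * U iL2 r <= U iR1 r.
Proof.
  intros Hr.
  assert (K0 : forall x, 0 < x < b -> 0 < U iL2 x / U iR1 x).
  { intros x Hx; apply Rdiv_lt_0_compat; [now apply flat_L2_pos|].
    apply (R1p); lra. }
  assert (K1 : forall x, 0 < x <= r -> 0 < 1 / 2 - U iL2 x / U iR1 x).
  { apply (pos_from0 (fun x => 1 / 2 - U iL2 x / U iR1 x)
      (fun x => - (U iR1 x * ((U iL2 x / U iR1 x) ^ 2 - 1 / 4)))
      (fun x => U iL2 x + U iR1 x * (1 / 2))).
    - apply (lim0_pos _ (1 / 2 - 1 / 4)); [|lra].
      exact (lim0_minus _ _ _ _ (lim0_const (1 / 2)) flat_kappa_lim).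
    - intros x Hx; pose proof (flat_kappa_derive x ltac:(lra)) as Hd.
      eapply is_derive_cv; [apply dminus; [apply dconst | exact Hd] | ring].
    - intros x Hx; contr ltac:(apply ode_cont, HO; lra).
    - intros x Hx; pose proof (R1p x ltac:(lra)).
      right; field; lra. }
  assert (H : - (1 / 4) <= - (U iL2 r / U iR1 r)).
  { apply (incr_from0 (fun x => - (U iL2 x / U iR1 x))
      (fun x => - (U iR1 x * ((U iL2 x / U iR1 x) ^ 2 - 1 / 4))) (- (1 / 4)) r); [| | |lra].
    - exact (lim0_opp _ _ flat_kappa_lim).
    - intros x Hx; apply dopp, flat_kappa_derive; lra.
    - intros x Hx; pose proof (R1p x ltac:(lra)).
      specialize (K0 x ltac:(lra)); specialize (K1 x Hx).
      set (k := U iL2 x / U iR1 x) in *.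
      assert (0 <= U iR1 x * (1 / 4 - k ^ 2)); [|lra].
      apply Rmult_le_pos; [lra | nra]. }
  pose proof (R1p r ltac:(lra)).
  assert (U iL2 r / U iR1 r * U iR1 r = U iL2 r) by (field; lra); nra.
Qed.

Lemma flat_gap r : 0 < r < b -> U iR2 r <= U iL1 r - U iL2 r.
Proof.
  intros Hr; pose proof (flat_kappa r Hr); pose proof (flat_L2_pos r Hr).
  pose proof (flat_constraint r Hr); pose proof (R12 r Hr).
  pose proof (R1p r ltac:(lra)).
  (* With L2 <= R1 / 4 and R1 < R2, the constraint gives 2 L1 L2 >= R1 R2 (1 - 1/4 - 1/16), and
     11/16 divided by 2 * 1/4 is 11/8; the gap 9/8 R2 then exceeds R2. *)
  assert (11 / 8 * U iR2 r <= U iL1 r); [|lra].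
  destruct (Rle_lt_dec (11 / 8 * U iR2 r) (U iL1 r)) as [|h]; [easy|exfalso].
  assert (2 * U iL1 r * U iL2 r < 2 * (11 / 8 * U iR2 r) * U iL2 r) by nra.
  assert (U iR2 r * U iL2 r <= U iR2 r * (U iR1 r / 4)) by (apply Rmult_le_compat_l; lra).
  assert (U iL2 r ^ 2 <= U iR1 r ^ 2 / 16) by nra.
  assert (U iR1 r ^ 2 <= U iR1 r * U iR2 r) by nra.
  lra.
Qed.

(** After use of the constraint, the derivative of - L1 / R2 has the numerator R1 R2 - 3/4 R1^2 -
    L2^2, which is nonnegative since R1 < R2 and 4 L2 <= R1. *)
Lemma flat_L1_ratio r : 1 <= r < b -> U iL1 r / U iR2 r <= U iL1 1 / U iR2 1.
Proof.
  intros Hr; assert (- (U iL1 1 / U iR2 1) <= - (U iL1 r / U iR2 r)); [|lra].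
  apply (incr_on (fun r => - (U iL1 r / U iR2 r))
    (fun r => (U iR1 r * U iR2 r - 3 / 4 * U iR1 r ^ 2 - U iL2 r ^ 2) / U iR2 r)); [lra | |].
  - intros x Hx; destruct (sym x ltac:(lra)) as [E1 E2].
    pose proof (R2p x ltac:(lra)).
    pose proof (flat_constraint x ltac:(lra)) as Hc.
    getode (HO x ltac:(lra)); derive_as; [lra|].
    rewrite E1, E2, (flat_w x) by lra.
    replace (U iL2 x ^ 2) with (U iR1 x * U iR2 x - U iR1 x ^ 2 / 4 - 2 * U iL1 x * U iL2 x) by lra.
    field; lra.
  - intros x Hx; pose proof (flat_kappa x ltac:(lra)); pose proof (flat_L2_pos x ltac:(lra)).
    pose proof (R12 x ltac:(lra)); pose proof (R1p x ltac:(lra)).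
    apply Rdiv_le_0_compat; [nra | lra].
Qed.

(** (1 / R2)' = L1 / R2 is bounded, so 1 / R2 <= c r, and (ln (R1 / R2))' >= 2 R2 >= 2 / (c r) has a
    divergent integral. With q the value of R1 / R2 at 1, the stated time would give ln (R1 / R2) >=
    2 - ln q > 0. *)
Lemma flat_bounded c : 1 < b -> c = / U iR2 1 + U iL1 1 / U iR2 1 ->
  b <= exp (c * (1 - ln (U iR1 1 / U iR2 1))).
Proof.
  intros Hb Hc.
  set (q := U iR1 1 / U iR2 1).
  pose proof (R1p 1 ltac:(lra)) as h1.
  pose proof (R12 1 ltac:(lra)) as h12.
  pose proof (flat_gap 1 ltac:(lra)); pose proof (flat_L2_pos 1 ltac:(lra)).
  assert (Hi : 0 < / U iR2 1) by (apply Rinv_0_lt_compat; lra).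
  assert (Hx : 0 < U iL1 1 / U iR2 1) by (apply Rdiv_lt_0_compat; lra).
  assert (Hq : 0 < q < 1) by (split; [apply Rdiv_lt_0_compat; lra | apply Rlt_div_l; lra]).
  assert (Hlq : ln q < 0) by (rewrite <- ln_1; apply ln_increasing; lra).
  set (r := exp (c * (1 - ln q))).
  destruct (Rle_lt_dec b r) as [|Hlt]; [easy|exfalso].
  assert (Hr1 : 1 < r).
  { unfold r; rewrite <- exp_0 at 1; apply exp_increasing; apply Rmult_lt_0_compat; lra. }
  assert (HR : forall x, 1 <= x <= r -> / U iR2 x <= c * x).
  { intros x Hxr.
    assert (/ U iR2 x - U iL1 1 / U iR2 1 * x <= / U iR2 1 - U iL1 1 / U iR2 1 * 1); [|rewrite Hc; nra].
    assert (- (/ U iR2 1 - U iL1 1 / U iR2 1 * 1) <= - (/ U iR2 x - U iL1 1 / U iR2 1 * x)); [|lra].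
    apply (incr_on (fun x => - (/ U iR2 x - U iL1 1 / U iR2 1 * x))
      (fun x => U iL1 1 / U iR2 1 - U iL1 x / U iR2 x)); [lra | |].
    - intros y Hy; destruct (sym y ltac:(lra)) as [E1 E2].
      pose proof (R2p y ltac:(lra)).
      getode (HO y ltac:(lra)); derive_as; [lra|].
      rewrite E2; field; lra.
    - intros y Hy; pose proof (flat_L1_ratio y ltac:(lra)); lra. }
  assert (H2 : ln q - 2 / c * ln 1 <= ln (U iR1 r / U iR2 r) - 2 / c * ln r).
  { apply (incr_on (fun x => ln (U iR1 x / U iR2 x) - 2 / c * ln x)
      (fun x => 2 * (U iL1 x - U iL2 x) - 2 / c * (1 / x))); [lra | |].
    - intros x Hxr; pose proof (R2p x ltac:(lra)).
      pose proof (R1p x ltac:(lra)).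
      destruct (sym x ltac:(lra)) as [E1 E2].
      getode (HO x ltac:(lra)); derive_as;
        [apply Rdiv_lt_0_compat; lra | lra | lra |].
      rewrite E2; field; lra.
    - intros x Hxr; pose proof (flat_gap x ltac:(lra)); pose proof (HR x Hxr) as HRx.
      pose proof (R2p x ltac:(lra)) as hp.
      assert (1 / (c * x) <= U iR2 x).
      { apply Rle_div_l; [nra|].
        apply (Rmult_le_compat_l (U iR2 x)) in HRx; [|lra]; rewrite Rinv_r in HRx by lra; lra. }
      replace (2 / c * (1 / x)) with (2 * (1 / (c * x))) by (field; lra); lra. }
  rewrite ln_1 in H2; unfold r in H2 at 3; rewrite ln_exp in H2.
  replace (2 / c * (c * (1 - ln q))) with (2 * (1 - ln q)) in H2 by (field; lra).
  assert (Hneg : ln (U iR1 r / U iR2 r) < 0).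
  { pose proof (R12 r ltac:(lra)); pose proof (R1p r ltac:(lra)).
    rewrite <- ln_1; apply ln_increasing; [apply Rdiv_lt_0_compat; lra | apply Rlt_div_l; lra]. }
  lra.
Qed.

End RicciFlat.

(** [flat_gap] keeps L1 > L2 as long as R1 < R2, which rules out [crossed_down]; without
    [crossed_up] the solution would be trapped for ever, against [flat_bounded]. *)
Lemma crossed_up_flat T be U : 0 < T -> 0 < be -> sol 0 be 0 T U -> crossed_up T 0 be 0.
Proof.
  intros HT Hbe HU; apply NNPP; intros HB.
  assert (HA : ~ crossed_down T 0 be 0).
  { intros [b [V [r [HTb [HV [Hr [H12 HD]]]]]]].
    assert (HVr : sol 0 be 0 r V) by (apply sol_restrict with b; [lra | easy]).
    destruct (density_exists 0 be 0 r V ltac:(lra) HVr) as [P HP].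
    assert (V iL2 r - V iL1 r <= 0); [|lra].
    apply (cont_le_left (fun r => V iL2 r - V iL1 r) 0 r); [lra | |].
    - contr ltac:(apply ode_cont, (proj1 HV); lra).
    - intros x Hx.
      pose proof (flat_gap be r V P ltac:(lra) Hbe HVr HP ltac:(intros; apply H12; lra) x Hx).
      pose proof (R2_pos 0 be 0 r V HVr x ltac:(lra)); lra. }
  destruct (trapped_exists T 0 be 0 U HT (Rle_refl 0) Hbe (Rle_refl 0) HU HA HB) as [W HW].
  set (c := / W iR2 1 + W iL1 1 / W iR2 1).
  set (B := exp (c * (1 - ln (W iR1 1 / W iR2 1)))).
  set (b := Rmax B 1 + 1).
  pose proof (Rmax_l B 1); pose proof (Rmax_r B 1).
  assert (Hb : 1 < b /\ B < b) by (unfold b; lra); clearbody b.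
  destruct (HW b ltac:(lra)) as [HWb Htr].
  destruct (density_exists 0 be 0 b W ltac:(lra) HWb) as [P HP].
  pose proof (flat_bounded be b W P ltac:(lra) Hbe HWb HP ltac:(intros; apply Htr; lra) c ltac:(lra) eq_refl) as Hbd.
  fold B in Hbd; lra.
Qed.

(** * Shooting *)

(** Near 0 the gap is large because R2 blows up, and the rest of (0, r] is compact. A uniform gap
    makes the strict inequality stable up to the singular orbit. *)
Lemma R12_gap al be ga b U r : 0 < r <= b -> sol al be ga b U ->
  (forall x, 0 < x <= r -> U iR1 x < U iR2 x) ->
  exists m, 0 < m /\ forall x, 0 < x <= r -> m <= U iR2 x - U iR1 x.
Proof.
  intros Hr HU H.
  destruct (large_near0 (fun r => U iR2 r - U iR1 r - 1) (ga - 1)) as [d [Hd Hn]].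
  { apply (lim0_ext (fun r => (U iR2 r - U iR1 r) - 1 / (2 * r) - 1) _ b); [lra | intros; ring |].
    exact (lim0_minus _ _ _ _ (R12_lim al be ga b U ltac:(lra) HU) (lim0_const 1)). }
  set (a := Rmin (d / 2) r).
  assert (Ha : 0 < a) by (apply Rmin_pos; lra).
  assert (Had : a <= d / 2) by apply Rmin_l; assert (Har : a <= r) by apply Rmin_r.
  destruct (continuity_ab_min (fun x => U iR2 x - U iR1 x) a r Har) as [y [Hy Hy']].
  { intros x Hx; apply continuity_pt_filterlim.
    apply (cminus (U iR2) (U iR1)); apply ode_cont, (proj1 HU); lra. }
  exists (Rmin 1 (U iR2 y - U iR1 y)); split.
  - apply Rmin_pos; [lra|]; specialize (H y ltac:(lra)); lra.
  - intros x Hx; destruct (Rle_lt_dec a x) as [h|h].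
    + eapply Rle_trans; [apply Rmin_r | apply Hy; lra].
    + eapply Rle_trans; [apply Rmin_l|]; specialize (Hn x ltac:(lra)); lra.
Qed.

(** Openness is relative to the parameters that possess a solution up to [T]; existence is given on
    the unit sphere only. *)
Definition open_at (T : R) (Q : R -> R -> R -> Prop) (al be ga : R) :=
  exists d, 0 < d /\ forall al' be' ga',
    Rabs (al' - al) <= d -> Rabs (be' - be) <= d -> Rabs (ga' - ga) <= d ->
    (exists W, sol al' be' ga' T W) -> Q al' be' ga'.

Lemma crossed_down_open T al be ga :
  0 < T -> crossed_down T al be ga -> open_at T (crossed_down T) al be ga.
Proof.
  intros HT [b [U [r [HTb [HU [Hr [H12 HD]]]]]]].
  destruct (R12_gap al be ga b U r Hr HU H12) as [m [Hm Hgap]].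
  set (e := Rmin (m / 3) ((U iL2 r - U iL1 r) / 3)).
  assert (He : 0 < e) by (apply Rmin_pos; lra).
  assert (He1 : e <= m / 3) by apply Rmin_l.
  assert (He2 : e <= (U iL2 r - U iL1 r) / 3) by apply Rmin_r.
  destruct (sol_perturb al be ga T b U e ltac:(lra) He HU) as [d [Hd H]].
  exists d; split; [easy|]; intros al' be' ga' Ha Hbe Hg [W HW].
  destruct (H al' be' ga' W Ha Hbe Hg HW) as [V [HV Hcl]].
  exists b, V, r; split; [easy | split; [exact HV | split; [easy | split]]].
  - intros x Hx; specialize (Hgap x Hx).
    pose proof (Hcl x iR1 ltac:(lra)) as h1; pose proof (Hcl x iR2 ltac:(lra)) as h2.
    apply Rabs_le_between in h1; apply Rabs_le_between in h2; lra.
  - pose proof (Hcl r iL1 ltac:(lra)) as h1; pose proof (Hcl r iL2 ltac:(lra)) as h2.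
    apply Rabs_le_between in h1; apply Rabs_le_between in h2; lra.
Qed.

Lemma crossed_up_open T al be ga :
  0 < T -> crossed_up T al be ga -> open_at T (crossed_up T) al be ga.
Proof.
  intros HT [b [U [r [HTb [HU [Hr H12]]]]]].
  set (e := (U iR1 r - U iR2 r) / 3).
  assert (He : 0 < e) by (unfold e; lra).
  destruct (sol_perturb al be ga T b U e ltac:(lra) He HU) as [d [Hd H]].
  exists d; split; [easy|]; intros al' be' ga' Ha Hbe Hg [W HW].
  destruct (H al' be' ga' W Ha Hbe Hg HW) as [V [HV Hcl]].
  exists b, V, r; split; [easy | split; [exact HV | split; [easy |]]].
  pose proof (Hcl r iR1 ltac:(lra)) as h1; pose proof (Hcl r iR2 ltac:(lra)) as h2.
  apply Rabs_le_between in h1; apply Rabs_le_between in h2; unfold e in *; lra.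
Qed.

(** By uniqueness both witnesses belong to one solution. R1 > R2 cannot occur up to the time r of
    the first witness, nor later by [absorbing]. *)
Lemma crossed_disjoint T al be ga :
  0 < be -> 0 <= ga -> crossed_down T al be ga -> crossed_up T al be ga -> False.
Proof.
  intros Hbe Hga [b [U [r [HTb [HU [Hr [H12 HD]]]]]]] [b' [V [r' [HTb' [HV [Hr' H']]]]]].
  destruct (Rle_lt_dec r' r) as [h|h].
  - assert (E : forall i, U i r' = V i r').
    { intros i; apply (sol_unique al be ga r'); [lra | | | lra];
      [apply sol_restrict with b | apply sol_restrict with b']; try easy; lra. }
    specialize (H12 r' ltac:(lra)); rewrite !E in H12; lra.
  - assert (E : forall i x, 0 < x <= r -> U i x = V i x).
    { intros i; apply (sol_unique al be ga r); [lra | |];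
      [apply sol_restrict with b | apply sol_restrict with b']; try easy; lra. }
    destruct (absorbing al be ga b' V r Hbe Hga HV ltac:(lra)) with (r := r') as [h1 _]; [| | lra | lra].
    + intros x Hx; rewrite <- !E by lra; now apply H12.
    + rewrite <- !E by lra; easy.
Qed.

(** Connectedness of [0, a]: the supremum of [B] belongs to neither of two disjoint relatively open
    sets. *)
Lemma shooting (A B : R -> Prop) a :
  0 < a -> B 0 -> A a ->
  (forall s, 0 <= s <= a -> A s -> B s -> False) ->
  (forall s, 0 <= s <= a -> A s -> exists d, 0 < d /\ forall x, 0 <= x <= a -> Rabs (x - s) < d -> A x) ->
  (forall s, 0 <= s <= a -> B s -> exists d, 0 < d /\ forall x, 0 <= x <= a -> Rabs (x - s) < d -> B x) ->
  exists s, 0 < s <= a /\ ~ A s /\ ~ B s.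
Proof.
  intros Ha HB0 HAa Hdis HA HB.
  destruct (completeness (fun s => 0 <= s <= a /\ B s)) as [s [Hub Hlub]].
  - exists a; intros x [Hx _]; lra.
  - exists 0; split; [lra | easy].
  - assert (Hs : 0 <= s <= a).
    { split; [apply Hub; split; [lra | easy] | apply Hlub; intros x [Hx _]; lra]. }
    assert (HnB : ~ B s).
    { intros HBs; destruct (HB s Hs HBs) as [d [Hd H]].
      destruct (Req_dec s a) as [->|Hne]; [now apply (Hdis a)|].
      assert (Hm : 0 < Rmin (d / 2) (a - s)) by (apply Rmin_pos; lra).
      pose proof (Rmin_l (d / 2) (a - s)); pose proof (Rmin_r (d / 2) (a - s)).
      assert (s + Rmin (d / 2) (a - s) <= s); [|lra].
      apply Hub; split; [lra|]; apply H; [lra|]; rewrite Rabs_right; lra. }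
    exists s; split; [|split; [|easy]].
    + split; [|lra]; destruct (proj1 Hs) as [h|h]; [easy|]; subst s; contradiction.
    + intros HAs; destruct (HA s Hs HAs) as [d [Hd H]].
      assert (Hle : s <= s - d / 2); [|lra].
      apply Hlub; intros x [Hx HBx].
      destruct (Rle_lt_dec x (s - d / 2)) as [|h]; [easy|exfalso].
      assert (x <= s) by (apply Hub; easy).
      apply (Hdis x Hx); [|easy]; apply H; [easy|]; rewrite Rabs_left1; lra.
Qed.

Definition beta (ga al : R) := sqrt (1 - ga ^ 2 - al ^ 2).

Lemma beta_cont ga al e : 0 < 1 - ga ^ 2 - al ^ 2 -> 0 < e ->
  exists d, 0 < d /\ forall ga' al', Rabs (ga' - ga) < d -> Rabs (al' - al) < d ->
    Rabs (beta ga' al' - beta ga al) <= e.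
Proof.
  intros Hp He.
  assert (Hc : continuous sqrt (1 - ga ^ 2 - al ^ 2)).
  { apply continuity_pt_filterlim, continuity_pt_sqrt; lra. }
  destruct (cont_eps _ _ Hc e He) as [d [Hd H]].
  set (k := 2 * (Rabs ga + Rabs al + 1)).
  assert (Hk : 0 < k) by (unfold k; pose proof (Rabs_pos ga); pose proof (Rabs_pos al); lra).
  exists (Rmin 1 (d / (2 * k))); split.
  - apply Rmin_pos; [lra|]; apply Rdiv_lt_0_compat; lra.
  - assert (Hsq : forall x y, Rabs (x - y) < Rmin 1 (d / (2 * k)) -> 2 * (Rabs y + 1) <= k ->
      Rabs (x ^ 2 - y ^ 2) < d / 2).
    { intros x y Hxy Hyk.
      assert (h1 : Rabs (x - y) < 1) by (eapply Rlt_le_trans; [exact Hxy | apply Rmin_l]).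
      assert (h2 : Rabs (x - y) < d / (2 * k)) by (eapply Rlt_le_trans; [exact Hxy | apply Rmin_r]).
      replace (x ^ 2 - y ^ 2) with ((x - y) * (x - y + 2 * y)) by ring; rewrite Rabs_mult.
      assert (h3 : Rabs (x - y + 2 * y) <= k).
      { eapply Rle_trans; [apply Rabs_triang|]; rewrite Rabs_mult, (Rabs_right 2) by lra; lra. }
      apply Rle_lt_trans with (Rabs (x - y) * k).
      - apply Rmult_le_compat_l; [apply Rabs_pos | easy].
      - apply (Rmult_lt_compat_r k) in h2; [|easy].
        replace (d / (2 * k) * k) with (d / 2) in h2 by (field; lra); lra. }
    intros ga' al' Hg Hal; left; apply H.
    apply Hsq in Hg; [|unfold k; pose proof (Rabs_pos al); lra].
    apply Hsq in Hal; [|unfold k; pose proof (Rabs_pos ga); lra].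
    apply Rabs_def2 in Hg; apply Rabs_def2 in Hal; apply Rabs_def1; lra.
Qed.

Lemma open_curve T Q ga al : 0 < 1 - ga ^ 2 - al ^ 2 -> open_at T Q al (beta ga al) ga ->
  exists d, 0 < d /\ forall ga' al', Rabs (ga' - ga) < d -> Rabs (al' - al) < d ->
    (exists W, sol al' (beta ga' al') ga' T W) -> Q al' (beta ga' al') ga'.
Proof.
  intros Hp [d [Hd H]]; destruct (beta_cont ga al d Hp Hd) as [d' [Hd' H']].
  exists (Rmin d d'); split; [now apply Rmin_pos|]; intros ga' al' Hg Ha HW.
  pose proof (Rmin_l d d'); pose proof (Rmin_r d d').
  apply H; [lra | apply H'; lra | lra | easy].
Qed.

Lemma beta_sphere ga al : 0 <= 1 - ga ^ 2 - al ^ 2 -> al ^ 2 + beta ga al ^ 2 + ga ^ 2 = 1.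
Proof. intros H; unfold beta; rewrite pow2_sqrt; lra. Qed.

(** The end of the arc, where [be] equals 1/100 at [ga = 0], the threshold of the small-beta
    analysis. *)
Definition al_top := sqrt (1 - (1 / 100) ^ 2).

Lemma al_top_sq : al_top ^ 2 = 1 - (1 / 100) ^ 2.
Proof. unfold al_top; apply pow2_sqrt; lra. Qed.

Lemma al_top_ge : 1 / 2 <= al_top.
Proof.
  unfold al_top; apply Rsqr_incr_0_var; [|apply sqrt_pos].
  rewrite Rsqr_sqrt by lra; unfold Rsqr; lra.
Qed.

Lemma trapped_parameters T :
  0 < T ->
  (forall al be ga, al ^ 2 + be ^ 2 + ga ^ 2 = 1 -> exists U, sol al be ga T U) ->
  exists g, 0 < g /\ forall ga, 0 <= ga < g -> exists al be,
    0 < al /\ 0 < be /\ al ^ 2 + be ^ 2 + ga ^ 2 = 1 /\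
    exists W, forall b, 0 < b -> sol al be ga b W /\ trapped b W.
Proof.
  intros HT Hex.
  pose proof al_top_sq as Htop; pose proof al_top_ge as Hge.
  assert (E0 : beta 0 0 = 1) by (unfold beta; replace (1 - 0 ^ 2 - 0 ^ 2) with 1 by ring; apply sqrt_1).
  assert (E1 : beta 0 al_top = 1 / 100).
  { unfold beta; rewrite Htop; replace (1 - 0 ^ 2 - (1 - (1 / 100) ^ 2)) with ((1 / 100) ^ 2) by ring.
    apply sqrt_pow2; lra. }
  destruct (open_curve T (crossed_up T) 0 0) as [d0 [Hd0 H0]]; [lra | |].
  { apply crossed_up_open; [easy|]; rewrite E0.
    destruct (Hex 0 1 0) as [U HU]; [ring|]; apply (crossed_up_flat T 1 U); lra || easy. }
  destruct (open_curve T (crossed_down T) 0 al_top) as [d1 [Hd1 H1]]; [rewrite Htop; lra | |].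
  { apply crossed_down_open; [easy|]; rewrite E1.
    destruct (Hex al_top (1 / 100) 0) as [U HU]; [rewrite Htop; lra|].
    apply (crossed_down_small T al_top (1 / 100) U); lra || easy. }
  (* The bound 1/200 < 1/100 keeps [beta] positive on the whole arc; d0 and d1 carry the events at
     its two ends from 0 to ga. *)
  exists (Rmin (1 / 200) (Rmin d0 d1)); split; [repeat apply Rmin_pos; lra|].
  intros ga Hga.
  assert (Hg : ga < 1 / 200 /\ ga < d0 /\ ga < d1).
  { pose proof (Rmin_l (1 / 200) (Rmin d0 d1)); pose proof (Rmin_r (1 / 200) (Rmin d0 d1)).
    pose proof (Rmin_l d0 d1); pose proof (Rmin_r d0 d1); lra. }
  assert (Hpos : forall al, 0 <= al <= al_top -> 0 < 1 - ga ^ 2 - al ^ 2).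
  { intros al Hal; assert (al ^ 2 <= al_top ^ 2) by (apply pow_incr; lra).
    assert (ga ^ 2 <= (1 / 200) ^ 2) by (apply pow_incr; lra); lra. }
  assert (Hsol : forall al, 0 <= al <= al_top -> exists W, sol al (beta ga al) ga T W).
  { intros al Hal; apply Hex, beta_sphere; left; now apply Hpos. }
  assert (Hb : forall al, 0 <= al <= al_top -> 0 < beta ga al) by (intros; now apply sqrt_lt_R0, Hpos).
  assert (Hga0 : Rabs (ga - 0) = ga) by (rewrite Rminus_0_r, Rabs_right; lra).
  destruct (shooting (fun al => crossed_down T al (beta ga al) ga)
    (fun al => crossed_up T al (beta ga al) ga) al_top) as [al [Hal [HA HB]]].
  - lra.
  - apply H0; [lra | rewrite Rminus_diag, Rabs_R0; lra | apply Hsol; lra].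
  - apply H1; [lra | rewrite Rminus_diag, Rabs_R0; lra | apply Hsol; lra].
  - intros s Hs; apply crossed_disjoint; [now apply Hb | lra].
  - intros s Hs HAs; destruct (open_curve T (crossed_down T) ga s (Hpos s Hs)) as [d [Hd H]].
    + now apply crossed_down_open.
    + exists d; split; [easy|]; intros x Hx Hxs; apply H; [rewrite Rminus_diag, Rabs_R0 | |]; auto.
  - intros s Hs HBs; destruct (open_curve T (crossed_up T) ga s (Hpos s Hs)) as [d [Hd H]].
    + now apply crossed_up_open.
    + exists d; split; [easy|]; intros x Hx Hxs; apply H; [rewrite Rminus_diag, Rabs_R0 | |]; auto.
  - exists al, (beta ga al); split; [lra|]; split; [apply Hb; lra|]; split.
    + apply beta_sphere; left; apply Hpos; lra.
    + destruct (Hsol al ltac:(lra)) as [U HU].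
      apply (trapped_exists T al (beta ga al) ga U HT ltac:(lra) (Hb al ltac:(lra)) ltac:(lra) HU HA HB).
Qed.

(** * Asymptotics of trapped solutions *)

Definition limi (f : R -> R) (l : R) := is_lim f p_infty l.

Lemma limi_eps f l : limi f l <-> forall e, 0 < e -> exists M, forall r, M < r -> Rabs (f r - l) < e.
Proof.
  unfold limi; split.
  - intros H e He; apply is_lim_spec in H; exact (H (mkposreal e He)).
  - intros H; apply is_lim_spec; intros e; apply (H e (cond_pos e)).
Qed.

Lemma limi_plus f g a b : limi f a -> limi g b -> limi (fun r => f r + g r) (a + b).
Proof. intros Hf Hg; eapply filterlim_comp_2; [exact Hf | exact Hg | apply (filterlim_plus a b)]. Qed.

Lemma limi_mult f g a b : limi f a -> limi g b -> limi (fun r => f r * g r) (a * b).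
Proof. intros Hf Hg; eapply filterlim_comp_2; [exact Hf | exact Hg | apply (filterlim_mult a b)]. Qed.

Lemma limi_const c : limi (fun _ => c) c.
Proof. apply filterlim_const. Qed.

Lemma limi_opp f a : limi f a -> limi (fun r => - f r) (- a).
Proof. intros Hf; eapply filterlim_comp; [exact Hf | apply (filterlim_opp a)]. Qed.

Lemma limi_minus f g a b : limi f a -> limi g b -> limi (fun r => f r - g r) (a - b).
Proof. intros; apply limi_plus; [easy | now apply limi_opp]. Qed.

Lemma limi_inv f a : a <> 0 -> limi f a -> limi (fun r => / f r) (/ a).
Proof.
  intros Ha Hf; apply (filterlim_comp _ _ _ f Rinv _ (locally a)); [exact Hf|].
  apply (filterlim_Rbar_inv a); injection; easy.
Qed.

Lemma limi_ext (f g : R -> R) a l : (forall r, a < r -> f r = g r) -> limi f l -> limi g l.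
Proof. intros H; apply is_lim_ext_loc; exists a; exact H. Qed.

Lemma limi_eq f a b : limi f a -> a = b -> limi f b.
Proof. now intros H <-. Qed.

Lemma limi_decr (f : R -> R) a c :
  (forall x y, a <= x <= y -> f y <= f x) -> (forall x, a <= x -> c <= f x) ->
  exists l, limi f l /\ c <= l /\ forall x, a <= x -> l <= f x.
Proof.
  intros Hd Hc.
  destruct (completeness (fun y => exists x, a <= x /\ y = - f x)) as [s [Hub Hlub]].
  - exists (- c); intros y [x [Hx ->]]; specialize (Hc x Hx); lra.
  - exists (- f a), a; split; [lra | easy].
  - assert (Hge : forall x, a <= x -> - s <= f x).
    { intros x Hx; assert (- f x <= s) by (apply Hub; now exists x); lra. }
    exists (- s); split; [|split; [|exact Hge]].
    + apply limi_eps; intros e He.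
      destruct (classic (exists x, a <= x /\ f x < - s + e)) as [[x [Hx Hfx]]|Hn].
      * exists x; intros r Hr; specialize (Hd x r ltac:(lra)); specialize (Hge r ltac:(lra)).
        rewrite Rabs_right; lra.
      * exfalso; assert (s <= s - e); [|lra]; apply Hlub; intros y [x [Hx ->]].
        destruct (Rle_lt_dec (- s + e) (f x)) as [|h]; [lra|exfalso; apply Hn; now exists x].
    + assert (s <= - c); [|lra]; apply Hlub; intros y [x [Hx ->]]; specialize (Hc x Hx); lra.
Qed.

(* Barbalat's lemma for [F]. *)
Lemma limi_integrable (F f f' : R -> R) a l K :
  (forall x, a <= x -> is_derive F x (- f x)) -> (forall x, a <= x -> is_derive f x (f' x)) ->
  (forall x, a <= x -> 0 <= f x) -> (forall x, a <= x -> Rabs (f' x) <= K) -> limi F l -> limi f 0.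
Proof.
  intros HF Hf H0 HK HL; apply limi_eps; intros e He.
  assert (HKp : 0 <= K) by (eapply Rle_trans; [apply Rabs_pos | apply (HK a); lra]).
  set (h := e / (2 * (K + 1))).
  assert (Hh : 0 < h) by (apply Rdiv_lt_0_compat; lra).
  assert (HKh : K * h <= e / 2).
  { unfold h; apply Rle_trans with ((K + 1) * (e / (2 * (K + 1)))); [|right; field; lra].
    apply Rmult_le_compat_r; [unfold h in Hh; lra | lra]. }
  destruct (proj1 (limi_eps F l) HL (e / 2 * h / 2)) as [M HM]; [nra|].
  exists (Rmax M a); intros r Hr.
  assert (Ha : a <= r) by (pose proof (Rmax_r M a); lra).
  assert (HMr : M < r) by (pose proof (Rmax_l M a); lra).
  rewrite Rminus_0_r, Rabs_right by (specialize (H0 r Ha); lra).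
  destruct (Rlt_le_dec (f r) e) as [|Hge]; [easy|exfalso].
  assert (Hlow : forall x, r <= x <= r + h -> e / 2 <= f x).
  { intros x Hx; assert (f r + K * r <= f x + K * x); [|nra].
    apply (incr_on (fun x => f x + K * x) (fun x => f' x + K)); [lra | |].
    - intros y Hy; specialize (Hf y ltac:(lra)); derive_as; ring.
    - intros y Hy; specialize (HK y ltac:(lra)); apply Rabs_le_between in HK; lra. }
  assert (Hdrop : - F r - e / 2 * r <= - F (r + h) - e / 2 * (r + h)).
  { apply (incr_on (fun x => - F x - e / 2 * x) (fun x => f x - e / 2)); [lra | |].
    - intros y Hy; specialize (HF y ltac:(lra)); derive_as; field.
    - intros y Hy; specialize (Hlow y Hy); lra. }
  pose proof (HM r HMr) as h1; pose proof (HM (r + h) ltac:(lra)) as h2.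
  apply Rabs_def2 in h1; apply Rabs_def2 in h2; lra.
Qed.

Lemma limi_derive_0 (f f' : R -> R) a c l :
  (forall x, a <= x -> is_derive f x (f' x)) -> limi f l -> limi f' c -> c = 0.
Proof.
  intros Hd Hf Hf'.
  assert (H : forall e, 0 < e -> Rabs c <= e).
  { intros e He.
    destruct (proj1 (limi_eps f l) Hf (e / 4)) as [M1 H1]; [lra|].
    destruct (proj1 (limi_eps f' c) Hf' (e / 4)) as [M2 H2]; [lra|].
    set (r := Rmax a (Rmax M1 M2) + 1).
    pose proof (Rmax_l a (Rmax M1 M2)); pose proof (Rmax_r a (Rmax M1 M2)).
    pose proof (Rmax_l M1 M2); pose proof (Rmax_r M1 M2).
    assert (Hr : a < r /\ M1 < r /\ M2 < r) by (unfold r; lra).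
    destruct (MVT_gen f r (r + 1) f') as [x [Hx E]].
    - intros x; rewrite Rmin_left, Rmax_right by lra; intros; apply Hd; lra.
    - intros x; rewrite Rmin_left, Rmax_right by lra; intros.
      apply continuity_pt_filterlim, (is_derive_cont _ _ (f' x)), Hd; lra.
    - rewrite Rmin_left, Rmax_right in Hx by lra.
      pose proof (H1 r ltac:(lra)) as h1; pose proof (H1 (r + 1) ltac:(lra)) as h2.
      pose proof (H2 x ltac:(lra)) as h3.
      apply Rabs_def2 in h1; apply Rabs_def2 in h2; apply Rabs_def2 in h3; apply Rabs_le; lra. }
  destruct (Req_dec c 0) as [|h]; [easy|exfalso].
  apply Rabs_pos_lt in h; specialize (H (Rabs c / 2) ltac:(lra)); lra.
Qed.

Lemma limi_of_sq (f g : R -> R) a : limi g 0 -> (forall r, a <= r -> f r ^ 2 <= g r) -> limi f 0.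
Proof.
  intros Hg H; apply limi_eps; intros e He.
  destruct (proj1 (limi_eps g 0) Hg (e ^ 2)) as [M HM]; [now apply pow_lt|].
  exists (Rmax M a); intros r Hr; pose proof (Rmax_l M a); pose proof (Rmax_r M a).
  specialize (HM r ltac:(lra)); specialize (H r ltac:(lra)); rewrite Rminus_0_r in *.
  apply Rabs_def2 in HM; apply Rabs_def1; nra.
Qed.

Lemma limi_exp_decay c : 0 < c -> limi (fun r => exp (- (c * (r - 1)))) 0.
Proof.
  intros Hc; apply limi_eps; intros e He.
  exists (1 - ln e / c); intros r Hr.
  rewrite Rminus_0_r, Rabs_right by (left; apply exp_pos).
  rewrite <- (exp_ln e) at 1 by easy; apply exp_increasing.
  assert (- ln e / c < r - 1) by (unfold Rdiv in *; lra).
  apply (Rmult_lt_compat_r c) in H; [|easy].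
  replace (- ln e / c * c) with (- ln e) in H by (field; lra); lra.
Qed.

Section Limits.
Variables (al be ga : R) (U : ix -> R -> R).
Hypothesis al_pos : 0 < al.
Hypothesis be_pos : 0 < be.
Hypothesis ga_nonneg : 0 <= ga.
Hypothesis HU : forall b, 0 < b -> sol al be ga b U.
Hypothesis Htr : forall b, 0 < b -> trapped b U.

Lemma global_ode r : 0 < r -> ode U r.
Proof. intros Hr; apply (HU r); lra. Qed.

Lemma global_bounds r : 1 <= r ->
  0 < U ixi r <= U ixi 1 /\ - L3_const 1 U <= U iL3 r <= U iL2 r /\ 0 <= U iL2 r <= U iL1 r /\
  U iL1 r <= U ixi 1 + L3_const 1 U /\ 0 < U iR1 r < U iR2 r /\ 0 < U iR3 r <= U iR2 r.
Proof.
  intros Hr; pose proof (trapped_bounds al be ga (r + 1) U 1 r ltac:(lra) be_pos ga_nonneg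
    (HU (r + 1) ltac:(lra)) (Htr (r + 1) ltac:(lra)) ltac:(lra) ltac:(lra)); tauto.
Qed.

(** w P is strictly increasing as al > 0, so w(1) > 0. Since xi <= xi(1), w' >= - xi(1) w + 2 al
    keeps w above the smaller of w(1) and 2 al / xi(1); and xi > w because the trace is positive. *)
Lemma xi_lower : exists c, 0 < c /\ forall r, 1 <= r -> c <= U ixi r.
Proof.
  set (w := fun r => U ixi r - U iL1 r - U iL2 r - U iL3 r).
  assert (Hw1 : 0 < w 1).
  { destruct (density_exists al be ga 2 U ltac:(lra) (HU 2 ltac:(lra))) as [P HP].
    pose proof (trapped_w al be ga 2 U (HU 2 ltac:(lra)) P HP (1 / 2) ltac:(lra) ltac:(lra)) as H.
    fold (w (1 / 2)) in H.
    destruct (proj1 HP 1) as [_ HP1]; [lra|]; destruct (proj1 HP (1 / 2)) as [_ HP2]; [lra|].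
    assert (w (1 / 2) * P (1 / 2) < w 1 * P 1).
    { apply (strict_incr_on (fun r => w r * P r) (fun r => 2 * al * P r)); [lra | |].
      - intros x Hx; destruct (proj1 HP x) as [Hd _]; [lra|].
        pose proof (w_derive al be ga 2 U (HU 2 ltac:(lra)) x ltac:(lra)) as Hw; fold w in Hw.
        eapply is_derive_cv; [exact (dmult _ _ _ _ _ Hw Hd) | unfold w; ring].
      - intros x Hx; destruct (proj1 HP x) as [_ Hp]; [lra|]; nra. }
    assert (0 <= w (1 / 2) * P (1 / 2)) by (apply Rmult_le_pos; lra); nra. }
  destruct (global_bounds 1 ltac:(lra)) as [[Hx1 _] _].
  set (c := Rmin (w 1) (2 * al / U ixi 1)).
  assert (Hc : 0 < c) by (apply Rmin_pos; [easy | apply Rdiv_lt_0_compat; lra]).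
  assert (Hc1 : c <= w 1) by apply Rmin_l.
  assert (Hc2 : U ixi 1 * c <= 2 * al).
  { apply Rle_trans with (U ixi 1 * (2 * al / U ixi 1)); [|right; field; lra].
    apply Rmult_le_compat_l; [lra | apply Rmin_r]. }
  exists c; split; [easy|]; intros r Hr.
  assert (Hwr : 0 <= w r - c).
  { eapply Rle_trans; [|apply (gron_ge (fun r => w r - c) (fun r => - U ixi r * w r + 2 * al - 0)
      (fun _ => - U ixi 1) (fun r => - U ixi 1 * r) 1 r Hr)].
    - apply Rmult_le_pos; [lra | left; apply exp_pos].
    - intros x Hx; pose proof (w_derive al be ga x U (HU x ltac:(lra)) x ltac:(lra)) as Hw.
      fold w in Hw; exact (dminus _ _ _ _ _ Hw (dconst c x)).
    - intros x Hx; derive_as; ring.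
    - intros x Hx; destruct (global_bounds x ltac:(lra)) as [Hxi _].
      destruct (density_exists al be ga (x + 1) U ltac:(lra) (HU (x + 1) ltac:(lra))) as [P HP].
      pose proof (trapped_w al be ga (x + 1) U (HU (x + 1) ltac:(lra)) P HP x ltac:(lra) ltac:(lra)) as Hw.
      fold (w x) in Hw.
      assert (0 <= (U ixi 1 - U ixi x) * w x) by (apply Rmult_le_pos; lra); lra. }
  destruct (density_exists al be ga (r + 1) U ltac:(lra) (HU (r + 1) ltac:(lra))) as [P HP].
  pose proof (trapped_trace al be ga (r + 1) U be_pos ga_nonneg (HU (r + 1) ltac:(lra)) (Htr (r + 1) ltac:(lra)) P HP r ltac:(lra)).
  unfold w in Hwr; lra.
Qed.

(** L3 P is bounded below while [P] grows at least like exp(c r). *)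
Lemma L3_decay c r : 0 < c -> (forall r, 1 <= r -> c <= U ixi r) -> 1 <= r ->
  - L3_const 1 U * exp (- (c * (r - 1))) <= U iL3 r.
Proof.
  intros Hc Hxi Hr.
  destruct (density_exists al be ga (r + 1) U ltac:(lra) (HU (r + 1) ltac:(lra))) as [P HP].
  pose proof (trapped_L3_lower al be ga (r + 1) U P 1 r ltac:(lra) be_pos ga_nonneg
    (HU (r + 1) ltac:(lra)) (Htr (r + 1) ltac:(lra)) HP ltac:(lra) ltac:(lra)) as H.
  destruct (proj1 HP 1) as [_ HP1]; [lra|]; destruct (proj1 HP r) as [_ HPr]; [lra|].
  assert (Hg : P 1 * exp (c * r - c * 1) <= P r).
  { apply (gron_ge P (fun x => U ixi x * P x) (fun _ => c) (fun x => c * x) 1 r Hr).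
    - intros x Hx; apply HP; lra.
    - intros x Hx; derive_as; ring.
    - intros x Hx; destruct (proj1 HP x) as [_ Hp]; [lra|]; specialize (Hxi x ltac:(lra)); nra. }
  set (K := L3_const 1 U) in *; assert (HK : 0 <= K) by apply Rabs_pos.
  set (E := exp (- (c * (r - 1)))).
  assert (HE : 0 < E) by apply exp_pos.
  assert (HEE : exp (c * r - c * 1) * E = 1).
  { unfold E; rewrite <- exp_plus; replace (c * r - c * 1 + - (c * (r - 1))) with 0 by ring; apply exp_0. }
  assert (HPE : P 1 <= P r * E).
  { apply (Rmult_le_compat_r E) in Hg; [|lra]; rewrite Rmult_assoc, HEE in Hg; lra. }
  apply (Rmult_le_reg_r (P r)); [easy|].
  assert (K * P 1 <= K * (P r * E)) by (apply Rmult_le_compat_l; lra); lra.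
Qed.

Lemma trapped_limits : exists x a, 0 < x /\ (forall r, 1 <= r -> x <= U ixi r) /\ limi (U ixi) x /\
  limi (U iL1) 0 /\ limi (U iL2) 0 /\ limi (U iL3) 0 /\
  limi (U iR1) a /\ limi (U iR2) a /\ limi (U iR3) 0.
Proof.
  destruct xi_lower as [c [Hc Hxi]].
  destruct (limi_decr (U ixi) 1 c) as [x [Hx [Hcx Hxge]]]; [| easy |].
  { intros u v Huv; apply (trapped_xi_decr al be ga (v + 1) U (HU (v + 1) ltac:(lra))); lra. }
  set (K := L3_const 1 U); assert (HK : 0 <= K) by apply Rabs_pos.
  (* [E] compensates the negative part of [L3]: E' / E = - K exp(- c (r - 1)), so R2 E is
     nonincreasing, and E tends to 1. *)
  set (E := fun r => exp (K / c * exp (- (c * (r - 1))))).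
  assert (HE : limi E 1).
  { rewrite <- exp_0; unfold E.
    apply (filterlim_comp _ _ _ (fun r => K / c * exp (- (c * (r - 1)))) exp _ (locally 0)).
    - eapply limi_eq; [exact (limi_mult _ _ _ _ (limi_const (K / c)) (limi_exp_decay c Hc)) | ring].
    - eapply is_derive_cont, is_derive_exp. }
  assert (HEp : forall r, 0 < E r) by (intros; apply exp_pos).
  assert (Hdec : forall u v, 1 <= u <= v -> U iR2 v * E v <= U iR2 u * E u).
  { intros u v Huv; assert (- (U iR2 u * E u) <= - (U iR2 v * E v)); [|lra].
    apply (incr_on (fun r => - (U iR2 r * E r))
      (fun r => U iR2 r * E r * (U iL1 r - U iL2 r + U iL3 r + K * exp (- (c * (r - 1)))))); [lra | |].
    - intros r Hr; pose proof (global_ode r ltac:(lra)) as Ho.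
      unfold E; getode Ho; derive_as; field; lra.
    - intros r Hr; destruct (global_bounds r ltac:(lra)) as [_ [B3 [B2 [_ [B5 _]]]]].
      pose proof (L3_decay c r Hc Hxi ltac:(lra)) as H3; fold K in H3; specialize (HEp r).
      apply Rmult_le_pos; [apply Rmult_le_pos|]; lra. }
  destruct (limi_decr (fun r => U iR2 r * E r) 1 0 Hdec) as [h [Hh [Hh0 _]]].
  { intros r Hr; destruct (global_bounds r Hr) as [_ [_ [_ [_ [B5 _]]]]]; specialize (HEp r).
    apply Rmult_le_pos; lra. }
  assert (HR2 : limi (U iR2) h).
  { apply (limi_ext (fun r => U iR2 r * E r * / E r) _ 1).
    - intros r Hr; specialize (HEp r); field; lra.
    - eapply limi_eq; [exact (limi_mult _ _ _ _ Hh (limi_inv _ _ R1_neq_R0 HE)) | field]. }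
  destruct (limi_decr (fun r => - (U iR1 r / U iR2 r)) 1 (-1)) as [rho' [Hrho [Hrho1 Hrho0]]].
  { intros u v Huv; pose proof (ratio12_incr al be ga (v + 1) U be_pos ga_nonneg (HU (v + 1) ltac:(lra))
      (Htr (v + 1) ltac:(lra)) u v ltac:(lra) ltac:(lra)); lra. }
  { intros r Hr; destruct (global_bounds r Hr) as [_ [_ [_ [_ [B5 _]]]]].
    assert (U iR1 r / U iR2 r <= 1); [apply Rle_div_l; lra | lra]. }
  destruct (limi_decr (fun r => U iR3 r / U iR2 r) 1 0) as [sig [Hsig [Hsig0 Hsig1]]].
  { intros u v Huv; apply (ratio32_decr al be ga (v + 1) U be_pos ga_nonneg (HU (v + 1) ltac:(lra))
      (Htr (v + 1) ltac:(lra))); lra. }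
  { intros r Hr; destruct (global_bounds r Hr) as [_ [_ [_ [_ [B5 B6]]]]].
    apply Rdiv_le_0_compat; lra. }
  set (rho := - rho').
  assert (HR1 : limi (U iR1) (rho * h)).
  { apply (limi_ext (fun r => - - (U iR1 r / U iR2 r) * U iR2 r) _ 1).
    - intros r Hr; destruct (global_bounds r ltac:(lra)) as [_ [_ [_ [_ [B5 _]]]]]; field; lra.
    - exact (limi_mult _ _ _ _ (limi_opp _ _ Hrho) HR2). }
  assert (HR3 : limi (U iR3) (sig * h)).
  { apply (limi_ext (fun r => U iR3 r / U iR2 r * U iR2 r) _ 1).
    - intros r Hr; destruct (global_bounds r ltac:(lra)) as [_ [_ [_ [_ [B5 _]]]]]; field; lra.
    - exact (limi_mult _ _ _ _ Hsig HR2). }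
  destruct (global_bounds 1 (Rle_refl 1)) as [B0 [_ [_ [_ [B5 B6]]]]].
  assert (Hrho_pos : 0 < rho <= 1).
  { split; [|unfold rho; lra].
    specialize (Hrho0 1 (Rle_refl 1)); assert (0 < U iR1 1 / U iR2 1) by (apply Rdiv_lt_0_compat; lra).
    unfold rho; lra. }
  assert (Hsig_le : 0 <= sig <= 1).
  { split; [easy|]; specialize (Hsig1 1 (Rle_refl 1)).
    assert (U iR3 1 / U iR2 1 <= 1); [apply Rle_div_l; lra | lra]. }
  set (M := U ixi 1 + K + U iR2 1 * E 1).
  assert (HM : forall i r, 1 <= r -> Rabs (U i r) <= M).
  { intros i r Hr; destruct (global_bounds r Hr) as [C0 [C3 [C2 [C1 [C5 C6]]]]]; fold K in C1, C3.
    assert (HER : U iR2 r <= U iR2 1 * E 1).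
    { apply Rle_trans with (U iR2 r * E r); [|apply Hdec; lra].
      rewrite <- (Rmult_1_r (U iR2 r)) at 1; apply Rmult_le_compat_l; [lra|].
      unfold E; rewrite <- exp_0 at 1.
      assert (0 <= K / c * exp (- (c * (r - 1)))) as [h0|h0].
      { apply Rmult_le_pos; [apply Rdiv_le_0_compat; lra | left; apply exp_pos]. }
      - left; now apply exp_increasing.
      - rewrite <- h0; lra. }
    apply Rabs_le; unfold M; destruct i; lra. }
  assert (HM0 : 0 <= M) by (eapply Rle_trans; [apply Rabs_pos | apply (HM ixi 1 (Rle_refl 1))]).
  assert (HG : forall i r, 1 <= r -> Rabs (G (fun j => U j r) i) <= 16 * M * M).
  { intros i r Hr; rewrite <- (Gc_id M) by (intros; now apply HM); now apply Gc_bound. }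
  (* The sum of squares is - xi' with xi convergent, and its derivative is bounded because all
     coordinates are. *)
  assert (HLL : limi (fun r => U iL1 r ^ 2 + U iL2 r ^ 2 + U iL3 r ^ 2) 0).
  { apply (limi_integrable (U ixi) _ (fun r => 2 * U iL1 r * G (fun j => U j r) iL1
      + 2 * U iL2 r * G (fun j => U j r) iL2 + 2 * U iL3 r * G (fun j => U j r) iL3) 1 x
      (3 * (2 * (M * (16 * M * M))))); [| | | |exact Hx].
    - intros r Hr; apply (global_ode r); lra.
    - intros r Hr; pose proof (global_ode r ltac:(lra)) as Ho.
      apply dplus; [apply dplus|]; apply dsqr; apply Ho.
    - intros; repeat apply Rplus_le_le_0_compat; apply pow2_ge_0.
    - intros r Hr.
      assert (Hp : forall i, - (M * (16 * M * M)) <= U i r * G (fun j => U j r) i <= M * (16 * M * M)).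
      { intros i; apply Rabs_le_between; rewrite Rabs_mult.
        apply Rmult_le_compat; try apply Rabs_pos; [now apply HM | now apply HG]. }
      pose proof (Hp iL1); pose proof (Hp iL2); pose proof (Hp iL3); apply Rabs_le; lra. }
  assert (HL : forall i, i = iL1 \/ i = iL2 \/ i = iL3 -> limi (U i) 0).
  { intros i Hi; apply (limi_of_sq _ _ 1 HLL); intros r _.
    pose proof (fun j => pow2_ge_0 (U j r)) as sq; pose proof (sq iL1); pose proof (sq iL2).
    pose proof (sq iL3); destruct Hi as [->|[->| ->]]; lra. }
  assert (HL2 : limi (U iL2) 0) by (apply HL; tauto).
  (* The limit of L2' must vanish since [L2] converges. *)
  assert (HS : h * h / 2 - (sig * h - rho * h) * (sig * h - rho * h) / 2 = 0).
  { apply (limi_derive_0 (U iL2) (fun r => - U ixi r * U iL2 r + (U iR2 r * U iR2 r * / 2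
      - (U iR3 r - U iR1 r) * (U iR3 r - U iR1 r) * / 2)) 1 _ 0); [| exact HL2 |].
    - intros r Hr; eapply is_derive_cv; [apply (global_ode r); lra | cbn [G]; field].
    - pose proof (limi_minus _ _ _ _ HR3 HR1) as H31.
      eapply limi_eq; [exact (limi_plus _ _ _ _ (limi_mult _ _ _ _ (limi_opp _ _ Hx) HL2)
        (limi_minus _ _ _ _ (limi_mult _ _ _ _ (limi_mult _ _ _ _ HR2 HR2) (limi_const (/ 2)))
          (limi_mult _ _ _ _ (limi_mult _ _ _ _ H31 H31) (limi_const (/ 2))))) | field]. }
  assert (Hh2 : h * h * (1 - (sig - rho) * (sig - rho)) = 0) by lra.
  assert (Hfin : rho * h = h /\ sig * h = 0).
  { apply Rmult_integral in Hh2; destruct Hh2 as [e|e].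
    - apply Rmult_integral in e; assert (h = 0) as -> by tauto; lra.
    (* (sig - rho)^2 = 1 with both in [0, 1]; [rho > 0], due to the growth of R1 / R2, excludes
       (sig, rho) = (1, 0). *)
    - assert (sig = 0) by nra; subst sig; assert (rho = 1) by nra; split; [rewrite H|]; ring. }
  destruct Hfin as [F1 F2]; rewrite F1 in HR1; rewrite F2 in HR3.
  exists x, h; repeat split; try easy; try (apply HL; tauto); lra.
Qed.

End Limits.

(** * From the radial solutions to system (F) *)

Definition state (f0 f1 f2 f3 f4 f5 f6 : R -> R) (i : ix) : R -> R :=
  match i with
  | ixi => f0 | iL1 => f1 | iL2 => f2 | iL3 => f3 | iR1 => f4 | iR2 => f5 | iR3 => f6
  end.

Lemma smooth_lim0 e : smooth e -> e 0 = 0 -> lim0 e 0.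
Proof.
  intros H H0; eapply lim0_eq; [apply lim0_cont, (ex_derive_continuous e), (H 1%nat 0) | exact H0].
Qed.

Lemma w_ode U r : ode U r ->
  is_derive (fun r => U ixi r - U iL1 r - U iL2 r - U iL3 r) r
    (- U ixi r * (U ixi r - U iL1 r - U iL2 r - U iL3 r) + energy U r).
Proof. intros H; getode H; derive_as; unfold energy; field. Qed.

(** With e the constant value of [energy], (r w)' = r (e - (xi - 1/r) w), so w / r tends to e / 2.
    Comparing with the prescribed limit identifies e as 2 al. *)
Lemma radial_sol_sol T al be ga xi L1 L2 L3 R1 R2 R3 :
  0 < T -> radial_sol T al be ga xi L1 L2 L3 R1 R2 R3 ->
  sol al be ga T (state xi L1 L2 L3 R1 R2 R3).
Proof.
  intros HT [e0 [e1 [e2 [e3 [e4 [e5 [e6 [s0 [s1 [s2 [s3 [s4 [s5 [s6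
    [z0 [z1 [z2 [z3 [z4 [z5 [z6 [Heq [Hd [Hal [Hbe _]]]]]]]]]]]]]]]]]]]]]]]]].
  set (U := state xi L1 L2 L3 R1 R2 R3).
  assert (HO : forall r, 0 < r <= T -> ode U r).
  { intros r Hr; destruct (Hd r Hr) as [h0 [h1 [h2 [h3 [h4 [h5 h6]]]]]]; intros i; destruct i; assumption. }
  pose proof (smooth_lim0 e0 s0 z0) as l0; pose proof (smooth_lim0 e1 s1 z1) as l1.
  pose proof (smooth_lim0 e2 s2 z2) as l2; pose proof (smooth_lim0 e3 s3 z3) as l3.
  pose proof (smooth_lim0 e5 s5 z5) as l5; pose proof (smooth_lim0 e6 s6 z6) as l6.
  assert (X : forall f g l, (forall r, 0 < r <= T -> f r = g r) -> lim0 f l -> lim0 g l)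
    by (intros f g l; now apply lim0_ext).
  assert (A0 : lim0 (fun r => U ixi r - 1 / r) 0).
  { apply (X e0); [|easy]; intros r Hr; destruct (Heq r Hr) as [h _]; cbn; rewrite h; ring. }
  assert (A1 : lim0 (fun r => U iL1 r - 1 / r) 0).
  { apply (X e1); [|easy]; intros r Hr; destruct (Heq r Hr) as [_ [h _]]; cbn; rewrite h; ring. }
  assert (A2 : lim0 (U iL2) ga).
  { apply (X (fun r => ga + e2 r)); [|eapply lim0_eq; [lim0s | ring]].
    intros r Hr; destruct (Heq r Hr) as [_ [_ [h _]]]; now symmetry. }
  assert (A3 : lim0 (U iL3) (- ga)).
  { apply (X (fun r => - ga + e3 r)); [|eapply lim0_eq; [lim0s | ring]].
    intros r Hr; destruct (Heq r Hr) as [_ [_ [_ [h _]]]]; now symmetry. }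
  assert (A5 : lim0 (fun r => U iR2 r - 1 / (2 * r)) ga).
  { apply (X (fun r => ga + e5 r)); [|eapply lim0_eq; [lim0s | ring]].
    intros r Hr; destruct (Heq r Hr) as [_ [_ [_ [_ [_ [h _]]]]]]; cbn; rewrite h; ring. }
  assert (A6 : lim0 (fun r => U iR3 r - 1 / (2 * r)) (- ga)).
  { apply (X (fun r => - ga + e6 r)); [|eapply lim0_eq; [lim0s | ring]].
    intros r Hr; destruct (Heq r Hr) as [_ [_ [_ [_ [_ [_ h]]]]]]; cbn; rewrite h; ring. }
  split; [easy | split].
  - assert (HE : forall r, 0 < r <= T -> energy U r = energy U T).
    { intros r Hr; apply energy_const; [lra|]; intros; apply HO; lra. }
    set (w := fun r => U ixi r - U iL1 r - U iL2 r - U iL3 r).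
    assert (Aw : lim0 w 0).
    { apply (X (fun r => (U ixi r - 1 / r) - (U iL1 r - 1 / r) - U iL2 r - U iL3 r));
        [intros; unfold w; ring|].
      eapply lim0_eq; [exact (lim0_minus _ _ _ _ (lim0_minus _ _ _ _ (lim0_minus _ _ _ _ A0 A1) A2) A3) | ring]. }
    assert (Hq : lim0 (fun r => r * w r / r ^ 2) (energy U T / 2)).
    { apply (lim0_quadratic _ (fun r => energy U T - (U ixi r - 1 / r) * w r) _ T HT).
      - eapply lim0_eq; [exact (lim0_mult _ _ _ _ lim0_id Aw) | ring].
      - intros r Hr; pose proof (w_ode U r (HO r Hr)) as Hw; rewrite (HE r Hr) in Hw.
        eapply is_derive_cv; [exact (dmult _ _ _ _ _ (did r) Hw) | unfold w; field; lra].
      - eapply lim0_eq; [exact (lim0_minus _ _ _ _ (lim0_const (energy U T)) (lim0_mult _ _ _ _ A0 Aw)) | ring]. }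
    assert (Hal' : lim0 (fun r => r * w r / r ^ 2) al).
    { apply (X (fun r => (xi r - L1 r - L2 r - L3 r) / r)); [|exact Hal].
      intros r Hr; unfold w, U, state; field; lra. }
    pose proof (lim0_unique _ _ _ Hq Hal') as E.
    intros r Hr; rewrite (HE r Hr); lra.
  - repeat split; easy.
Qed.

Lemma inverse_flow (g : R -> R) c T :
  0 < c -> (forall x, c <= g x) -> (forall x, continuous g x) ->
  exists rho : R -> R, rho 0 = T /\ (forall s, is_derive rho s (/ g (rho s))) /\
    (forall s t, s <= t -> rho s <= rho t) /\ forall M, exists s0, forall s, s0 < s -> M < rho s.
Proof.
  intros Hc Hg Hcont.
  set (S := fun x => RInt g T x).
  assert (HS : forall x, is_derive S x (g x)) by (intros; now apply prim_aux).
  assert (Hgrow : forall x y, x <= y -> c * (y - x) <= S y - S x).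
  { intros x y Hxy; assert (S x - c * x <= S y - c * y); [|lra].
    apply (incr_on (fun x => S x - c * x) (fun x => g x - c)); [easy | |].
    - intros z _; pose proof (HS z); derive_as; ring.
    - intros z _; specialize (Hg z); lra. }
  assert (HST : S T = 0) by (unfold S; rewrite RInt_point; reflexivity).
  assert (Hsurj : forall s, exists x, S x = s).
  { intros s; set (u := Rabs s / c + 1).
    assert (Hu : 0 < u).
    { assert (0 <= Rabs s / c) by (apply Rdiv_le_0_compat; [apply Rabs_pos | easy]); unfold u; lra. }
    assert (Hcu : c * u = Rabs s + c) by (unfold u; field; lra).
    pose proof (Hgrow T (T + u) ltac:(lra)); pose proof (Hgrow (T - u) T ltac:(lra)).
    pose proof (Rle_abs s); pose proof (Rle_abs (- s)); rewrite Rabs_Ropp in *.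
    destruct (IVT_gen S (T - u) (T + u) s) as [x [_ Hx]].
    - intros x; apply continuity_pt_filterlim, (is_derive_cont _ _ _ (HS x)).
    - rewrite Rmin_left, Rmax_right by lra; lra.
    - now exists x. }
  set (rho := fun s => proj1_sig (constructive_indefinite_description _ (Hsurj s))).
  assert (Hrho : forall s, S (rho s) = s) by (intros s; unfold rho; apply proj2_sig).
  assert (Hmono : forall s t, s <= t -> rho s <= rho t).
  { intros s t Hst; destruct (Rle_lt_dec (rho s) (rho t)) as [|h]; [easy|exfalso].
    pose proof (Hgrow (rho t) (rho s) ltac:(lra)); rewrite !Hrho in H; nra. }
  assert (Hinj : forall x, rho (S x) = x).
  { intros x; destruct (Rle_lt_dec (rho (S x)) x) as [h|h].
    - pose proof (Hgrow _ _ h); rewrite Hrho in H; nra.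
    - pose proof (Hgrow x (rho (S x)) ltac:(lra)); rewrite Hrho in H; nra. }
  assert (Hlip : forall s t, Rabs (rho s - rho t) <= Rabs (s - t) / c).
  { assert (Hl : forall s t, s <= t -> Rabs (rho t - rho s) <= Rabs (t - s) / c).
    { intros s t Hst; pose proof (Hmono s t Hst); rewrite !Rabs_right by lra.
      apply Rle_div_r; [easy|]; pose proof (Hgrow _ _ H); rewrite !Hrho in *; lra. }
    intros s t; destruct (Rle_lt_dec s t).
    - rewrite Rabs_minus_sym, (Rabs_minus_sym s t); now apply Hl.
    - apply Hl; lra. }
  exists rho; split; [|split; [|split; [exact Hmono|]]].
  - rewrite <- HST; apply Hinj.
  - intros s; apply is_derive_Reals; intros e He.
    pose proof (HS (rho s)) as Hd; apply is_derive_Reals in Hd.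
    assert (Hce : 0 < c * c * e) by (repeat apply Rmult_lt_0_compat; lra).
    destruct (Hd (c * c * e) Hce) as [d H].
    assert (Hdc : 0 < d * c) by (apply Rmult_lt_0_compat; [apply cond_pos | easy]).
    exists (mkposreal _ Hdc); intros h Hh Hhd; cbn in Hhd.
    set (k := rho (s + h) - rho s).
    assert (Hk : k <> 0).
    { intros E; assert (E' : rho (s + h) = rho s) by (unfold k in E; lra).
      apply (f_equal S) in E'; rewrite !Hrho in E'; lra. }
    assert (Hkd : Rabs k < d).
    { eapply Rle_lt_trans; [apply Hlip|]; apply Rlt_div_l; [easy|].
      replace (s + h - s) with h by ring; easy. }
    specialize (H k Hk Hkd); replace (rho s + k) with (rho (s + h)) in H by (unfold k; ring).
    rewrite !Hrho in H; replace (s + h - s) with h in H by ring.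
    assert (Hhk : c <= h / k).
    { destruct (Rle_lt_dec 0 k) as [hk|hk].
      - apply Rle_div_r; [lra|]; pose proof (Hgrow (rho s) (rho (s + h)) ltac:(unfold k in *; lra)) as Q.
        rewrite !Hrho in Q; unfold k; lra.
      - replace (h / k) with (- h / - k) by (field; easy).
        apply Rle_div_r; [lra|]; pose proof (Hgrow (rho (s + h)) (rho s) ltac:(unfold k in *; lra)) as Q.
        rewrite !Hrho in Q; unfold k; lra. }
    pose proof (Hg (rho s)) as Hgs; set (G0 := g (rho s)) in *; set (q := h / k) in *.
    replace (k / h - / G0) with ((G0 - q) / (G0 * q)) by (unfold q; field; lra).
    assert (Hgq : c * c <= G0 * q) by (apply Rmult_le_compat; lra).
    assert (Hcc : 0 < c * c) by (apply Rmult_lt_0_compat; lra).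
    unfold Rdiv; rewrite Rabs_mult, (Rabs_right (/ (G0 * q)))
      by (left; apply Rinv_0_lt_compat; lra).
    apply Rlt_div_l; [lra|]; rewrite Rabs_minus_sym.
    eapply Rlt_le_trans; [exact H|]; rewrite (Rmult_comm e); apply Rmult_le_compat_r; lra.
  - intros M; exists (S M); intros s Hs.
    destruct (Rle_lt_dec (rho s) M) as [h|h]; [|easy].
    exfalso; pose proof (Hgrow _ _ h) as Q; rewrite Hrho in Q; nra.
Qed.

Lemma limi_comp (f rho : R -> R) l :
  (forall M, exists s0, forall s, s0 < s -> M < rho s) -> limi f l -> limi (fun s => f (rho s)) l.
Proof.
  intros Hr Hf; apply limi_eps; intros e He.
  destruct (proj1 (limi_eps f l) Hf e He) as [M HM], (Hr M) as [s0 H0].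
  exists s0; intros s Hs; apply HM, H0, Hs.
Qed.

Lemma F_solution T x a1 a2 a3 (U : ix -> R -> R) :
  0 < T -> 0 < x -> (forall r, 0 < r -> ode U r) -> (forall r, 0 < r -> x <= U ixi r) ->
  limi (U ixi) x -> limi (U iL1) 0 -> limi (U iL2) 0 -> limi (U iL3) 0 ->
  limi (U iR1) a1 -> limi (U iR2) a2 -> limi (U iR3) a3 ->
  exists Lc X1 X2 X3 Y1 Y2 Y3 : R -> R,
    F_sol_from (chg (val_at T (U ixi) (U iL1) (U iL2) (U iL3) (U iR1) (U iR2) (U iR3)))
      Lc X1 X2 X3 Y1 Y2 Y3 /\
    limi Lc (/ x) /\ limi X1 0 /\ limi X2 0 /\ limi X3 0 /\
    limi Y1 (/ x * a1) /\ limi Y2 (/ x * a2) /\ limi Y3 (/ x * a3).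
Proof.
  intros HT Hx HO Hxi lx l1 l2 l3 m1 m2 m3.
  (* Clamping at T / 2 keeps xi away from its pole; for s >= 0 the radius is at least T, where the
     clamp has no effect. *)
  destruct (inverse_flow (fun r => U ixi (Rmax (T / 2) r)) x T Hx) as [rho [Hr0 [Hrd [Hrm Hrinf]]]].
  - intros y; apply Hxi; pose proof (Rmax_l (T / 2) y); lra.
  - intros y; apply continuous_intro; intros e He.
    assert (Hm : 0 < Rmax (T / 2) y) by (pose proof (Rmax_l (T / 2) y); lra).
    destruct (cont_eps _ _ (ode_cont U _ ixi (HO _ Hm)) e He) as [d [Hd H]].
    exists d; split; [easy|]; intros z Hz; apply H; eapply Rle_lt_trans; [|exact Hz].
    unfold Rmax; repeat destruct Rle_dec; unfold Rabs; repeat destruct Rcase_abs; lra.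
  - assert (HrT : forall s, 0 <= s -> T <= rho s) by (intros s Hs; rewrite <- Hr0; now apply Hrm).
    assert (HD : forall i s, 0 <= s ->
      is_derive (fun s => U i (rho s)) s (/ U ixi (rho s) * G (fun j => U j (rho s)) i)).
    { intros i s Hs; specialize (HrT s Hs).
      eapply is_derive_cv; [apply (is_derive_comp (U i) rho); [apply HO; lra | apply Hrd]|].
      rewrite Rmax_right by lra; reflexivity. }
    assert (Hpos : forall s, 0 <= s -> 0 < U ixi (rho s)).
    { intros s Hs; specialize (HrT s Hs); specialize (Hxi (rho s) ltac:(lra)); lra. }
    set (V := fun i s => U i (rho s)).
    set (Lc := fun s => / V ixi s); set (X := fun i s => / V ixi s * V i s).
    set (Q := fun s => X iL1 s ^ 2 + X iL2 s ^ 2 + X iL3 s ^ 2).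
    assert (DL : forall s, 0 <= s -> is_derive Lc s (Lc s * Q s)).
    { intros s Hs; pose proof (HD ixi s Hs) as D; specialize (Hpos s Hs); fold (V ixi) in D.
      unfold Lc; eapply is_derive_cv; [apply dinv; [unfold V; lra | exact D]|].
      unfold Q, X, V; cbn [G]; field; lra. }
    assert (DX : forall i s, 0 <= s ->
      is_derive (X i) s (Lc s * Q s * V i s + Lc s * (/ U ixi (rho s) * G (fun j => U j (rho s)) i))).
    { intros i s Hs; exact (dmult _ _ _ _ _ (DL s Hs) (HD i s Hs)). }
    assert (HF : forall s, 0 <= s ->
      is_derive Lc s (Lc s * Q s) /\
      is_derive (X iL1) s (X iR1 s ^ 2 / 2 - (X iR2 s - X iR3 s) ^ 2 / 2 - X iL1 s + X iL1 s * Q s) /\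
      is_derive (X iL2) s (X iR2 s ^ 2 / 2 - (X iR3 s - X iR1 s) ^ 2 / 2 - X iL2 s + X iL2 s * Q s) /\
      is_derive (X iL3) s (X iR3 s ^ 2 / 2 - (X iR1 s - X iR2 s) ^ 2 / 2 - X iL3 s + X iL3 s * Q s) /\
      is_derive (X iR1) s (X iR1 s * (X iL1 s - X iL2 s - X iL3 s + Q s)) /\
      is_derive (X iR2) s (X iR2 s * (X iL2 s - X iL3 s - X iL1 s + Q s)) /\
      is_derive (X iR3) s (X iR3 s * (X iL3 s - X iL1 s - X iL2 s + Q s))).
    { intros s Hs; specialize (Hpos s Hs); split; [now apply DL|].
      split; [|split; [|split; [|split; [|split]]]]; (eapply is_derive_cv; [now apply DX|]);
      unfold Lc, Q, X, V; cbn [G]; field; lra. }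
    exists Lc, (X iL1), (X iL2), (X iL3), (X iR1), (X iR2), (X iR3); split.
    + assert (E : forall i, X i 0 = / U ixi T * U i T) by (intros i; unfold X, V; now rewrite Hr0).
      split; [unfold Lc, V; now rewrite Hr0|].
      do 6 (split; [rewrite E; reflexivity|]).
      split; [apply lim0_cont; eapply is_derive_cont, DL; lra|].
      do 6 (split; [apply lim0_cont; eapply is_derive_cont, DX; lra|]).
      intros s Hs; apply HF; lra.
    + assert (LC : limi Lc (/ x)).
      { apply limi_inv; [lra|]; now apply (limi_comp (U ixi)). }
      assert (LX : forall i l, limi (U i) l -> limi (X i) (/ x * l)).
      { intros i l H; apply limi_mult; [exact LC | now apply (limi_comp (U i))]. }
      assert (LX0 : forall i, limi (U i) 0 -> limi (X i) 0).
      { intros i H; eapply limi_eq; [exact (LX i 0 H) | ring]. }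
      auto 10.
Qed.

Lemma sol_phi T phi al be ga U :
  0 < T ->
  (exists xi L1 L2 L3 R1 R2 R3 : R -> R, radial_sol T al be ga xi L1 L2 L3 R1 R2 R3 /\
    phi = val_at T xi L1 L2 L3 R1 R2 R3) ->
  sol al be ga T U ->
  phi = val_at T (U ixi) (U iL1) (U iL2) (U iL3) (U iR1) (U iR2) (U iR3).
Proof.
  intros HT [xi [L1 [L2 [L3 [R1 [R2 [R3 [Hrad ->]]]]]]]] HU.
  pose proof (radial_sol_sol _ _ _ _ _ _ _ _ _ _ _ HT Hrad) as HV.
  assert (E : forall i, state xi L1 L2 L3 R1 R2 R3 i T = U i T).
  { intros i; apply (sol_unique al be ga T); lra || easy. }
  unfold val_at; f_equal; [apply (E ixi) | apply (E iL1) | apply (E iL2) | apply (E iL3)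
    | apply (E iR1) | apply (E iR2) | apply (E iR3)].
Qed.

Theorem theorem5p2 (T : R) (phi : R -> R -> R -> st7)
  (HT : 0 < T)
  (Hphi_gt1 : forall al be ga, al ^ 2 + be ^ 2 + ga ^ 2 = 1 ->
     1 < c0 (phi al be ga))
  (Hphi_ex : forall al be ga, al ^ 2 + be ^ 2 + ga ^ 2 = 1 ->
     exists xi L1 L2 L3 R1 R2 R3 : R -> R,
       radial_sol T al be ga xi L1 L2 L3 R1 R2 R3 /\
       phi al be ga = val_at T xi L1 L2 L3 R1 R2 R3)
  (Hphi_uniq : forall al be ga, al ^ 2 + be ^ 2 + ga ^ 2 = 1 ->
     forall xi L1 L2 L3 R1 R2 R3 : R -> R,
       radial_sol T al be ga xi L1 L2 L3 R1 R2 R3 ->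
       phi al be ga = val_at T xi L1 L2 L3 R1 R2 R3) :
  exists i1 i2 : R, i1 < 0 < i2 /\
    forall ga : R, i1 < ga < i2 ->
      exists al be : R,
        al ^ 2 + be ^ 2 + ga ^ 2 = 1 /\
        exists Lc X1 X2 X3 Y1 Y2 Y3 : R -> R,
          F_sol_from (chg (phi al be ga)) Lc X1 X2 X3 Y1 Y2 Y3 /\
          exists l a b c : R,
            is_lim Lc p_infty l /\
            is_lim X1 p_infty 0 /\ is_lim X2 p_infty 0 /\ is_lim X3 p_infty 0 /\
            is_lim Y1 p_infty a /\ is_lim Y2 p_infty b /\ is_lim Y3 p_infty c /\
            0 < l /\ ((a = b /\ c = 0) \/ (a = c /\ b = 0)).
Proof.
  destruct (trapped_parameters T HT) as [g [Hg Hpar]].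
  { intros al be ga H; destruct (Hphi_ex al be ga H) as [xi [L1 [L2 [L3 [R1 [R2 [R3 [Hrad _]]]]]]]].
    eexists; now apply radial_sol_sol with (1 := HT) (2 := Hrad). }
  exists (- g), g; split; [lra|]; intros ga Hga.
  (* The sphere condition is even in ga, so the pair found for |ga| serves both signs; for ga < 0
     the solution is then exchanged by [swap23], which moves the vanishing limit from the third to
     the second Y. *)
  destruct (Hpar (Rabs ga)) as [al [be [Hal [Hbe [Hs [W HW]]]]]].
  { split; [apply Rabs_pos | apply Rabs_def1; lra]. }
  rewrite pow2_abs in Hs.
  exists al, be; split; [exact Hs|].
  assert (HWs : forall b, 0 < b -> sol al be (Rabs ga) b W) by (intros; now apply HW).
  assert (HWt : forall b, 0 < b -> trapped b W) by (intros; now apply HW).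
  destruct (trapped_limits al be (Rabs ga) W Hal Hbe (Rabs_pos ga) HWs HWt)
    as [x [a [Hx [Hxle [lx [l1 [l2 [l3 [m1 [m2 m3]]]]]]]]]].
  assert (Hxi : forall r, 0 < r -> x <= W ixi r).
  { intros r Hr; destruct (Rle_lt_dec 1 r); [now apply Hxle|].
    apply Rle_trans with (W ixi 1); [apply Hxle; lra|].
    apply (trapped_xi_decr al be (Rabs ga) 2 W (HWs 2 ltac:(lra))); lra. }
  assert (HO : forall r, 0 < r -> ode W r) by (intros r Hr; apply (HWs r Hr); lra).
  assert (Hix : 0 < / x) by now apply Rinv_0_lt_compat.
  destruct (Rle_lt_dec 0 ga) as [h|h].
  - assert (HWT := HWs T HT); rewrite Rabs_right in HWT by lra.
    rewrite (sol_phi T (phi al be ga) al be ga W HT (Hphi_ex al be ga Hs) HWT).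
    destruct (F_solution T x a a 0 W HT Hx HO Hxi lx l1 l2 l3 m1 m2 m3)
      as [Lc [X1 [X2 [X3 [Y1 [Y2 [Y3 [HF [k0 [k1 [k2 [k3 [k4 [k5 k6]]]]]]]]]]]]]].
    exists Lc, X1, X2, X3, Y1, Y2, Y3; split; [exact HF|].
    exists (/ x), (/ x * a), (/ x * a), (/ x * 0); do 8 (split; [assumption|]).
    left; split; [reflexivity | ring].
  - assert (HVs : forall b, 0 < b -> sol al be ga b (swap23 W)).
    { intros b Hb; pose proof (swap23_sol _ _ _ _ _ (HWs b Hb)) as H.
      rewrite Rabs_left, Ropp_involutive in H by lra; exact H. }
    rewrite (sol_phi T (phi al be ga) al be ga (swap23 W) HT (Hphi_ex al be ga Hs) (HVs T HT)).
    destruct (F_solution T x a 0 a (swap23 W) HT Hx (fun r Hr => proj1 (HVs r Hr) r (conj Hr (Rle_refl r)))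
      Hxi lx l1 l3 l2 m1 m3 m2)
      as [Lc [X1 [X2 [X3 [Y1 [Y2 [Y3 [HF [k0 [k1 [k2 [k3 [k4 [k5 k6]]]]]]]]]]]]]].
    exists Lc, X1, X2, X3, Y1, Y2, Y3; split; [exact HF|].
    exists (/ x), (/ x * a), (/ x * 0), (/ x * a); do 8 (split; [assumption|]).
    right; split; [reflexivity | ring].
Qed.
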